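(* Let $B_H=\{B_H(t)\}_{t\in\mathbb{R}}$ be an $\mathbb{R}^n$-valued operator fractional Brownian motion such that $\Re(AA^* )$ has full rank and $\Im(AA^* )=0$, and suppose that $H$ has Jordan form $$H=PJ_HP^{-1},\quad J_H=\mathrm{diag}(J_{h_1},\ldots,J_{h_{n'}}),\quad 1\le n'\le n,\quad 0<\Re h_1\le \Re h_2\le\cdots\le\Re h_{n'}<1,$$ where $P\in GL(n,\mathbb{C})$ has columns of unit norm and $J_{h_i}$ is a Jordan block with eigenvalue $h_i\in\mathbb{C}$ and size $n_i$ (so $n_1+\cdots+n_{n'}=n$). Fix $j\in\mathbb{N}$. Then, as $\nu\to\infty$, for every $q=1,\ldots,n$, $$\frac{\log\lambda_q(W_a(a(\nu)2^j))}{2\log a(\nu)}\stackrel{P}{\to}\Re h_{q'},\qquad \frac{\log\lambda_q(\mathbb{E}W_a(a(\nu)2^j))}{2\log a(\nu)}\to\Re h_{q'},$$ where $q'\in\{1,\ldots,n'\}$ is the index such that $n_1+\cdots+n_{q'-1}<q\le n_1+\cdots+n_{q'}$. In particular, if $n'=n$ and the eigenvalues are real with $h_1<\cdots<h_n$, then for every $q=1,\ldots,n$, $$\frac{\log\lambda_q(W_a(a(\nu)2^j))}{2\log a(\nu)}\stackrel{P}{\to}h_q,\qquad \frac{\log\lambda_q(\mathbb{E}W_a(a(\nu)2^j))}{2\log a(\nu)}\to h_q .$$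
   Context: Notation: $A^*$ is the conjugate transpose; $c^{M}=\exp(\log(c)\,M)$ for $c>0$ and a square matrix $M$; $\lambda_1(S)\le\cdots\le\lambda_n(S)$ are the ordered eigenvalues of a Hermitian positive semidefinite $n\times n$ matrix $S$; $\stackrel{P}{\to}$ is convergence in probability. Operator fractional Brownian motion (OFBM). Let $n\ge2$, let $H$ be a real $n\times n$ matrix all of whose eigenvalues have real part in $(0,1)$, put $D=H-\frac12 I$, and let $A\in M(n,\mathbb{C})$. The OFBM $B_H$ with parameters $(H,A)$ is the $\mathbb{R}^n$-valued Gaussian process given, in the sense of finite-dimensional distributions, by $$B_H(t)=\int_{\mathbb{R}}\frac{e^{\mathbf{i}tx}-1}{\mathbf{i}x}\{x_+^{-D}A+x_-^{-D}\overline{A}\}\,\widetilde B(dx),$$ where $x_\pm=\max\{\pm x,0\}$, $x_\pm^{-D}$ is understood to be $0$ when $x_\pm=0$, and $\widetilde B$ is a $\mathbb{C}^n$-valued Gaussian random measure with $\widetilde B(-dx)=\overline{\widetilde B(dx)}$ and $\mathbb{E}\widetilde B(dx)\widetilde B(dx)^*=dx\,I$. It has stationary increments and satisfies $\{B_H(ct)\}_t\stackrel{\mathcal L}{=}\{c^HB_H(t)\}_t$ for $c>0$. Wavelet. $\psi\in L^1(\mathbb{R})$ is a real function with $\int\psi^2=1$, $\int t^p\psi(t)dt=0$ for $p=0,\ldots,N_\psi-1$, where $N_\psi\ge2$; $\mathrm{supp}(\psi)$ is a compact interval; and for some $\alpha>1$, $\sup_{x}|\widehat\psi(x)|(1+|x|)^\alpha<\infty$,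 with $\widehat\psi$ the Fourier transform. The wavelet transform is $D(2^j,k)=2^{-j/2}\int_{\mathbb{R}}2^{-j/2}\psi(2^{-j}t-k)B_H(t)\,dt\in\mathbb{R}^n$, $j\in\mathbb{N}\cup\{0\}$, $k\in\mathbb{Z}$. Scaling factor. For sample size $\nu\in\mathbb{N}$, $a(\nu)$ is a power of $2$ with $a(\nu)\le\nu/2^j$ (for the octaves $j$ in use) and $$\frac{a(\nu)}{\nu}+\frac{\nu}{a(\nu)^{1+2\varpi_0}}\to0,\quad\nu\to\infty.$$ Here, if $\rho_1\le\cdots\le\rho_n$ are the real parts of the eigenvalues of $H$ (with multiplicity) and $\delta=\min_{q_1<q_2}(\rho_{q_2}-\rho_{q_1})$, then $\varpi_0=\min\{\rho_1,\delta\}$ if $\delta>0$ and $\varpi_0=\rho_1$ if $\delta=0$. Sample wavelet variance. $W_a(a(\nu)2^j)=\frac1{K_{a,j}}\sum_{k=1}^{K_{a,j}}D(a(\nu)2^j,k)D(a(\nu)2^j,k)^*$ with $K_{a,j}=\nu/(a(\nu)2^j)$; $\nu$ ranges over values for which $K_{a,j}$ is an integer. *)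

(* Defs.v *)
From HB Require Import structures.
From mathcomp Require Import all_boot all_order all_algebra.
From mathcomp Require Import complex.
From mathcomp Require Import all_classical all_reals all_analysis.

Set Implicit Arguments.
Unset Strict Implicit.
Unset Printing Implicit Defensive.

Import Order.TTheory GRing.Theory Num.Theory.
Import numFieldNormedType.Exports.
Import Normc.

Local Open Scope classical_set_scope.
Local Open Scope complex_scope.
Local Open Scope ring_scope.

Section matrices.
Variable R : realType.
Local Notation C := R[i].

Definition cplxmx m n (M : 'M[R]_(m, n)) : 'M[C]_(m, n) :=
  map_mx (real_complex R) M.
Definition conjmx m n (M : 'M[C]_(m, n)) : 'M[C]_(m, n) := map_mx conjc M.
Definition adjmx m n (M : 'M[C]_(m, n)) : 'M[C]_(n, m) := (conjmx M)^T.

Definition mxnorm2 m n (M : 'M[C]_(m, n)) : R :=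
  \sum_(i < m) \sum_(j < n) normc (M i j) ^+ 2.

(* The exponential series, summed entrywise. *)
Definition expmx n (M : 'M[R]_n) : 'M[R]_n :=
  \matrix_(i, j) limn (series (fun k => (k`!%:R)^-1 * (M ^+ k) i j)).

Definition powmx n (c : R) (M : 'M[R]_n) : 'M[R]_n := expmx (ln c *: M).

(* The convention 0^M = 0 of the harmonizable representation. *)
Definition powmx0 n (c : R) (M : 'M[R]_n) : 'M[R]_n :=
  if 0 < c then powmx c M else 0.

(* The roots of the (monic) characteristic polynomial, that is, the
   eigenvalues listed with algebraic multiplicity. *)
Definition eigenvalues n (M : 'M[C]_n) : seq C :=
  sval (closed_field_poly_normal (char_poly M)).

Definition sorted_Re_eigenvalues n (M : 'M[C]_n) : seq R :=
  sort <=%R [seq complex.Re z | z <- eigenvalues M].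

(* The (q+1)-st smallest eigenvalue of a symmetric matrix; its eigenvalues are
   real, so that taking real parts loses nothing. *)
Definition lambda n (q : 'I_n) (S : 'M[R]_n) : R :=
  (sorted_Re_eigenvalues (cplxmx S))`_q.

Definition Jordan_block (z : C) m : 'M[C]_m :=
  \matrix_(i, j) (if i == j then z else if j == i.+1 :> nat then 1 else 0).

(* rho_1 <= ... <= rho_n. *)
Definition rho n (H : 'M[R]_n) (q : 'I_n) : R :=
  (sorted_Re_eigenvalues (cplxmx H))`_q.

(* For n >= 2 the seed of the iterated minimum is one of its terms. *)
Definition delta n (H : 'M[R]_n.+1) : R :=
  \big[Num.min/rho H ord_max - rho H ord0]_(p : 'I_n.+1 * 'I_n.+1
    | (p.1 < p.2)%N) (rho H p.2 - rho H p.1).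

Definition varpi0 n : 'M[R]_n -> R :=
  match n with
  | 0 => fun=> 0
  | n'.+1 => fun H => if 0 < delta H then Num.min (rho H ord0) (delta H)
                      else rho H ord0
  end.

End matrices.

Section gaussian.
Variables (R : realType) (d : measure_display) (T : measurableType d).
Variable Pr : probability T R.
Local Notation C := R[i].
Local Notation mu := (@lebesgue_measure R).

(* [normal_prob 0 0] is not the point mass at 0, whence the case distinction. *)
Definition centered_normal (Y : T -> R) : Prop :=
  measurable_fun [set: T] Y /\
  exists s : R, 0 <= s /\
    forall E : set R, measurable E ->
      Pr (Y @^-1` E) = (if s == 0%R then \d_(0 : R) E else normal_prob 0 s E).

Definition centered_gaussian_process n (X : R -> T -> 'cV[R]_n) : Prop :=
  forall (m : nat) (u : 'I_m -> 'rV[R]_n) (t : 'I_m -> R),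
    centered_normal (fun w => (\sum_(l < m) u l *m X (t l) w) 0 0).

Definition cplx_expectation (Z : T -> C) : C :=
  fine ('E_Pr[fun w => complex.Re (Z w)]) +i*
  fine ('E_Pr[fun w => complex.Im (Z w)]).

Definition finite_borel (E : set R) : Prop :=
  measurable E /\ (mu E < +oo)%E.

(* C^n-valued Gaussian random measure on the line, with
   B(-dx) = conj B(dx) and E B(dx) B(dx)^* = dx I; the latter means
   E B(E) B(F)^* = |E `&` F| I for Borel sets E and F of finite measure.
   Real parts of C-linear combinations of the B(E_l) are the real-linear
   combinations of the real and imaginary parts of their entries.
   Countable additivity in mean square follows from the covariance. *)
Record gaussian_random_measure n (B : set R -> T -> 'cV[C]_n) : Prop := {
  grm_gaussian : forall (m : nat) (u : 'I_m -> 'rV[C]_n) (E : 'I_m -> set R),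
    (forall l, finite_borel (E l)) ->
    centered_normal
      (fun w => complex.Re ((\sum_(l < m) u l *m B (E l) w) 0 0));
  grm_additive : forall E F, finite_borel E -> finite_borel F ->
    E `&` F = set0 -> {ae Pr, forall w, B (E `|` F) w = B E w + B F w};
  grm_hermitian : forall E, finite_borel E ->
    {ae Pr, forall w, B [set x | E (- x)] w = conjmx (B E w)};
  grm_cov : forall E F, finite_borel E -> finite_borel F ->
    forall i k : 'I_n,
    cplx_expectation (fun w => B E w i 0 * (B F w k 0)^*) =
      ((i == k)%:R * fine (mu (E `&` F)))%:C
}.

(* Y is (a version of) the integral of the matrix-valued function f with
   respect to B: the mean-square limit of the integrals of simple functions
   \sum_l c k l 1_(E k l) which tend to f in L^2(dx). *)
Definition is_wiener_integral n (B : set R -> T -> 'cV[C]_n)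
    (f : R -> 'M[C]_n) (Y : T -> 'cV[C]_n) : Prop :=
  (forall i, measurable_fun [set: T] (fun w => complex.Re (Y w i 0)) /\
             measurable_fun [set: T] (fun w => complex.Im (Y w i 0))) /\
  exists (m : nat -> nat) (c : nat -> nat -> 'M[C]_n)
         (E : nat -> nat -> set R),
    [/\ forall k l, finite_borel (E k l),
        (fun k => (\int[mu]_x
           (mxnorm2 (f x - \sum_(l < m k) (\1_(E k l) x)%:C *: c k l))%:E)%E)
          @ \oo --> 0%E
      & (fun k => (\int[Pr]_w
           (mxnorm2 (Y w - \sum_(l < m k) c k l *m B (E k l) w))%:E)%E)
          @ \oo --> 0%E].

End gaussian.

Section ofbm.
Variable R : realType.
Local Notation C := R[i].

Definition expi (x : R) : C := cos x +i* sin x.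

Definition ofbm_kernel n (H : 'M[R]_n) (A : 'M[C]_n) (t x : R) : 'M[C]_n :=
  let D := H - (2^-1)%:M in
  ((expi (t * x) - 1) / ('i%C * x%:C)) *:
    (cplxmx (powmx0 (Num.max x 0) (- D)) *m A +
     cplxmx (powmx0 (Num.max (- x) 0) (- D)) *m conjmx A).

Definition same_fdd n d (T : measurableType d) (Pr : probability T R)
    d' (T' : measurableType d') (Pr' : probability T' R)
    (X : R -> T -> 'cV[R]_n) (X' : R -> T' -> 'cV[R]_n) : Prop :=
  forall (m : nat) (t : 'I_m -> R) (E : 'I_m -> 'I_n -> set R),
    (forall l i, measurable (E l i)) ->
    Pr [set w | forall l i, E l i (X (t l) w i 0)] =
    Pr' [set w | forall l i, E l i (X' (t l) w i 0)].

(* X is an OFBM with parameters (H, A).  The harmonizable representation holds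
   in the sense of finite-dimensional distributions, so the random measure may
   live on another probability space. *)
Definition is_ofbm n (H : 'M[R]_n) (A : 'M[C]_n)
    d (T : measurableType d) (Pr : probability T R)
    (X : R -> T -> 'cV[R]_n) : Prop :=
  [/\ forall z, eigenvalue (cplxmx H) z -> 0 < complex.Re z < 1,
      centered_gaussian_process Pr X
    & exists (d' : measure_display) (T' : measurableType d')
             (Pr' : probability T' R) (B : set R -> T' -> 'cV[C]_n)
             (Y : R -> T' -> 'cV[R]_n),
        [/\ gaussian_random_measure Pr' B,
            forall t, is_wiener_integral Pr' B (ofbm_kernel H A t)
                        (fun w => cplxmx (Y t w))
          & same_fdd Pr Pr' X Y]].

(* Joint measurability in (time, outcome): what the pathwise time integral
   defining the wavelet transform needs in order to be a random variable. *)
Definition measurable_process n d (T : measurableType d)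
    (X : R -> T -> 'cV[R]_n) : Prop :=
  forall i, measurable_fun [set: R * T] (fun p => X p.1 p.2 i 0).

End ofbm.

Section wavelet.
Variable R : realType.
Local Notation C := R[i].
Local Notation mu := (@lebesgue_measure R).

Definition fourier (f : R -> R) (x : R) : C :=
  (\int[mu]_t (cos (x * t) * f t)) +i* (- \int[mu]_t (sin (x * t) * f t)).

Record is_wavelet (psi : R -> R) (N : nat) (alpha : R) : Prop := {
  wavelet_L1 : mu.-integrable [set: R] (EFin \o psi);
  wavelet_norm : (\int[mu]_t (psi t ^+ 2)%:E)%E = 1%E;
  wavelet_N : (2 <= N)%N;
  wavelet_moments : forall p, (p < N)%N ->
    (\int[mu]_t (t ^+ p * psi t)%:E)%E = 0%E;
  wavelet_supp : exists a b : R, closure [set t | psi t != 0] = `[a, b]%classic;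
  wavelet_alpha : 1 < alpha;
  wavelet_decay :
    has_ubound (range (fun x => normc (fourier psi x) * (1 + `|x|) `^ alpha))
}.

(* The wavelet transform D(s, k) at scale s = 2^j, where 2^(-j/2) is written
   s^(-1/2); the integral is taken path by path. *)
Definition wavelet_coef n (T : Type) (psi : R -> R) (X : R -> T -> 'cV[R]_n)
    (s : R) (k : int) (w : T) : 'cV[R]_n :=
  \col_i ((Num.sqrt s)^-1 * \int[mu]_t
    ((Num.sqrt s)^-1 * psi (s^-1 * t - k%:~R) * X t w i 0)).

(* The sample wavelet variance at scale s with K = nu / s terms, used when s
   divides nu; for real vectors the conjugate transpose is the transpose. *)
Definition wavelet_var n (T : Type) (psi : R -> R) (X : R -> T -> 'cV[R]_n)
    (nu s : nat) (w : T) : 'M[R]_n :=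
  let K := (nu %/ s)%N in
  K%:R^-1 *: \sum_(1 <= k < K.+1)
    (wavelet_coef psi X s%:R k%:Z w *m (wavelet_coef psi X s%:R k%:Z w)^T).

Definition mx_expectation n d (T : measurableType d) (Pr : probability T R)
    (M : T -> 'M[R]_n) : 'M[R]_n :=
  \matrix_(i, k) fine ('E_Pr[fun w => M w i k]).

(* The sample sizes nu for which K_(a,j) = nu / (a(nu) 2^j) is an integer. *)
Definition sample_sizes (a : nat -> nat) (j : nat) : set nat :=
  [set nu | (0 < nu)%N /\ (a nu * 2 ^ j %| nu)%N].

(* nu tends to infinity through the admissible sample sizes. *)
Definition nu_infty (a : nat -> nat) (j : nat) : set_system nat :=
  within (sample_sizes a j) \oo.

Record is_scaling_factor n (H : 'M[R]_n) (a : nat -> nat) (j : nat) : Prop := {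
  scaling_pow2 : forall nu, sample_sizes a j nu -> exists m, a nu = (2 ^ m)%N;
  scaling_le : forall nu, sample_sizes a j nu ->
    (a nu)%:R <= nu%:R / 2 ^+ j :> R;
  scaling_cvg :
    (fun nu => (a nu)%:R / nu%:R + nu%:R / (a nu)%:R `^ (1 + 2 * varpi0 H))
      @ nu_infty a j --> (0 : R)
}.

Definition cvg_in_probability d (T : measurableType d) (Pr : probability T R)
    (F : set_system nat) (Z : nat -> T -> R) (l : R) : Prop :=
  forall e : R, 0 < e ->
    (fun nu => Pr [set w | e < `|Z nu w - l|]) @ F --> 0%E.

Definition log_ratio (x c : R) : R := ln x / (2 * ln c).

End wavelet.

(* Main.v *)
Require Import Defs.
From HB Require Import structures.
From mathcomp Require Import all_boot all_order all_algebra.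
From mathcomp Require Import complex.
From mathcomp Require Import all_classical all_reals all_analysis.
From mathcomp Require Import measurable_realfun zify ring lra.
Import Order.TTheory GRing.Theory Num.Theory.
Import numFieldNormedType.Exports.
Import Normc.
Set Implicit Arguments.
Unset Strict Implicit.
Unset Printing Implicit Defensive.
Local Open Scope classical_set_scope.
Local Open Scope complex_scope.
Local Open Scope ring_scope.

(* Let s = a(nu) 2^j and let G be the real part of A A^*.  By self-similarity the
   normalized sample variance s^{-H} W (s^{-H})^T has second and fourth moments
   that depend only on the number of blocks.  The isometry of the Wiener integral
   gives B_H the spectral density x^{-2} |x|^{-D} G (|x|^{-D})^T, so that the
   normalized wavelet coefficients at k and k' have covariance Gam(k - k'), where
     Gam(m) = \int |psi^(x)|^2 cos(m x) x^{-2} |x|^{-D} G (|x|^{-D})^T dx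
   tends to 0 (Riemann-Lebesgue).  By Wick's formula the variance of the
   normalized sample variance is at most a Cesaro mean of |Gam(m)|^2, hence it
   converges in mean square to Gam(0).  Since psi is integrable and nonzero, its
   Fourier transform does not vanish identically, and Gam(0) is positive definite.
   Finally, min-max turns two-sided bounds c I <= S <= C I into bounds of
   lambda_q(s^H S (s^H)^T) by s^{2 Re h_q' -+ epsilon}: conjugating a Jordan block
   by diag(eps^i) makes it almost diagonal, so that s^H expands almost like
   s^{Re h_i} on its coordinates. *)

(** * Ordered eigenvalues and min-max *)

(** The harmonizable representation is given only in law, on a possibly different probability space,
    and as a mean-square limit, whereas the wavelet coefficients are integrals of each path; this
    shapes the proof. Only second moments are transferred to B_H: they give its covariance kernel,
    and self-similarity is used for this kernel alone, as K(cs, ct) = c^H K(s, t) (c^H)^T, read off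
    the scaling of the density. The density need not be integrable at 0; factors 1 - cos tame it
    until both integrations over time are done, when the vanishing mean of psi takes over. The
    wavelet coefficients are never shown to be Gaussian: Wick's formula, obtained for four values of
    B_H from E G^4 = 3 (E G^2)^2, is linear in each slot and passes through the time integrals by
    Fubini. Nor is the exponential of a Jordan block computed: the growth of s^H follows from
    Gronwall's inequality for the energies of groups of blocks. Constants may depend on epsilon,
    since they disappear after division by log a(nu). The two terms of the scaling condition make
    the number of blocks and a(nu) tend to infinity. *)

Section minmax.
Variable R : realType.
Local Notation C := R[i].

(** The squared modulus as a real polynomial in the two coordinates, free of the square root in
    [normc], so that [ring], derivatives and measurability apply to it directly. *)
Definition sqn (z : C) : R := complex.Re z ^+ 2 + complex.Im z ^+ 2.

Lemma normc_sqn (z : C) : normc z ^+ 2 = sqn z.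
Proof. by case: z => x y; rewrite /sqn /= sqr_sqrtr // addr_ge0 ?sqr_ge0. Qed.

Lemma sqn_ge0 (z : C) : 0 <= sqn z.
Proof. by rewrite addr_ge0 ?sqr_ge0. Qed.

Lemma sqn_mulC (z : C) : z * z^*%C = (sqn z)%:C.
Proof. by case: z => x y; rewrite /sqn; simpc => /=; congr (_ +i* _); ring. Qed.

Lemma mxnorm2_row n (v : 'rV[C]_n) : mxnorm2 v = \sum_i sqn (v 0 i).
Proof. by rewrite /mxnorm2 big_ord1; apply: eq_bigr => i _; rewrite normc_sqn. Qed.

Lemma mxnorm2_ge0 m n (v : 'M[C]_(m, n)) : 0 <= mxnorm2 v.
Proof. by do 2!apply: sumr_ge0 => ? _; rewrite sqr_ge0. Qed.

Lemma adjmxE m n (M : 'M[C]_(m, n)) : adjmx M = map_mx Num.conj (M^T).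
Proof. by apply/matrixP => i j; rewrite !mxE. Qed.

Lemma adjmxM m n p (M : 'M[C]_(m, n)) (N : 'M[C]_(n, p)) :
  adjmx (M *m N) = adjmx N *m adjmx M.
Proof. by rewrite !adjmxE trmx_mul map_mxM. Qed.

Lemma adjmxK m n (M : 'M[C]_(m, n)) : adjmx (adjmx M) = M.
Proof. by apply/matrixP => i j; rewrite !mxE conjcK. Qed.

Lemma adjmx_cplxmx m n (M : 'M[R]_(m, n)) : adjmx (cplxmx M) = cplxmx M^T.
Proof. by apply/matrixP => i j; rewrite !mxE conjc_real. Qed.

Lemma cplxmxM m n p (M : 'M[R]_(m, n)) (N : 'M[R]_(n, p)) :
  cplxmx (M *m N) = cplxmx M *m cplxmx N.
Proof. exact: map_mxM. Qed.

Lemma row_adjmx n (v : 'rV[C]_n) : (v *m adjmx v) 0 0 = (mxnorm2 v)%:C.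
Proof.
rewrite mxnorm2_row mxE rmorph_sum; apply: eq_bigr => i _.
by rewrite !mxE sqn_mulC.
Qed.

(** Vectors are rows acting from the left, and they are complex because the Jordan basis of the real
    matrix H is. For symmetric [S] the real part discards nothing. *)
Definition qf n (S : 'M[R]_n) (v : 'rV[C]_n) : R :=
  complex.Re ((v *m cplxmx S *m adjmx v) 0 0).

Lemma char_poly_similar n (U V D : 'M[C]_n) : U *m V = 1%:M ->
  char_poly (V *m D *m U) = char_poly D.
Proof.
move=> UV; have VU := mulmx1C UV; rewrite /char_poly.
have -> : char_poly_mx (V *m D *m U) =
   map_mx polyC V *m char_poly_mx D *m map_mx polyC U.
  rewrite /char_poly_mx mulmxBr mulmxBl -!map_mxM; congr (_ - _).
  by rewrite scalar_mxC -mulmxA -map_mxM VU map_mx1 mulmx1.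
by rewrite !det_mulmx mulrAC -det_mulmx -map_mxM VU map_mx1 det1 mul1r.
Qed.

Lemma perm_eq_prod_XsubC (F : idomainType) (s t : seq F) :
  \prod_(z <- s) ('X - z%:P) = \prod_(z <- t) ('X - z%:P) -> perm_eq s t.
Proof.
elim: s t => [|x s IHs] t.
  rewrite big_nil => /(congr1 (fun p : {poly F} => size p)).
  by rewrite size_prod_XsubC size_poly1; case: t.
move=> e; have xt : x \in t.
  by rewrite -root_prod_XsubC -e root_prod_XsubC mem_head.
rewrite perm_sym (permPl (perm_to_rem xt)) perm_cons perm_sym; apply: IHs.
move: e; rewrite big_cons (perm_big _ (perm_to_rem xt)) /= big_cons.
by apply: mulfI; rewrite polyXsubC_eq0.
Qed.

Lemma char_poly_diag n (sp : 'rV[C]_n) :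
  char_poly (diag_mx sp) = \prod_(z <- [seq sp 0 i | i <- enum 'I_n]) ('X - z%:P).
Proof.
rewrite char_poly_trig; last exact: diag_mx_is_trig.
rewrite big_map big_enum /=.
by apply: eq_bigr => i _; rewrite mxE eqxx mulr1n.
Qed.

Lemma eigenvalues_prod n (M : 'M[C]_n) :
  char_poly M = \prod_(z <- eigenvalues M) ('X - z%:P).
Proof.
rewrite /eigenvalues; case: closed_field_poly_normal => r /= ->.
by rewrite (monicP (char_poly_monic M)) scale1r.
Qed.

(** [eigenvalues] is an unspecified list of roots, so the diagonal [d] of the spectral theorem can
    be compared with it only as a multiset, through the two factorizations of the characteristic
    polynomial. *)
Lemma spectral_real n (S : 'M[R]_n) : S^T = S ->
  exists (U : 'M[C]_n) (d : 'I_n -> R),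
    [/\ U *m adjmx U = 1%:M,
        cplxmx S = adjmx U *m diag_mx (\row_i (d i)%:C) *m U &
        perm_eq [seq complex.Re z | z <- eigenvalues (cplxmx S)] (codom d)].
Proof.
move=> St; set M := cplxmx S.
have Mh : M \is hermsymmx.
  apply/is_hermitianmxP; rewrite expr0 scale1r -adjmxE adjmx_cplxmx St //.
have := hermitian_normalmx Mh => /orthomx_spectralP Meq.
have dreal := hermitian_spectral_diag_real Mh.
set U := spectralmx M in Meq; set sp := spectral_diag M in Meq dreal.
have Uu : U \is unitarymx by exact: spectral_unitarymx.
rewrite invmx_unitary // -adjmxE in Meq.
have U1 : U *m adjmx U = 1%:M by rewrite adjmxE; apply/unitarymxP.
clearbody U sp.
pose d i := complex.Re (sp 0 i).
have spE : sp = \row_i (d i)%:C.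
  apply/rowP => i; rewrite mxE /d; have := mxOverP dreal 0 i.
  by case: (sp 0 i) => x y; rewrite complex_real /= => /eqP ->.
exists U, d; split.
- exact: U1.
- by rewrite -spE; exact: Meq.
have : char_poly M = \prod_(z <- [seq sp 0 i | i <- enum 'I_n]) ('X - z%:P).
  by rewrite [in LHS]Meq (char_poly_similar _ U1) char_poly_diag.
rewrite eigenvalues_prod => eqp.
have pe : perm_eq (eigenvalues M) [seq sp 0 i | i <- enum 'I_n].
  exact: perm_eq_prod_XsubC.
have -> : codom d = map (@complex.Re R) [seq sp 0 i | i <- enum 'I_n].
  by rewrite -map_comp codomE.
exact: perm_map.
Qed.

Lemma count_codom n (d : 'I_n -> R) (p : pred R) :
  count p (codom d) = #|[pred i | p (d i)]|.
Proof. by rewrite codomE count_map -size_filter cardE /enum_mem -filter_predI; congr size; apply: eq_filter => i /=; rewrite inE andbT. Qed.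

Section spectral_span.
Variables (n : nat) (U : 'M[C]_n) (d : 'I_n -> R) (S : 'M[R]_n).
Hypothesis U1 : U *m adjmx U = 1%:M.
Hypothesis SE : cplxmx S = adjmx U *m diag_mx (\row_i (d i)%:C) *m U.

Lemma adjU1 : adjmx U *m U = 1%:M.
Proof. exact: mulmx1C. Qed.

Lemma qf_spectral v : qf S v = \sum_i d i * sqn ((v *m adjmx U) 0 i).
Proof.
rewrite /qf SE; set w := v *m adjmx U.
have -> : v *m (adjmx U *m diag_mx (\row_i (d i)%:C) *m U) *m adjmx v
  = w *m diag_mx (\row_i (d i)%:C) *m adjmx w.
  by rewrite /w adjmxM adjmxK !mulmxA.
rewrite mxE raddf_sum; apply: eq_bigr => i _.
rewrite mul_mx_diag !mxE mulrAC [_ * (_)^*%C]sqn_mulC.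
by rewrite -rmorphM mulrC.
Qed.

Lemma mxnorm2_spectral (v : 'rV[C]_n) : mxnorm2 v = \sum_i sqn ((v *m adjmx U) 0 i).
Proof.
rewrite -mxnorm2_row; apply: complexI; rewrite -!row_adjmx.
by rewrite adjmxM adjmxK -!mulmxA (mulmxA (adjmx U)) adjU1 mul1mx.
Qed.

(** The rows of [U] are orthonormal eigenvectors for the action on rows; [p] selects some of
    them. *)
Definition span_of (p : pred 'I_n) : 'M[C]_(#|p|, n) := rowsub enum_val U.

Lemma rank_span_of p : \rank (span_of p) = #|p|.
Proof.
apply: mxrank_unitary; apply/unitarymxP; rewrite -adjmxE.
apply/matrixP => i j.
have /matrixP/(_ (enum_val i) (enum_val j)) := U1.
rewrite [in LHS]mxE [in RHS]mxE (inj_eq enum_val_inj) => e; rewrite mxE [RHS]mxE -e.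
by apply: eq_bigr => k _; rewrite !mxE.
Qed.

Lemma span_of_coord p (v : 'rV[C]_n) i : (v <= span_of p)%MS -> ~~ p i ->
  (v *m adjmx U) 0 i = 0.
Proof.
move=> /submxP [w ->] npi; rewrite -mulmxA.
have -> : span_of p *m adjmx U = rowsub enum_val 1%:M.
  rewrite -U1; apply/matrixP => a b; rewrite !mxE.
  by apply: eq_bigr => k _; rewrite !mxE.
rewrite mxE big1 // => k _; rewrite !mxE.
case: eqP => [e|]; last by rewrite mulr0.
by move: npi; rewrite -e; have := enum_valP k; rewrite unfold_in => ->.
Qed.

Lemma span_of_le (p : pred 'I_n) c (v : 'rV[C]_n) : (forall i, p i -> d i <= c) ->
  (v <= span_of p)%MS -> qf S v <= c * mxnorm2 v.
Proof.
move=> pc vp; rewrite qf_spectral mxnorm2_spectral mulr_sumr.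
apply: ler_sum => i _; have [pi|npi] := boolP (p i).
  by rewrite ler_wpM2r ?sqn_ge0 // pc.
by rewrite (span_of_coord vp npi) /sqn /= expr0n addr0 !mulr0.
Qed.

Lemma span_of_gt (p : pred 'I_n) c (v : 'rV[C]_n) : (forall i, p i -> c < d i) ->
  (v <= span_of p)%MS -> v != 0 -> c * mxnorm2 v < qf S v.
Proof.
move=> pc vp v0; rewrite qf_spectral mxnorm2_spectral mulr_sumr.
have /rV0Pn [k wk] : v *m adjmx U != 0.
  apply: contra_neq v0 => e; rewrite -[v]mulmx1 -adjU1 mulmxA e mul0mx //.
rewrite [ltLHS](bigD1 k) // [ltRHS](bigD1 k) //=.
have pk : p k by apply: contraNT wk => npk; rewrite (span_of_coord vp npk).
apply: ltr_leD; last first.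
  apply: ler_sum => i _; have [pi|npi] := boolP (p i).
    by rewrite ler_wpM2r ?sqn_ge0 // ltW // pc.
  by rewrite (span_of_coord vp npi) /sqn /= expr0n addr0 !mulr0.
rewrite ltr_pM2r ?pc // lt_neqAle sqn_ge0 andbT eq_sym.
apply: contra wk; rewrite paddr_eq0 ?sqr_ge0 // !sqrf_eq0 => /andP[/eqP a /eqP b].
by apply/eqP; case: ((v *m adjmx U) 0 k) a b => ? ? /= -> ->.
Qed.

End spectral_span.

Lemma rank_cap_nz n m1 m2 (A : 'M[C]_(m1, n)) (B : 'M[C]_(m2, n)) :
  (n < \rank A + \rank B)%N -> exists v : 'rV[C]_n,
  [/\ (v <= A)%MS, (v <= B)%MS & v != 0].
Proof.
move=> h; have /rowV0Pn[v vAB v0] : (A :&: B)%MS != 0.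
  rewrite -mxrank_eq0 -lt0n -(ltn_add2l (\rank (A + B)%MS)) addn0 mxrank_sum_cap.
  by apply: leq_ltn_trans h; rewrite rank_leq_col.
by exists v; split => //; apply: submx_trans vAB _; [exact: capmxSl|exact: capmxSr].
Qed.

(** If the eigenvalue exceeded [c], at least n - q eigenvectors would have eigenvalue above [c].
    Their span meets [V], of dimension at least q + 1 because [q] counts from 0, and a common
    nonzero vector contradicts the bound on [V]. *)
Lemma lambda_le n (S : 'M[R]_n) (q : 'I_n) m (V : 'M[C]_(m, n)) c : S^T = S ->
  (q < \rank V)%N -> (forall v, (v <= V)%MS -> qf S v <= c * mxnorm2 v) ->
  lambda q S <= c.
Proof.
move=> St rV hV; have [U [d [U1 SE pe]]] := spectral_real St.
rewrite leNgt; apply/negP => clt.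
have sz : size (sorted_Re_eigenvalues (cplxmx S)) = n.
  by rewrite size_sort (perm_size pe) codomE size_map size_enum_ord.
have srt : sorted <=%R (sorted_Re_eigenvalues (cplxmx S)).
  exact: sort_le_sorted.
have cnt : (count (fun x => x <= c)%R (sorted_Re_eigenvalues (cplxmx S)) <= q)%N.
  rewrite leqNgt; apply/negP => /(nth_count_le 0 srt).
  by rewrite leNgt clt.
move: cnt; rewrite count_sort (permP pe) count_codom => cnt.
have cnt2 : (n - q <= #|[pred i | (c < d i)%R]|)%N.
  have := cardC [pred i | (d i <= c)%R]; rewrite card_ord => e.
  have e2 : #|[predC [pred i | d i <= c]]| = #|[pred i | c < d i]|.
    by apply: eq_card => i; rewrite !inE ltNge.
  by rewrite leq_subLR -{1}e e2 leq_add2r.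
have [] := @rank_cap_nz _ _ _ V (span_of U [pred i | (c < d i)%R]).
  rewrite (rank_span_of U1) //; have := ltn_ord q => qn.
  by apply: leq_trans (leq_add rV cnt2); rewrite addSn subnKC // ltnW.
move=> v [vV vW v0]; have := hV _ vV.
by rewrite leNgt (span_of_gt U1 SE _ vW v0).
Qed.

(** The extremal space of min-max: all eigenvectors with eigenvalue at most [lambda q S]. Ties may
    make its dimension larger than q + 1, whence the inequality on the rank. *)
Lemma lambda_lowspace n (S : 'M[R]_n) (q : 'I_n) : S^T = S ->
  exists m (V : 'M[C]_(m, n)), (q < \rank V)%N /\
    forall v, (v <= V)%MS -> qf S v <= lambda q S * mxnorm2 v.
Proof.
move=> St; have [U [d [U1 SE pe]]] := spectral_real St.
set p := [pred i | d i <= lambda q S].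
exists #|p|, (span_of U p); split; last first.
  by move=> v; apply: (span_of_le U1 SE) => i.
rewrite (rank_span_of U1) // /p -(count_codom d (fun x => x <= lambda q S)) -(permP pe).
rewrite -(count_sort <=%R) ltnNge; apply/negP => h.
have sz : size (sorted_Re_eigenvalues (cplxmx S)) = n.
  by rewrite size_sort (perm_size pe) codomE size_map size_enum_ord.
have srt : sorted <=%R (sorted_Re_eigenvalues (cplxmx S)).
  exact: sort_le_sorted.
have := @nth_count_gt _ _ (lambda q S) 0 _ q srt.
by rewrite sz ltn_ord andbT h => /(_ isT); rewrite ltxx.
Qed.

(** The dimensions n - q and q + 1 of [V] and of the extremal space add up to more than n, so both
    bounds apply to a common nonzero vector. *)
Lemma lambda_ge n (S : 'M[R]_n) (q : 'I_n) m (V : 'M[C]_(m, n)) c : S^T = S ->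
  (n - q <= \rank V)%N -> (forall v, (v <= V)%MS -> c * mxnorm2 v <= qf S v) ->
  c <= lambda q S.
Proof.
move=> St rV hV; have [m' [V' [rV' hV']]] := lambda_lowspace q St.
have [] := @rank_cap_nz _ _ _ V V'.
  apply: leq_trans (leq_add rV rV'); rewrite addnS subnK //.
  exact: ltnW.
move=> v [vV vV' v0]; have := le_trans (hV _ vV) (hV' _ vV').
rewrite ler_pM2r // lt_neqAle mxnorm2_ge0 andbT eq_sym.
apply: contra v0 => /eqP h; apply/eqP/rowP => i; rewrite mxE.
have := congr1 (real_complex R) h; rewrite -row_adjmx mxE.
move: h; rewrite mxnorm2_row => /eqP; rewrite psumr_eq0 => [/allP /(_ i)|? _]; last exact: sqn_ge0.
rewrite mem_index_enum => /(_ isT); rewrite paddr_eq0 ?sqr_ge0 // !sqrf_eq0 => /andP[/eqP a /eqP b] _.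
by case: (v 0 i) a b => ? ? /= -> ->.
Qed.

(** Weyl's inequality: the extremal space of [S'] is a test space for [S]. *)
Lemma lambda_mono n (S S' : 'M[R]_n) (q : 'I_n) e : S^T = S -> S'^T = S' ->
  (forall v, qf S v <= qf S' v + e * mxnorm2 v) -> lambda q S <= lambda q S' + e.
Proof.
move=> St St' h; have [m' [V' [rV' hV']]] := lambda_lowspace q St'.
apply: (lambda_le St rV') => v vV; apply: le_trans (h v) _.
by rewrite mulrDl lerD2r hV'.
Qed.

End minmax.

(** * Growth of the matrix exponential *)

Section matrix_exponential.
Variable R : realType.
Local Notation C := R[i].

(** Derivatives are taken entrywise, so that the calculus of real functions suffices. *)
Definition mderiv m n (F F' : R -> 'M[R]_(m, n)) :=
  forall t i j, is_derive t (1 : R) (fun s => F s i j) (F' t i j).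

Lemma is_derive_bigsum (I : Type) (r : seq I) (f df : I -> R -> R) (t : R) :
  (forall i, is_derive t (1 : R) (f i) (df i t)) ->
  is_derive t (1 : R) (fun s => \sum_(i <- r) f i s) (\sum_(i <- r) df i t).
Proof.
move=> h; elim: r => [|i r IHr].
  rewrite big_nil (_ : (fun _ => _) = cst 0); first exact: is_derive_cst.
  by apply/funext => s; rewrite big_nil.
rewrite big_cons (_ : (fun _ => _) = f i + (fun s => \sum_(i <- r) f i s)).
  exact: is_deriveD.
by apply/funext => s; rewrite big_cons.
Qed.

Lemma mderivM m n p (F F' : R -> 'M[R]_(m, n)) (G G' : R -> 'M[R]_(n, p)) :
  mderiv F F' -> mderiv G G' ->
  mderiv (fun t => F t *m G t) (fun t => F' t *m G t + F t *m G' t).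
Proof.
move=> hF hG t i j.
rewrite (_ : (fun _ => _) = fun s => \sum_k F s i k * G s k j); last first.
  by apply/funext => s; rewrite mxE.
apply: is_derive_eq; first apply: (@is_derive_bigsum _ _ (fun k s => F s i k * G s k j)
  (fun k s => F' s i k * G s k j + F s i k * G' s k j)).
  move=> k; have /= := is_deriveM (hF t i k) (hG t k j).
  rewrite /GRing.scale /= => /is_derive_eq; apply.
  by rewrite addrC mulrC.
by rewrite !mxE -big_split.
Qed.

Lemma mderiv_eq m n (F F' G' : R -> 'M[R]_(m, n)) : mderiv F F' ->
  F' =1 G' -> mderiv F G'.
Proof. by move=> h e t i j; rewrite -e; exact: h. Qed.

Lemma mderiv0_cst m n (F : R -> 'M[R]_(m, n)) : mderiv F (fun=> 0) ->
  forall s t, F s = F t.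
Proof.
move=> h s t; apply/matrixP => i j.
apply: (@is_derive_0_is_cst _ (fun s => F s i j)) => x.
by have := h x i j; rewrite mxE.
Qed.

Lemma mderiv_comp m n (F F' : R -> 'M[R]_(m, n)) (g : R -> R) (dg : R) :
  mderiv F F' -> (forall t, is_derive t (1 : R) g dg) ->
  mderiv (fun t => F (g t)) (fun t => dg *: F' (g t)).
Proof.
move=> h hg t i j; have /= := is_derive1_comp (h (g t) i j) (hg t).
by rewrite mulrC mxE.
Qed.

Lemma mx_exprZ n (t : R) (M : 'M[R]_n) k : (t *: M) ^+ k = t ^+ k *: M ^+ k.
Proof.
elim: k => [|k IHk]; first by rewrite !expr0 scale1r.
by rewrite !exprS IHk; apply: etrans (esym (scalemxAl _ _ _)) _; rewrite -[X in _ *: X]scalemxAr scalerA.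
Qed.

Definition expcoef n (M : 'M[R]_n) i j k := (k`!%:R)^-1 * (M ^+ k) i j.

Lemma expmxZE n (t : R) (M : 'M[R]_n) i j :
  expmx (t *: M) i j = limn (pseries (expcoef M i j) t).
Proof.
rewrite mxE; congr (limn _); congr series; apply/funext => k.
by rewrite mx_exprZ mxE /= /expcoef mulrCA mulrC.
Qed.

Lemma mx_expr_bound n (M : 'M[R]_n) : exists2 b, 0 <= b &
  forall k i j, `|(M ^+ k) i j| <= b ^+ k.
Proof.
exists (\sum_i \sum_j `|M i j|); first by do 2!apply: sumr_ge0 => ? _.
elim=> [|k IHk] i j.
  by rewrite !expr0 mxE; case: eqP => _; rewrite ?normr1 // normr0.
rewrite exprS mxE exprS; apply: le_trans (ler_norm_sum _ _ _) _.
rewrite [X in _ <= X * _](bigD1 i) //= mulrDl -[leLHS]addr0 lerD //.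
  rewrite mulr_suml; apply: ler_sum => l _.
  by rewrite normrM ler_wpM2l.
by rewrite mulr_ge0 ?exprn_ge0 // !sumr_ge0 // => ? _; rewrite ?sumr_ge0.
Qed.

Lemma is_cvg_expmx n (M : 'M[R]_n) i j t : cvgn (pseries (expcoef M i j) t).
Proof.
have [b b0 hb] := mx_expr_bound M.
apply: normed_cvg.
apply: (@series_le_cvg _ _ (exp_coeff (b * `|t|))) => /=.
- by move=> k; rewrite normr_ge0.
- by move=> k; rewrite exp_coeff_ge0 // mulr_ge0.
- move=> k; rewrite /exp_coeff /= /expcoef !normrM normrX exprMn normfV normr_nat.
  rewrite [leRHS]mulrC [leRHS]mulrA ler_wpM2r ?exprn_ge0 //.
  by rewrite ler_wpM2l ?invr_ge0.
- exact: is_cvg_series_exp_coeff.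
Qed.

Lemma pseries_diffs_expcoefl n (M : 'M[R]_n) i j :
  pseries_diffs (expcoef M i j) = fun k => \sum_l M i l * expcoef M l j k.
Proof.
apply/funext => k; rewrite /pseries_diffs /expcoef exprS mxE factS natrM invfM.
rewrite mulrA mulrA divff ?mul1r ?pnatr_eq0 // mulr_sumr.
by apply: eq_bigr => l _; rewrite mulrCA.
Qed.

Lemma pseries_diffs_expcoefr n (M : 'M[R]_n) i j :
  pseries_diffs (expcoef M i j) = fun k => \sum_l expcoef M i l k * M l j.
Proof.
apply/funext => k; rewrite /pseries_diffs /expcoef exprSr mxE factS natrM invfM.
rewrite mulrA mulrA divff ?mul1r ?pnatr_eq0 // mulr_sumr.
by apply: eq_bigr => l _; rewrite mulrA.
Qed.

Lemma cvg_bigsum (I : Type) (r : seq I) (T : Type) (F : set_system T) (FF : Filter F)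
    (f : I -> T -> R) (a : I -> R) : (forall i, f i @ F --> a i) ->
  (fun x => \sum_(i <- r) f i x) @ F --> \sum_(i <- r) a i.
Proof.
move=> h; elim: r => [|i r IHr].
  rewrite big_nil (_ : (fun _ => _) = cst 0); first exact: cvg_cst.
  by apply/funext => s; rewrite big_nil.
rewrite big_cons (_ : (fun _ => _) = f i \+ (fun s => \sum_(i <- r) f i s)).
  exact: cvgD.
by apply/funext => s; rewrite big_cons.
Qed.

Lemma cvg_pseries_sum n (c : 'I_n -> nat -> R) (a : 'I_n -> R) t :
  (forall l, cvgn (pseries (c l) t)) ->
  pseries (fun k => \sum_l a l * c l k) t @ \oo --> \sum_l a l * limn (pseries (c l) t).
Proof.
move=> h.
rewrite (_ : pseries _ t = fun m => \sum_l a l * pseries (c l) t m).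
  by apply: cvg_bigsum => l; apply: cvgM; [exact: cvg_cst|exact: h].
apply/funext => m; rewrite /pseries /series /=.
under eq_bigr do rewrite mulr_suml.
rewrite exchange_big; apply: eq_bigr => l _.
by rewrite mulr_sumr; apply: eq_bigr => k _; rewrite mulrA.
Qed.

Lemma expmx_derivl n (M : 'M[R]_n) :
  mderiv (fun t => expmx (t *: M)) (fun t => M *m expmx (t *: M)).
Proof.
move=> t i j.
rewrite (_ : (fun _ => _) = fun s => limn (pseries (expcoef M i j) s)); last first.
  by apply/funext => s; rewrite expmxZE.
have c1 (s : R) l m : pseries (pseries_diffs (expcoef M l m)) s @ \oo --> \sum_o M l o * limn (pseries (expcoef M o m) s).
  rewrite pseries_diffs_expcoefl; apply: cvg_pseries_sum => o; exact: is_cvg_expmx.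
have -> : (M *m expmx (t *: M)) i j = limn (pseries (pseries_diffs (expcoef M i j)) t).
  rewrite (cvg_lim _ (c1 _ _ _)) // mxE.
  by apply: eq_bigr => l _; rewrite expmxZE.
apply: (@pseries_snd_diffs _ _ (`|t| + 1)).
- exact: is_cvg_expmx.
- by apply/cvg_ex; eexists; exact: c1.
- rewrite pseries_diffs_expcoefl.
  rewrite (_ : pseries_diffs _ = fun k => \sum_l M i l * pseries_diffs (expcoef M l j) k); last first.
    apply/funext => k; rewrite /pseries_diffs mulr_sumr.
    by apply: eq_bigr => l _; rewrite mulrCA.
  apply/cvg_ex; eexists; apply: cvg_pseries_sum => o.
  by apply/cvg_ex; eexists; exact: c1.
- by rewrite [ltRHS]ger0_norm ?ltrDl // addr_ge0.
Qed.

(** Both products are sums of the differentiated series, with M^(k+1) split as M M^k or as M^k M. *)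
Lemma expmx_comm n (M : 'M[R]_n) t : M *m expmx (t *: M) = expmx (t *: M) *m M.
Proof.
apply/matrixP => i j; rewrite !mxE.
have h1 : pseries (pseries_diffs (expcoef M i j)) t @ \oo --> \sum_o M i o * limn (pseries (expcoef M o j) t).
  rewrite pseries_diffs_expcoefl; apply: cvg_pseries_sum => o; exact: is_cvg_expmx.
have h2 : pseries (pseries_diffs (expcoef M i j)) t @ \oo --> \sum_o M o j * limn (pseries (expcoef M i o) t).
  rewrite pseries_diffs_expcoefr.
  under [X in pseries X]eq_fun do under eq_bigr do rewrite mulrC.
  apply: (@cvg_pseries_sum _ _ (fun o => M o j)) => o; exact: is_cvg_expmx.
have := cvg_unique _ h1 h2.
under eq_bigr do rewrite -expmxZE. under [in RHS]eq_bigr do rewrite -expmxZE mulrC.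
by apply.
Qed.

Lemma expmx_derivr n (M : 'M[R]_n) :
  mderiv (fun t => expmx (t *: M)) (fun t => expmx (t *: M) *m M).
Proof. by apply: mderiv_eq (expmx_derivl M) _ => t; rewrite expmx_comm. Qed.

Lemma expmx0 n (M : 'M[R]_n) : expmx (0 *: M) = 1%:M.
Proof.
apply/matrixP => i j; rewrite expmxZE.
apply: cvg_lim => //; apply: cvg_near_cst; exists 1%N => // m /= m0.
rewrite /pseries /series /= big_ltn // big1_seq => [|k]; last first.
  by rewrite mem_index_iota => /andP[_ /andP[k0 _]]; rewrite expr0n gtn_eqF // mulr0.
by rewrite /expcoef !expr0 invr1 mul1r mulr1 addr0.
Qed.

Lemma expmxNK n (M : 'M[R]_n) t : expmx (t *: M) *m expmx (- t *: M) = 1%:M.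
Proof.
have h : mderiv (fun t => expmx (t *: M) *m expmx (- t *: M)) (fun=> 0).
  have d := @mderiv_comp _ _ _ _ (fun t => - t) (-1) (expmx_derivl M).
  apply: (mderiv_eq (mderivM (expmx_derivr M) (d _))).
  by move=> s /=; rewrite scaleN1r mulmxN mulmxA subrr.
by rewrite (mderiv0_cst h t 0) oppr0 expmx0 mulmx1.
Qed.

(** Uniqueness for F' = F M: the product of F(t) with the exponential of -tM has zero derivative.
    The semigroup law and the shift of the exponent by a scalar matrix are instances. *)
Lemma expmx_ode n m (M : 'M[R]_n) (F : R -> 'M[R]_(m, n)) :
  mderiv F (fun t => F t *m M) -> forall t, F t = F 0 *m expmx (t *: M).
Proof.
move=> hF t.
have h : mderiv (fun t => F t *m expmx (- t *: M)) (fun=> 0).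
  have d := @mderiv_comp _ _ _ _ (fun t => - t) (-1) (expmx_derivl M).
  apply: (mderiv_eq (mderivM hF (d _))).
  by move=> s /=; rewrite scaleN1r mulmxN mulmxA subrr.
have := mderiv0_cst h t 0; rewrite oppr0 expmx0 mulmx1 => <-.
by have := expmxNK M (- t); rewrite opprK -mulmxA => ->; rewrite mulmx1.
Qed.

Lemma expmxDl n (M : 'M[R]_n) s t :
  expmx ((s + t) *: M) = expmx (s *: M) *m expmx (t *: M).
Proof.
have h : mderiv (fun t => expmx ((s + t) *: M)) (fun t => expmx ((s + t) *: M) *m M).
  apply: (mderiv_eq (@mderiv_comp _ _ _ _ (fun t => s + t) 1 (expmx_derivr M) _)).
    move=> u; rewrite -[X in is_derive _ _ _ X]add0r.
    by apply: is_deriveD; exact: is_derive_cst.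
  by move=> u /=; rewrite scale1r.
by rewrite (expmx_ode h) addr0.
Qed.

Lemma is_derive_le0 (f df : R -> R) : (forall t, is_derive t (1 : R) f (df t)) ->
  (forall t, df t <= 0) -> forall s t, s <= t -> f t <= f s.
Proof.
move=> h h0 s t st; apply: (@ler0_derive1_nincr _ f s t) => //.
- by move=> x _; rewrite derive1E derive_val.
- apply: derivable_within_continuous => x _; by have [] := h x.
Qed.

Definition rin (z w : C) : R := complex.Re z * complex.Re w + complex.Im z * complex.Im w.

(* Along a solution u of u' = uJ, the energy [Ep p u] of the coordinates in p
   has derivative [2 * Dp p u (u J)]. *)
Definition Ep n (p : pred 'I_n) (u : 'rV[C]_n) : R := \sum_(k | p k) sqn (u 0 k).
Definition Dp n (p : pred 'I_n) (u w : 'rV[C]_n) : R := \sum_(k | p k) rin (u 0 k) (w 0 k).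

Lemma Ep_ge0 n (p : pred 'I_n) u : 0 <= Ep p u.
Proof. by apply: sumr_ge0 => *; exact: sqn_ge0. Qed.

(** Real and imaginary parts of the row are real-linear in the entries of the real matrix [M], so
    they can be differentiated along [expmx] entry by entry. *)
Lemma Re_bilin n m (v : 'rV[C]_n) (M : 'M[R]_n) (Q : 'M[C]_(n, m)) k :
  complex.Re ((v *m cplxmx M *m Q) 0 k) =
  \sum_j \sum_i M i j * complex.Re (v 0 i * Q j k).
Proof.
rewrite mxE raddf_sum; apply: eq_bigr => j _.
rewrite mxE mulr_suml raddf_sum; apply: eq_bigr => i _.
rewrite !mxE mulrAC; case: (v 0 i * Q j k) => x y /=.
by rewrite mulr0 subr0 mulrC.
Qed.

Lemma Im_bilin n m (v : 'rV[C]_n) (M : 'M[R]_n) (Q : 'M[C]_(n, m)) k :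
  complex.Im ((v *m cplxmx M *m Q) 0 k) =
  \sum_j \sum_i M i j * complex.Im (v 0 i * Q j k).
Proof.
rewrite mxE raddf_sum; apply: eq_bigr => j _.
rewrite mxE mulr_suml raddf_sum; apply: eq_bigr => i _.
rewrite !mxE mulrAC; case: (v 0 i * Q j k) => x y /=.
by rewrite mulr0 add0r mulrC.
Qed.

Lemma is_derive_sumZ n (F F' : R -> 'M[R]_n) (a : 'I_n -> 'I_n -> R) t : mderiv F F' ->
  is_derive t (1 : R) (fun s => \sum_j \sum_i F s i j * a i j)
     (\sum_j \sum_i F' t i j * a i j).
Proof.
move=> hF; apply: (@is_derive_bigsum _ _ _ (fun j s => \sum_i F' s i j * a i j)) => j.
apply: (@is_derive_bigsum _ _ _ (fun i s => F' s i j * a i j)) => i.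
have /= := is_deriveM (hF t i j) (is_derive_cst (a i j) t (1 : R)).
by move=> /is_derive_eq; apply; rewrite /GRing.scale /= mulr0 add0r mulrC.
Qed.

Section growth.
Variables (n : nat) (H : 'M[R]_n) (Q J : 'M[C]_n).
Hypothesis HQ : cplxmx H *m Q = Q *m J.
Variable v : 'rV[C]_n.
Let u t := v *m cplxmx (expmx (t *: H)) *m Q.

Lemma is_derive_energy (p : pred 'I_n) t :
  is_derive t (1 : R) (fun s => Ep p (u s)) (2 * Dp p (u t) (u t *m J)).
Proof.
have uJ s : u s *m J = v *m cplxmx (expmx (s *: H) *m H) *m Q.
  by rewrite /u -mulmxA -HQ cplxmxM !mulmxA.
rewrite uJ /Ep (_ : (fun _ => _) = fun s => \sum_(k <- seq.filter p (index_enum _)) sqn (u s 0 k)); last first.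
  by apply/funext => s; rewrite big_filter.
rewrite /Dp mulr_sumr -big_filter.
apply: (@is_derive_bigsum _ _ (fun k s => sqn (u s 0 k))
   (fun k t => 2 * rin (u t 0 k) ((v *m cplxmx (expmx (t *: H) *m H) *m Q) 0 k))) => k.
rewrite /sqn /rin.
under eq_fun do rewrite Re_bilin Im_bilin.
rewrite !Re_bilin !Im_bilin.
have d1 := is_derive_sumZ (fun i j => complex.Re (v 0 i * Q j k)) t (expmx_derivr H).
have d2 := is_derive_sumZ (fun i j => complex.Im (v 0 i * Q j k)) t (expmx_derivr H).
have /= := is_deriveD (is_deriveX 2 d1) (is_deriveX 2 d2).
move=> /is_derive_eq; apply.
by rewrite /= /GRing.scale /= !expr1; ring.
Qed.

(** Gronwall's factor: the sign of [Dp - c * Ep] decides the monotonicity of the energy damped by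
    exp(-2ct). *)
Lemma is_derive_energy_exp (p : pred 'I_n) c t :
  is_derive t (1 : R) (fun s => Ep p (u s) * expR (- (2 * c) * s))
    (2 * (Dp p (u t) (u t *m J) - c * Ep p (u t)) * expR (- (2 * c) * t)).
Proof.
have d1 := is_derive_energy p t.
have d2 : is_derive t (1 : R) (fun s => expR (- (2 * c) * s)) (expR (- (2 * c) * t) * (- (2 * c))).
  apply: (@is_derive1_comp _ expR (fun s => - (2 * c) * s)).
  have /= := is_deriveM (is_derive_cst (- (2 * c)) t (1 : R)) (is_derive_id t (1 : R)).
  by rewrite /GRing.scale /= mulr0 addr0 mulr1; exact.
have /= := is_deriveM d1 d2.
move=> /is_derive_eq; apply.
by rewrite /= /GRing.scale /=; ring.
Qed.

Lemma u0 : u 0 = v *m Q.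
Proof. by rewrite /u expmx0 /cplxmx map_mx1 mulmx1. Qed.

Lemma growth_upper (p : pred 'I_n) c t : (forall w, Dp p w (w *m J) <= c * Ep p w) ->
  0 <= t -> Ep p (u t) <= expR (2 * c * t) * Ep p (v *m Q).
Proof.
move=> h t0.
suff h' s : 2 * (Dp p (u s) (u s *m J) - c * Ep p (u s)) * expR (- (2 * c) * s) <= 0.
  have := is_derive_le0 (is_derive_energy_exp p c) h' t0.
  by rewrite u0 mulr0 expR0 mulr1 mulNr expRN ler_pdivrMr ?expR_gt0 // mulrC.
rewrite pmulr_lle0 ?expR_gt0 // pmulr_rle0 // subr_le0; exact: h.
Qed.

Lemma energy_nondecreasing (p : pred 'I_n) c s t : (forall w, c * Ep p w <= Dp p w (w *m J)) ->
  s <= t -> Ep p (u s) * expR (- (2 * c) * s) <= Ep p (u t) * expR (- (2 * c) * t).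
Proof.
move=> h st; rewrite -lerN2.
have dN x : is_derive x (1 : R) (fun s => - (Ep p (u s) * expR (- (2 * c) * s)))
    (- (2 * (Dp p (u x) (u x *m J) - c * Ep p (u x)) * expR (- (2 * c) * x))).
  exact: (is_deriveN (is_derive_energy_exp p c x)).
apply: (is_derive_le0 dN _ st) => x.
rewrite oppr_le0 pmulr_lge0 ?expR_gt0 // pmulr_rge0 // subr_ge0; exact: h.
Qed.

Lemma growth_lower (p : pred 'I_n) c t : (forall w, c * Ep p w <= Dp p w (w *m J)) ->
  0 <= t -> expR (2 * c * t) * Ep p (v *m Q) <= Ep p (u t).
Proof.
move=> h t0; have := energy_nondecreasing h t0.
by rewrite u0 mulr0 expR0 mulr1 mulNr expRN ler_pdivlMr ?expR_gt0 // mulrC.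
Qed.

(** Backwards in time a lower bound on the derivative bounds the energy from above. This case
    controls c^H for small c. *)
Lemma growth_upper_neg (p : pred 'I_n) c t : (forall w, c * Ep p w <= Dp p w (w *m J)) ->
  t <= 0 -> Ep p (u t) <= expR (2 * c * t) * Ep p (v *m Q).
Proof.
move=> h t0; have := energy_nondecreasing h t0.
by rewrite u0 mulr0 expR0 mulr1 mulNr expRN ler_pdivrMr ?expR_gt0 // mulrC.
Qed.
End growth.

(* Conjugation by diag (eps ^ i) makes the off-diagonal part of a Jordan
   matrix as small as wanted. *)
Definition scaled_jordan n n' (b : 'I_n -> 'I_n') (h : 'I_n' -> C) (e : R) (J : 'M[C]_n) :=
  forall l k, exists2 r : R, `|r| <= e & [/\ (b l != b k -> r = 0) &
    J l k = (if l == k then h (b k) else 0) + r%:C].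

(** Entries of [J] between different blocks vanish, so the coordinates of a union of blocks evolve
    among themselves. Within them each entry [r] of the perturbation costs at most e (|w_k|^2 +
    |w_l|^2) / 2, and each coordinate occurs in at most 2n such terms. *)
Lemma Dp_scaled_jordan n n' (b : 'I_n -> 'I_n') h e (J : 'M[C]_n) (p : pred 'I_n') w :
  scaled_jordan b h e J ->
  `|Dp (p \o b) w (w *m J) - \sum_(k | p (b k)) complex.Re (h (b k)) * sqn (w 0 k)|
   <= e * n%:R * Ep (p \o b) w.
Proof.
move=> hJ; rewrite /Dp -sumrB.
(* The sign of [e] is read off an entry of [J]; for n = 0 there is none, and both sides vanish. *)
have e0 : 0 <= e \/ n = 0%N.
  by case: n b J hJ {w} => [|m] b J hJ; [right|left; have [r re _] := hJ 0 0; apply: le_trans re].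
have [e_ge0|n0] := e0; last first.
  by subst n; rewrite /Ep !big1 ?normr0 ?mulr0 // => -[].
have key k : p (b k) -> `|rin (w 0 k) ((w *m J) 0 k) - complex.Re (h (b k)) * sqn (w 0 k)|
   <= \sum_(l | p (b l)) e * ((sqn (w 0 k) + sqn (w 0 l)) / 2).
  move=> pk.
  have -> : rin (w 0 k) ((w *m J) 0 k) - complex.Re (h (b k)) * sqn (w 0 k) =
    \sum_l rin (w 0 k) (w 0 l * (J l k - (if l == k then h (b k) else 0))).
    rewrite mxE.
    have -> : \sum_j w 0 j * J j k = \sum_l (w 0 l * (J l k - (if l == k then h (b k) else 0)))
        + w 0 k * h (b k).
      rewrite (bigD1 k) //= [in RHS](bigD1 k) //= eqxx.
      rewrite mulrBr addrAC subrK; congr (_ + _); apply: eq_bigr => l /negbTE ->.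
      by rewrite subr0.
    rewrite /rin !raddfD /= !raddf_sum /= !mulrDr !mulr_sumr.
    rewrite big_split /=; case: (w 0 k) (h (b k)) => x y [z t] /=; rewrite /sqn /=; ring.
  rewrite [leRHS]big_mkcond; apply: le_trans (ler_norm_sum _ _ _) _.
  apply: ler_sum => l _; have [r re [r0 ->]] := hJ l k.
  rewrite addrAC subrr add0r.
  have -> : rin (w 0 k) (w 0 l * r%:C) = r * rin (w 0 k) (w 0 l).
    by rewrite /rin; case: (w 0 k) (w 0 l) => x y [z t] /=; ring.
  case: ifPn => [pl|npl].
    rewrite normrM ler_pM //.
    rewrite ler_norml /rin /sqn; case: (w 0 k) (w 0 l) => x y [z t] /=.
    have := sqr_ge0 (x + z); have := sqr_ge0 (y + t).
    have := sqr_ge0 (x - z); have := sqr_ge0 (y - t).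
    by rewrite !expr2 => *; apply/andP; split; lra.
  by rewrite r0 ?mul0r ?normr0 //; apply: contra npl => /eqP ->.
apply: le_trans (ler_norm_sum _ _ _) _.
apply: le_trans (ler_sum _ key) _.
have sz : \sum_(l | p (b l)) 1 <= n%:R :> R.
  apply: (@le_trans _ _ (\sum_(l < n) 1)); last by rewrite sumr_const card_ord.
  by rewrite big_mkcond; apply: ler_sum => l _; case: ifP.
have -> : \sum_(i | p (b i)) \sum_(l | p (b l)) e * ((sqn (w 0 i) + sqn (w 0 l)) / 2) =
  e * (\sum_(l | p (b l)) 1) * Ep (p \o b) w.
  under eq_bigr do rewrite -mulr_sumr -mulr_suml big_split /=.
  rewrite -mulr_sumr -mulr_suml big_split /= [X in _ * ((_ + X) / _)]exchange_big /=.
  rewrite -mulrA; congr (_ * _).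
  have e1 : \sum_(i | p (b i)) \sum_(i0 | p (b i0)) sqn (w 0 i) =
    (\sum_(l | p (b l)) 1) * Ep (p \o b) w.
    rewrite /Ep mulr_sumr; apply: eq_bigr => i _.
    by rewrite mulr_suml; apply: eq_bigr => ? _; rewrite mul1r.
  rewrite e1; lra.
by rewrite ler_wpM2r ?Ep_ge0 // ler_wpM2l.
Qed.

Lemma jordan_scaling n n' (h : 'I_n' -> C) (sz : 'I_n' -> nat)
    (hsz : (\sum_(i < n') sz i)%N = n) (H P : 'M[C]_n) e :
  P \in unitmx ->
  H = P *m castmx (hsz, hsz) (\mxdiag_(i < n') Jordan_block (h i) (sz i)) *m invmx P ->
  0 < e ->
  exists (b : 'I_n -> 'I_n') (Q J : 'M[C]_n),
    [/\ forall i, #|[pred k | b k == i]| = sz i, Q \in unitmx, H *m Q = Q *m J &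
        scaled_jordan b h e J].
Proof.
subst n => uP; rewrite castmx_id => HE e0; set n := (\sum_i sz i)%N in H P uP HE *.
set J0 := \mxdiag_(i < n') _ in HE.
pose b (k : 'I_n) : 'I_n' := tagnat.sig1 k.
pose s (k : 'I_n) : nat := tagnat.sig2 k.
(* The exponent is the position within the block and restarts in each block: entry (l, k) is
   multiplied by e^(s k - s l), which is [e] on the superdiagonal. *)
pose D : 'M[C]_n := diag_mx (\row_k (e%:C ^+ s k)).
pose D' : 'M[C]_n := diag_mx (\row_k (e%:C ^- s k)).
have eC0 : e%:C != 0 :> C by rewrite (fmorph_eq0 (real_complex R)) gt_eqF.
have DD' : D *m D' = 1%:M.
  apply/matrixP => i j; rewrite mul_diag_mx !mxE; case: eqVneq => [->|_]; last by rewrite mulr0n mulr0.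
  by rewrite !mulr1n divff // expf_neq0.
exists b, (P *m D), (D' *m J0 *m D); split.
- move=> i; rewrite -[RHS]card_ord -(card_imset _ (f := fun j : 'I_(sz i) => tagnat.Rank i j)); last first.
    move=> j j' /(congr1 val)/eqP; rewrite tagnat.eq_Rank eqxx /= => /eqP /val_inj; exact.
  apply: eq_card => k; rewrite !inE; apply/eqP/imsetP => [<-|[j _ ->]].
    by exists (tagnat.sig2 k) => //; rewrite tagnat.sig2K.
  by rewrite /b tagnat.Rank1K.
- by rewrite unitmx_mul uP /=; case: (mulmx1_unit DD').
- rewrite HE !mulmxA mulmxKV // -(mulmxA P D D') DD' mulmx1 //.
move=> l k.
have JE : J0 l k = if b l == b k then (if s l == s k then h (b k) else if s k == (s l).+1 then 1 else 0) else 0.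
  rewrite /J0 /mxdiag mxE /b /s.
  move: (tagnat.sig2 l) (tagnat.sig2 k); move: (tagnat.sig1 l) (tagnat.sig1 k) => i i' x y.
  case: (eqVneq i i') y => [<-|_] y; last by rewrite mxE.
  by rewrite conform_mx_id mxE -val_eqE.
have bs : l != k -> b l == b k -> s l != s k.
  move=> lk bb; apply: contra lk => ss.
  by rewrite -val_eqE -(tagnat.sig2K l) -(tagnat.sig2K k) tagnat.eq_Rank bb.
have DJD : (D' *m J0 *m D) l k = e%:C ^- s l * J0 l k * e%:C ^+ s k.
  by rewrite mul_mx_diag mxE mul_diag_mx !mxE.
have [lk|lk] := eqVneq l k.
  exists 0; first by rewrite normr0 ltW.
  split=> //; rewrite DJD JE lk !eqxx addr0 mulrAC mulVf ?mul1r // expf_neq0 //.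
exists (if (b l == b k) && (s k == (s l).+1) then e else 0).
  by case: ifP => _; [rewrite gtr0_norm|rewrite normr0 ltW].
split; first by move=> /negbTE ->.
rewrite DJD JE add0r; case: ifPn => bb /=; last by rewrite mulr0 mul0r.
rewrite (negbTE (bs lk bb)); case: eqP => [->|_]; last by rewrite mulr0 mul0r.
by rewrite mulr1 exprS mulrCA mulVf ?mulr1 // expf_neq0.
Qed.

End matrix_exponential.

(** * Growth of the eigenvalues under congruence by the matrix exponential *)

Section growth_of_eigenvalues.
Variable R : realType.
Local Notation C := R[i].

Lemma sqr_sum_le (I : finType) (x : I -> R) :
  (\sum_i x i) ^+ 2 <= #|I|%:R * \sum_i x i ^+ 2.
Proof.
rewrite expr2 mulr_suml.
have -> : #|I|%:R * \sum_i x i ^+ 2 = \sum_i \sum_j (x i ^+ 2 + x j ^+ 2) / 2.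
  rewrite [RHS](eq_bigr (fun i => (#|I|%:R * x i ^+ 2 + \sum_j x j ^+ 2) / 2)); last first.
    by move=> i _; rewrite -mulr_suml big_split /= sumr_const mulr_natl.
  rewrite -mulr_suml big_split /= -mulr_sumr sumr_const -[X in _ + X]mulr_natl; lra.
apply: ler_sum => i _; rewrite mulr_sumr; apply: ler_sum => k _.
have := sqr_ge0 (x i - x k); rewrite !expr2; lra.
Qed.

Lemma sqnM (z w : C) : sqn (z * w) = sqn z * sqn w.
Proof. by case: z w => x y [z t]; rewrite /sqn /=; ring. Qed.

Lemma sqn_sum_le (I : finType) (x : I -> C) :
  sqn (\sum_i x i) <= #|I|%:R * \sum_i sqn (x i).
Proof.
rewrite {1}/sqn !raddf_sum /= /sqn big_split /= mulrDr.
by rewrite lerD // sqr_sum_le.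
Qed.

Lemma mxnorm2_mulmx n (x : 'rV[C]_n) (Q : 'M[C]_n) :
  mxnorm2 (x *m Q) <= n%:R * mxnorm2 Q * mxnorm2 x.
Proof.
rewrite !mxnorm2_row.
have -> : n%:R * mxnorm2 Q * (\sum_i sqn (x 0 i)) =
   \sum_k n%:R * ((\sum_i sqn (Q i k)) * (\sum_i sqn (x 0 i))).
  rewrite /mxnorm2 exchange_big -mulrA mulr_suml mulr_sumr; apply: eq_bigr => k _.
  by congr (_ * (_ * _)); apply: eq_bigr => i _; rewrite normc_sqn.
apply: ler_sum => k _; rewrite mxE.
apply: le_trans (sqn_sum_le _) _; rewrite card_ord ler_wpM2l // mulr_suml.
apply: ler_sum => i _; rewrite sqnM mulrC ler_wpM2l ?sqn_ge0 //.
by rewrite (bigD1 i) //= lerDl sumr_ge0 // => *; rewrite sqn_ge0.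
Qed.

Lemma qf_congr n (E S : 'M[R]_n) (v : 'rV[C]_n) :
  qf (E *m S *m E^T) v = qf S (v *m cplxmx E).
Proof.
by rewrite /qf !cplxmxM adjmxM adjmx_cplxmx !mulmxA.
Qed.

Lemma EpT n (u : 'rV[C]_n) : Ep predT u = mxnorm2 u.
Proof. by rewrite mxnorm2_row. Qed.

Lemma Ep_le_mxnorm2 n (p : pred 'I_n) (u : 'rV[C]_n) : Ep p u <= mxnorm2 u.
Proof.
rewrite mxnorm2_row /Ep big_mkcond; apply: ler_sum => i _.
by case: ifP => // _; exact: sqn_ge0.
Qed.

Section coord_space.
Variables (n : nat) (Q : 'M[C]_n).
Hypothesis uQ : Q \in unitmx.

(** The coordinates of a row v in the Jordan frame are the entries of v Q, so the vectors with
    coordinates supported in [p] are spanned by rows of the inverse of [Q]. *)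
Definition coord_space (p : pred 'I_n) : 'M[C]_(#|p|, n) := rowsub enum_val (invmx Q).

Lemma rank_coord_space p : \rank (coord_space p) = #|p|.
Proof.
rewrite -(mxrankMfree (coord_space p) (_ : row_free Q)); last by rewrite row_free_unit.
apply/eqP; apply/row_freeP; exists (rowsub enum_val 1%:M)^T.
apply/matrixP => i k.
have -> : coord_space p *m Q = rowsub enum_val 1%:M.
  by rewrite /coord_space -[1%:M](mulVmx uQ); apply/matrixP => a b; rewrite !mxE; apply: eq_bigr => l _; rewrite !mxE.
rewrite !mxE (bigD1 (enum_val k)) //= !mxE eqxx mulr1 big1 ?addr0.
  by rewrite (inj_eq enum_val_inj).
by move=> l lk; rewrite !mxE [enum_val k == l]eq_sym (negbTE lk) mulr0.
Qed.

Lemma coord_space_support p (v : 'rV[C]_n) k : (v <= coord_space p)%MS -> ~~ p k ->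
  (v *m Q) 0 k = 0.
Proof.
move=> /submxP[w ->] npk; rewrite -mulmxA.
have -> : coord_space p *m Q = rowsub enum_val 1%:M.
  by rewrite /coord_space -[1%:M](mulVmx uQ); apply/matrixP => a b; rewrite !mxE; apply: eq_bigr => l _; rewrite !mxE.
rewrite mxE big1 // => l _; rewrite !mxE; case: eqP => [e|]; last by rewrite mulr0.
by move: npk; rewrite -e; have := enum_valP l; rewrite unfold_in => ->.
Qed.

Lemma coord_space_Ep p (v : 'rV[C]_n) : (v <= coord_space p)%MS ->
  Ep p (v *m Q) = mxnorm2 (v *m Q).
Proof.
move=> vp; rewrite mxnorm2_row [RHS](bigID p) /= [X in _ = _ + X]big1 ?addr0 // => k npk.
by rewrite (coord_space_support vp npk) /sqn /= expr0n addr0.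
Qed.

Lemma coord_space_EpC p (v : 'rV[C]_n) : (v <= coord_space p)%MS ->
  Ep (predC p) (v *m Q) = 0.
Proof.
move=> vp; rewrite /Ep big1 // => k npk.
by rewrite (coord_space_support vp npk) /sqn /= expr0n addr0.
Qed.
End coord_space.

Section jordan.
Variables (n n' : nat) (H : 'M[R]_n) (h : 'I_n' -> C) (sz : 'I_n' -> nat)
  (hsz : (\sum_(i < n') sz i)%N = n) (P : 'M[C]_n).
Hypothesis uP : P \in unitmx.
Hypothesis HJ : cplxmx H =
     P *m castmx (hsz, hsz) (\mxdiag_(i < n') Jordan_block (h i) (sz i)) *m invmx P.

Lemma card_blocks (b : 'I_n -> 'I_n') (p : pred 'I_n') :
  (forall i, #|[pred k | b k == i]| = sz i) -> #|[pred k | p (b k)]| = (\sum_(i | p i) sz i)%N.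
Proof.
move=> hb; rewrite -sum1_card (partition_big b p) //=.
apply: eq_bigr => i pi; rewrite -hb -sum1_card; apply: eq_bigl => k; rewrite !inE.
by case: eqP => [->|]; rewrite ?pi ?andbF.
Qed.

Lemma Dp_upper (b : 'I_n -> 'I_n') e (J : 'M[C]_n) (p : pred 'I_n') c w :
  scaled_jordan b h e J -> (forall i, p i -> complex.Re (h i) <= c) ->
  Dp (p \o b) w (w *m J) <= (c + e * n%:R) * Ep (p \o b) w.
Proof.
move=> hJ hc; have := Dp_scaled_jordan p w hJ; rewrite ler_distl => /andP[_ +].
move=> /le_trans; apply; rewrite mulrDl lerD2r /Ep mulr_sumr.
by apply: ler_sum => k pk; rewrite ler_wpM2r ?sqn_ge0 // hc.
Qed.

Lemma Dp_lower (b : 'I_n -> 'I_n') e (J : 'M[C]_n) (p : pred 'I_n') c w :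
  scaled_jordan b h e J -> (forall i, p i -> c <= complex.Re (h i)) ->
  (c - e * n%:R) * Ep (p \o b) w <= Dp (p \o b) w (w *m J).
Proof.
move=> hJ hc; have := Dp_scaled_jordan p w hJ; rewrite ler_distl => /andP[+ _].
apply: le_trans; rewrite mulrBl lerD2r /Ep mulr_sumr.
by apply: ler_sum => k pk; rewrite ler_wpM2r ?sqn_ge0 // hc.
Qed.

(** The price of the almost diagonal form is [K], a condition number of [Q]. It depends on [e] but
    not on time, hence is harmless on the logarithmic scale. *)
Lemma jordan_eps e : 0 < e -> exists (b : 'I_n -> 'I_n') (Q J : 'M[C]_n) (e' K : R),
  [/\ e' * n%:R <= e, 0 < K,
    forall i, #|[pred k | b k == i]| = sz i, 
    [/\ Q \in unitmx, cplxmx H *m Q = Q *m J & scaled_jordan b h e' J] &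
    forall x : 'rV[C]_n, mxnorm2 (x *m Q) <= K * mxnorm2 x /\ mxnorm2 x <= K * mxnorm2 (x *m Q)].
Proof.
move=> e0; have e'0 : 0 < e / n.+1%:R by rewrite divr_gt0.
have [b [Q [J [hb uQ HQ hJ]]]] := jordan_scaling uP HJ e'0.
exists b, Q, J, (e / n.+1%:R), (1 + n%:R * mxnorm2 Q + n%:R * mxnorm2 (invmx Q)); split => //.
- by rewrite mulrAC ler_pdivrMr // ler_pM2l // ler_nat.
- by rewrite -addrA ltr_wpDr // addr_ge0 // mulr_ge0 // mxnorm2_ge0.
have m0 m (M : 'M[C]_m) : 0 <= n%:R * mxnorm2 M by rewrite mulr_ge0 // mxnorm2_ge0.
move=> x; split.
  apply: le_trans (mxnorm2_mulmx _ _) _; rewrite ler_wpM2r ?mxnorm2_ge0 //.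
  have := m0 _ (invmx Q); lra.
rewrite -{1}(mulmxK uQ x).
apply: le_trans (mxnorm2_mulmx _ _) _; rewrite ler_wpM2r ?mxnorm2_ge0 //.
have := m0 _ Q; lra.
Qed.

Lemma expmx_upper c e : (forall i, complex.Re (h i) <= c) -> 0 < e ->
  exists2 K, 0 < K & forall t (v : 'rV[C]_n), 0 <= t ->
  mxnorm2 (v *m cplxmx (expmx (t *: H))) <= K * expR (2 * (c + e) * t) * mxnorm2 v.
Proof.
move=> hc e0; have [b [Q [J [e' [K [e'e K0 hb [uQ HQ hJ] hK]]]]]] := jordan_eps e0.
exists (K * K); first by rewrite mulr_gt0.
move=> t v t0; have [_ h1] := hK (v *m cplxmx (expmx (t *: H))); have [h2 _] := hK v.
apply: le_trans h1 _.
have := @growth_upper R n H Q J HQ v predT (c + e) t.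
rewrite !EpT; set X := expR _ => gr.
have -> : K * K * X * mxnorm2 v = K * (X * (K * mxnorm2 v)) by ring.
rewrite (ler_wpM2l (ltW K0)) //; apply: le_trans (gr _ t0) _.
  move=> w; apply: le_trans (@Dp_upper b e' J predT c w hJ _) _ => //.
  by rewrite ler_wpM2r ?Ep_ge0 // lerD2l.
by rewrite ler_wpM2l ?expR_ge0.
Qed.

Lemma expmx_upper_neg c e : (forall i, c <= complex.Re (h i)) -> 0 < e ->
  exists2 K, 0 < K & forall t (v : 'rV[C]_n), t <= 0 ->
  mxnorm2 (v *m cplxmx (expmx (t *: H))) <= K * expR (2 * (c - e) * t) * mxnorm2 v.
Proof.
move=> hc e0; have [b [Q [J [e' [K [e'e K0 hb [uQ HQ hJ] hK]]]]]] := jordan_eps e0.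
exists (K * K); first by rewrite mulr_gt0.
move=> t v t0; have [_ h1] := hK (v *m cplxmx (expmx (t *: H))); have [h2 _] := hK v.
apply: le_trans h1 _.
have := @growth_upper_neg R n H Q J HQ v predT (c - e) t.
rewrite !EpT; set X := expR _ => gr.
have -> : K * K * X * mxnorm2 v = K * (X * (K * mxnorm2 v)) by ring.
rewrite (ler_wpM2l (ltW K0)) //; apply: le_trans (gr _ t0) _.
  move=> w; apply: le_trans (@Dp_lower b e' J predT c w hJ _) => //.
  by rewrite ler_wpM2r ?Ep_ge0 // lerB.
by rewrite ler_wpM2l ?expR_ge0.
Qed.

Hypothesis h_le : forall i1 i2 : 'I_n', (i1 <= i2)%N -> complex.Re (h i1) <= complex.Re (h i2).

(** Min-max with two test spaces. The blocks with Re h_i at least Re h_q' have total size at least n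
    - q and expand at least like exp((Re h_q' - e) t); those with Re h_i at most Re h_q' have total
    size above q and expand at most like exp((Re h_q' + e) t). Comparing real parts rather than
    indices takes all ties together. The constant is uniform in [t] and [S]. *)
Lemma lambda_growth e : 0 < e -> exists2 K, 0 < K &
  forall (q : 'I_n) (q' : 'I_n'),
   (\sum_(i < n' | (i < q')%N) sz i < q.+1 <= \sum_(i < n' | (i <= q')%N) sz i)%N ->
  forall t (S : 'M[R]_n) (c1 c2 : R), 0 <= t -> S^T = S -> 0 <= c1 -> 0 <= c2 ->
    (forall x, c1 * mxnorm2 x <= qf S x <= c2 * mxnorm2 x) ->
    c1 / K * expR (2 * (complex.Re (h q') - e) * t) <= lambda q (expmx (t *: H) *m S *m (expmx (t *: H))^T)
     <= c2 * K * expR (2 * (complex.Re (h q') + e) * t).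
Proof.
move=> e0; have [b [Q [J [e' [K [e'e K0 hb [uQ HQ hJ] hK]]]]]] := jordan_eps e0.
exists (K * K); first by rewrite mulr_gt0.
move=> q q' /andP[q1 q2] t S c1 c2 t0 St c10 c20 hS; set E := expmx (t *: H).
have Mt : (E *m S *m E^T)^T = E *m S *m E^T by rewrite !trmx_mul trmxK St mulmxA.
apply/andP; split.
  pose p : pred 'I_n' := [pred i | complex.Re (h q') <= complex.Re (h i)].
  apply: (lambda_ge (V := coord_space Q (p \o b)) Mt).
    rewrite rank_coord_space //.
    have -> : #|(p \o b : pred 'I_n)| = #|[pred k | p (b k)]| by apply: eq_card.
    rewrite (card_blocks p hb) -{1}hsz (bigID (fun i : 'I_n' => (i < q')%N)) /=.
    rewrite leq_subLR; apply: leq_add; first by rewrite -ltnS.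
    rewrite big_mkcond [leqRHS]big_mkcond; apply: leq_sum => i _.
    by case: ltnP => //= qi; rewrite /p /= h_le.
  move=> v vV; rewrite qf_congr; set x := v *m cplxmx E.
  have [h1 _] := hK x; have [_ h2] := hK v; have /andP[h3 _] := hS x.
  apply: le_trans h3.
  (* For the lower bound the energy in [p] alone is enough, since the other coordinates can only add
     to the norm. *)
  have := @growth_lower R n H Q J HQ v (p \o b) (complex.Re (h q') - e) t.
  rewrite coord_space_Ep //; set X := expR _ => gr.
  have -> : c1 / (K * K) * X * mxnorm2 v = c1 * (K^-1 * (X * (K^-1 * mxnorm2 v))).
    by rewrite invfM; ring.
  rewrite ler_wpM2l // ler_pdivrMl //.
  apply: le_trans h1; apply: le_trans (Ep_le_mxnorm2 (p \o b) _).
  apply: le_trans (gr _ t0).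
    by rewrite ler_wpM2l ?expR_ge0 // ler_pdivrMl.
  move=> w; apply: le_trans (@Dp_lower b e' J p (complex.Re (h q')) w hJ _) => //.
  by rewrite ler_wpM2r ?Ep_ge0 // lerB.
pose p : pred 'I_n' := [pred i | complex.Re (h i) <= complex.Re (h q')].
apply: (lambda_le (V := coord_space Q (p \o b)) Mt).
  rewrite rank_coord_space //.
  have -> : #|(p \o b : pred 'I_n)| = #|[pred k | p (b k)]| by apply: eq_card.
  rewrite (card_blocks p hb); apply: leq_trans q2 _.
  rewrite big_mkcond [leqRHS]big_mkcond; apply: leq_sum => i _.
  by case: (leqP i q') => // qi; rewrite /p /= h_le.
move=> v vV; rewrite qf_congr; set x := v *m cplxmx E.
have [_ h1] := hK x; have [h2 _] := hK v; have /andP[_ h3] := hS x.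
apply: le_trans h3 _; rewrite -2!mulrA ler_wpM2l // -mulrA.
apply: le_trans h1 _.
set X := expR _.
have -> : K * (K * (X * mxnorm2 v)) = K * (X * (K * mxnorm2 v)) by ring.
rewrite (ler_wpM2l (ltW K0)) //.
(* For the upper bound the test space must be invariant: the energy outside [p] starts at 0 and
   Gronwall keeps it there, whatever the rate [c]. *)
have -> : mxnorm2 (x *m Q) = Ep (p \o b) (x *m Q).
  apply/eqP; rewrite eq_le Ep_le_mxnorm2 andbT mxnorm2_row (bigID (p \o b)) /= -[leRHS]addr0 lerD2l.
  pose c := \sum_i `|complex.Re (h i)|.
  have := @growth_upper R n H Q J HQ v (predC p \o b) (c + e) t.
  have -> : Ep (predC p \o b) (v *m Q) = 0 by exact: (coord_space_EpC uQ vV).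
  rewrite mulr0 => /(_ _ t0); apply => w.
  apply: le_trans (@Dp_upper b e' J (predC p) c w hJ _) _ => //.
    move=> i _; apply: le_trans (ler_norm _) _.
    by rewrite /c (bigD1 i) //= lerDl sumr_ge0.
  by rewrite ler_wpM2r ?Ep_ge0 // lerD2l.
have := @growth_upper R n H Q J HQ v (p \o b) (complex.Re (h q') + e) t.
move=> gr; apply: le_trans (gr _ t0) _.
  move=> w; apply: le_trans (@Dp_upper b e' J p (complex.Re (h q')) w hJ _) _ => //.
  by rewrite ler_wpM2r ?Ep_ge0 // lerD2l.
by rewrite coord_space_Ep // ler_wpM2l ?expR_ge0.
Qed.

End jordan.
End growth_of_eigenvalues.

(** * Gaussian moments and Wick's formula *)

Section normal_moments.
Variable R : realType.
Local Notation mu := (@lebesgue_measure R).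

Let seg (n : nat) : set R := `[- n%:R, n%:R]%classic.

Lemma ge0_cvg_integral_segment (f : R -> R) : (forall x, 0 <= f x) ->
  measurable_fun setT f ->
  (fun n : nat => (\int[mu]_(x in seg n) (f x)%:E)%E) @ \oo
    --> (\int[mu]_x (f x)%:E)%E.
Proof.
move=> f0 mf.
have UT : \bigcup_n seg n = setT.
  rewrite -subTset => x _ /=; exists (Num.bound x) => //=.
  by rewrite /seg /= in_itv /= -ler_norml ltW // unstable.ltr_norm_bound.
rewrite -[X in _ --> (\int[mu]_(x in X) _)%E]UT.
apply: ge0_nondecreasing_set_cvg_integral => //.
- move=> n m nm; rewrite subsetEset; apply: subset_itv; rewrite bnd_simp ?lerN2 ler_nat //.
- by move=> n; exact: measurable_itv.
- move=> n; apply/measurable_EFinP; exact: measurable_funTS.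
- by move=> n x _; rewrite lee_fin.
Qed.

(** The fundamental theorem of calculus on [-n, n] and monotone convergence. Integrability of [g]
    comes out as a conclusion, so that moments can be computed one from another. *)
Lemma ge0_integral_parts (f g F : R -> R) (c : R) :
  (forall x, 0 <= f x) -> (forall x, 0 <= g x) -> continuous f -> continuous g ->
  (forall x, is_derive x (1 : R) F (g x - c * f x)) ->
  (fun n : nat => F n%:R - F (- n%:R)) @ \oo --> (0 : R) ->
  (\int[mu]_x (f x)%:E < +oo)%E ->
  (\int[mu]_x (g x)%:E = c%:E * \int[mu]_x (f x)%:E)%E.
Proof.
move=> f0 g0 cf cg dF F0 foo.
have mf : measurable_fun setT f by exact: continuous_measurable_fun.
have mg : measurable_fun setT g by exact: continuous_measurable_fun.
have cF : continuous F.
  by move=> x; apply/differentiable_continuous/derivable1_diffP; have [] := dF x.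
have step n : (0 < n)%N ->
  (\int[mu]_(x in seg n) (g x)%:E =
   c%:E * \int[mu]_(x in seg n) (f x)%:E + (F n%:R - F (- n%:R))%:E)%E.
  move=> n0; have nn : - n%:R < n%:R :> R by rewrite -subr_gt0 opprK addr_gt0 // ltr0n.
  have int h : continuous h -> mu.-integrable (seg n) (EFin \o h).
    move=> ch; apply: continuous_compact_integrable; first exact: segment_compact.
    exact: continuous_subspaceT.
  have i1 := int _ cf; have i2 := int _ cg.
  have ms : measurable (seg n : set (measurableTypeR R)) by exact: measurable_itv.
  have := @continuous_FTC2 R (fun x => g x - c * f x) F (- n%:R) n%:R nn.
  have -> : (\int[mu]_(x in seg n) (g x - c * f x)%:E =
     \int[mu]_(x in seg n) (g x)%:E - c%:E * \int[mu]_(x in seg n) (f x)%:E)%E.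
    under eq_integral do rewrite EFinB EFinM.
    have i3 : mu.-integrable (seg n) (fun x => c%:E * (f x)%:E)%E by exact: integrableZl.
    by rewrite integralB //= integralZl.
  rewrite -EFinB => <- //.
  - rewrite [RHS]addeC subeK // fin_numM //; exact: integrable_fin_num.
  - apply: continuous_subspaceT => x; apply: cvgB; first exact: cg.
    by apply: cvgM; [exact: cvg_cst|exact: cf].
  - split=> [x _||]; first by have [] := dF x.
      by apply: cvg_at_right_filter; exact: cF.
    by apply: cvg_at_left_filter; exact: cF.
  - by move=> x _; rewrite derive1E derive_val.
have ffin : (\int[mu]_x (f x)%:E)%E \is a fin_num.
  by rewrite ge0_fin_numE // integral_ge0 // => x _; rewrite lee_fin.
have lim1 := ge0_cvg_integral_segment g0 mg.
have lim2 : (fun n : nat => (c%:E * \int[mu]_(x in seg n) (f x)%:E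
    + (F n%:R - F (- n%:R))%:E)%E) @ \oo --> (c%:E * \int[mu]_x (f x)%:E + 0%:E)%E.
  apply: cvgeD; first by rewrite fin_num_adde_defl.
    by apply: cvgeZl => //; exact: ge0_cvg_integral_segment.
  by apply: cvg_EFin; [exact: nearW|exact: F0].
rewrite adde0 in lim2; apply: cvg_unique lim1 _ => //.
move: lim2; apply: cvg_trans; apply: near_eq_cvg.
by exists 1%N => // n n0; rewrite /= step.
Qed.

Section density.
Variables (s : R).
Hypothesis s0 : s != 0.
Local Notation p := (normal_pdf 0 s).

(** The Radon-Nikodym derivative of [normal_prob] equals the density almost everywhere, since both
    have the same integral over every measurable set. *)
Lemma ge0_integral_normal_prob (f : R -> R) : (forall x, 0 <= f x) ->
  measurable_fun setT f ->
  (\int[normal_prob 0 s]_x (f x)%:E = \int[mu]_x (f x * p x)%:E)%E.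
Proof.
move=> f0 mf.
have dom := normal_prob_dominates 0 s.
rewrite -(Radon_Nikodym_SigmaFinite.change_of_variables dom (f := EFin \o f)) //=; last first.
  exact/measurable_EFinP.
apply: ae_eq_integral => //.
- apply: emeasurable_funM; first exact/measurable_EFinP.
  exact: measurable_int (Radon_Nikodym_SigmaFinite.f_integrable dom).
- apply/measurable_EFinP/measurable_funM => //; exact: measurable_normal_pdf.
- under [X in ae_eq _ _ _ X]eq_fun do rewrite EFinM.
  apply: ae_eqe_mul2l => /=.
  apply: integral_ae_eq => //.
  + exact: Radon_Nikodym_SigmaFinite.f_integrable dom.
  + apply/measurable_EFinP; exact: measurable_normal_pdf.
  + by move=> E _ mE; rewrite -(Radon_Nikodym_SigmaFinite.f_integral dom).
Qed.

Lemma is_derive_normal_pdf (x : R) : is_derive x (1 : R) p (- (x / s ^+ 2) * p x).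
Proof.
rewrite normal_pdfE // /normal_fun.
have d1 : is_derive x (1 : R) (fun y : R => - (y - 0) ^+ 2 / (s ^+ 2 *+ 2)) (- (x / s ^+ 2)).
  rewrite (_ : (fun _ => _) = fun y => (- (s ^+ 2 *+ 2)^-1) * (y ^+ 2)); last first.
    by apply/funext => y; rewrite subr0 mulNr mulNr mulrC.
  have /= := is_deriveM (is_derive_cst (- (s ^+ 2 *+ 2)^-1) x (1 : R))
     (is_deriveX 2 (is_derive_id x (1 : R))).
  move=> /is_derive_eq; apply; rewrite /GRing.scale /= mulr0 addr0 expr1 mulr1.
  by field.
have d2 := is_derive1_comp (is_derive_expR _) d1.
have /= := is_deriveM (is_derive_cst (normal_peak s) x (1 : R)) d2.
move=> /is_derive_eq; apply; rewrite /GRing.scale /= mulr0 addr0; ring.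
Qed.

Lemma cvg_xn_normal_pdf (k : nat) : (k <= 3)%N ->
  (fun n : nat => n%:R ^+ k * p n%:R) @ \oo --> (0 : R).
Proof.
move=> k3.
have s2 : 0 < s ^+ 2 by rewrite exprn_even_gt0.
(* From exp(-y) <= 2 / y^2 at y = n^2 / (2 s^2): then n^3 exp(-y) <= 8 s^4 / n. *)
pose K := normal_peak s * (8 * s ^+ 4).
have K0 : 0 <= K.
  by rewrite mulr_ge0 ?normal_peak_ge0 // mulr_ge0 // exprn_even_ge0.
have harm : (fun n : nat => K * n%:R^-1) @ \oo --> (0 : R).
  rewrite -(mulr0 K); apply: cvgM; first exact: cvg_cst.
  apply/gtr0_cvgV0; last exact: cvgr_idn.
  by exists 1%N => // n /= n0; rewrite ltr0n.
apply: (squeeze_cvgr _ _ harm); last first.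
  exact: (cvg_cst (0 : R)).
exists 1%N => // n /= n0.
have n0' : 0 < n%:R :> R by rewrite ltr0n.
rewrite mulr_ge0 ?exprn_ge0 ?normal_pdf_ge0 //= normal_pdfE // /normal_fun subr0.
pose y : R := n%:R ^+ 2 / (s ^+ 2 *+ 2).
have y0 : 0 < y by rewrite divr_gt0 ?exprn_gt0 // pmulrn_lgt0.
have hy : expR (- y) <= 2 / y ^+ 2.
  rewrite expRN -[leRHS]invrK lef_pV2 ?posrE ?expR_gt0 ?invr_gt0 ?divr_gt0 ?exprn_gt0 //.
  rewrite invfM invrK; have := @expR_ge1Dxn R y 1 (ltW y0).
  by rewrite mulrC; apply: le_trans; rewrite lerDr.
rewrite mulNr -/y mulrCA /K -mulrA ler_wpM2l ?normal_peak_ge0 //.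
apply: (@le_trans _ _ (n%:R ^+ 3 * (2 / y ^+ 2))).
  rewrite ler_pM ?exprn_ge0 ?expR_ge0 //.
  by rewrite ler_weXn2l // ler1n.
rewrite le_eqVlt; apply/orP; left; apply/eqP.
rewrite /y; field.
by rewrite pnatr_eq0 -lt0n n0 s0.
Qed.

(** Stein's identity: the derivative of - s^2 x^(k+1) p is x^(k+2) p - (k+1) s^2 x^k p. Here k = 0;
    the fourth moment takes k = 2. *)
Lemma normal_moment2 : (\int[mu]_x (x ^+ 2 * p x)%:E = (s ^+ 2)%:E)%E.
Proof.
transitivity ((s ^+ 2)%:E * \int[mu]_x (p x)%:E)%E; last first.
  by rewrite integral_normal_pdf mule1.
apply: (@ge0_integral_parts p (fun x => x ^+ 2 * p x) (fun x => - (s ^+ 2) * (x * p x))).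
- by move=> x; exact: normal_pdf_ge0.
- by move=> x; rewrite mulr_ge0 ?sqr_ge0 ?normal_pdf_ge0.
- exact: continuous_normal_pdf.
- by move=> x; apply: cvgM; [exact: exprn_continuous|exact: continuous_normal_pdf].
- move=> x; have /= := is_deriveM (is_derive_cst (- (s ^+ 2)) x (1 : R))
     (is_deriveM (is_derive_id x (1 : R)) (is_derive_normal_pdf x)).
  move=> /is_derive_eq; apply; rewrite /GRing.scale /=; field; exact: s0.
- have e n : - s ^+ 2 * (n%:R * p n%:R) - - s ^+ 2 * (- n%:R * p (- n%:R)) =
     (- (s ^+ 2) *+ 2) * (n%:R ^+ 1 * p n%:R).
    by rewrite normal_pdfE // /normal_fun !subr0 sqrrN expr1; ring.
  under eq_fun do rewrite e.
  have := cvgM (cvg_cst (- (s ^+ 2) *+ 2)) (@cvg_xn_normal_pdf 1 isT).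
  by rewrite mulr0; apply.
- by rewrite integral_normal_pdf ltry.
Qed.

Lemma normal_moment4 : (\int[mu]_x (x ^+ 4 * p x)%:E = (3 * (s ^+ 2) ^+ 2)%:E)%E.
Proof.
transitivity ((3 * s ^+ 2)%:E * \int[mu]_x (x ^+ 2 * p x)%:E)%E; last first.
  by rewrite normal_moment2 -EFinM [in RHS]expr2 mulrA.
apply: (@ge0_integral_parts (fun x => x ^+ 2 * p x) (fun x => x ^+ 4 * p x) (fun x => - (s ^+ 2) * (x ^+ 3 * p x))).
- by move=> x; rewrite mulr_ge0 ?sqr_ge0 ?normal_pdf_ge0.
- by move=> x; rewrite mulr_ge0 ?exprn_even_ge0 ?normal_pdf_ge0.
- by move=> x; apply: cvgM; [exact: exprn_continuous|exact: continuous_normal_pdf].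
- by move=> x; apply: cvgM; [exact: exprn_continuous|exact: continuous_normal_pdf].
- move=> x; have /= := is_deriveM (is_derive_cst (- (s ^+ 2)) x (1 : R))
     (is_deriveM (is_deriveX 3 (is_derive_id x (1 : R))) (is_derive_normal_pdf x)).
  move=> /is_derive_eq; apply.
  have -> : (3 * x ^+ 2)%:A = 3 * x ^+ 2 :> R by exact: mulr1.
  have -> : (id ^+ 3 : R -> R) x = x ^+ 3 by [].
  rewrite scaler0 addr0 /GRing.scale /=; field; exact: s0.
- have e n : - s ^+ 2 * (n%:R ^+ 3 * p n%:R) - - s ^+ 2 * ((- n%:R) ^+ 3 * p (- n%:R)) =
     (- (s ^+ 2) *+ 2) * (n%:R ^+ 3 * p n%:R).
    by rewrite normal_pdfE // /normal_fun !subr0 sqrrN; ring.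
  under eq_fun do rewrite e.
  have := cvgM (cvg_cst (- (s ^+ 2) *+ 2)) (@cvg_xn_normal_pdf 3 isT).
  by rewrite mulr0; apply.
- by rewrite normal_moment2 ltry.
Qed.

End density.

Section gaussian_moments.
Variables (d : measure_display) (T : measurableType d) (Pr : probability T R).

Lemma ge0_integral_law d' (T' : measurableType d') (Y : T -> T') (nu : measure T' R) (f : T' -> R) :
  measurable_fun setT Y -> (forall E, measurable E -> Pr (Y @^-1` E) = nu E) ->
  measurable_fun setT f -> (forall x, 0 <= f x) ->
  (\int[Pr]_w (f (Y w))%:E = \int[nu]_x (f x)%:E)%E.
Proof.
move=> mY h mf f0.
have := @ge0_integral_pushforward _ _ _ _ R Y mY Pr setT (EFin \o f) measurableT.
rewrite preimage_setT => <- //.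
- by apply: eq_measure_integral => A mA _; rewrite -h.
- exact/measurable_EFinP.
- by move=> x _; rewrite lee_fin.
Qed.

(** Apart from measurability, this is all that Gaussianity contributes to the proof: a fourth moment
    equal to three times the square of the second. *)
Lemma centered_normal_moments (Y : T -> R) : centered_normal Pr Y ->
  exists2 v : R, 0 <= v &
    (\int[Pr]_w ((Y w) ^+ 2)%:E = v%:E /\ \int[Pr]_w ((Y w) ^+ 4)%:E = (3 * v ^+ 2)%:E)%E.
Proof.
move=> [mY [s [s0 hs]]]; exists (s ^+ 2); first exact: sqr_ge0.
have [s00|sn0] := eqVneq s 0.
  have h E : measurable E -> Pr (Y @^-1` E) = dirac (0 : R) E.
    by move=> mE; rewrite hs // s00 eqxx.
  have e2 (k : nat) : (0 < k)%N -> (\int[Pr]_w ((Y w) ^+ k.*2)%:E = 0)%E.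
    move=> k0; rewrite (@ge0_integral_law _ _ Y (dirac (0 : R)) (fun x => x ^+ k.*2)) //.
    - have e0 : (0 : R) ^+ k.*2 = 0 by rewrite expr0n double_eq0 gtn_eqF.
      rewrite integral_dirac //; first by rewrite /= e0 mule0.
      by apply/measurable_EFinP; exact: exprn_measurable.
    - by move=> x; rewrite exprn_even_ge0 // odd_double.
  by rewrite (e2 1%N) // (e2 2%N) // s00 !expr0n /= mulr0.
have h E : measurable E -> Pr (Y @^-1` E) = normal_prob 0 s E.
  by move=> mE; rewrite hs // (negbTE sn0).
have step (k : nat) : (\int[Pr]_w ((Y w) ^+ k.*2)%:E = \int[mu]_x (x ^+ k.*2 * normal_pdf 0 s x)%:E)%E.
  rewrite -ge0_integral_normal_prob //; last by move=> x; rewrite exprn_even_ge0 ?odd_double.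
  apply: (@ge0_integral_law _ (measurableTypeR R) Y (normal_prob 0 s) (fun x => x ^+ k.*2)) => //.
  by move=> x; rewrite exprn_even_ge0 ?odd_double.
by split; [rewrite (step 1%N) normal_moment2|rewrite (step 2%N) normal_moment4].
Qed.

End gaussian_moments.
End normal_moments.

(** * Integrals of real-valued functions *)

Section real_integrals.
Context {d : measure_display} {T : measurableType d} {R : realType}.
Variable mu : {measure set T -> \bar R}.

Implicit Types f g : T -> R.

Definition intg (f : T -> R) := mu.-integrable [set: T] (EFin \o f).

Lemma intg_measurable f : intg f -> measurable_fun setT f.
Proof. by move=> /integrableP[/measurable_EFinP]. Qed.

Lemma intg_le f g : measurable_fun setT f -> intg g -> (forall x, `|f x| <= g x) -> intg f.
Proof.
move=> mf ig h; apply: (le_integrable measurableT _ _ ig); first exact/measurable_EFinP.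
move=> x _ /=; rewrite lee_fin; apply: le_trans (h x) _; exact: ler_norm.
Qed.

Lemma intg_lty f : measurable_fun setT f -> (forall x, 0 <= f x) ->
  (\int[mu]_x (f x)%:E < +oo)%E -> intg f.
Proof.
move=> mf f0 h; apply/integrableP; split; first exact/measurable_EFinP.
by under eq_integral do rewrite /= ger0_norm //.
Qed.

Lemma intgE f : intg f -> (\int[mu]_x (f x)%:E)%E = (\int[mu]_x f x)%:E.
Proof. by move=> fi; rewrite fineK //; exact: integrable_fin_num. Qed.

Lemma intgD f g : intg f -> intg g -> intg (fun x => f x + g x).
Proof. by move=> fi gi; have := integrableD measurableT fi gi. Qed.

Lemma intgZ k f : intg f -> intg (fun x => k * f x).
Proof. by move=> fi; exact: (integrableZl measurableT k fi). Qed.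

Lemma intgB f g : intg f -> intg g -> intg (fun x => f x - g x).
Proof. by move=> fi gi; have := integrableB measurableT fi gi. Qed.

Lemma intg_norm f : intg f -> intg (fun x => `|f x|).
Proof. by move=> /integrable_norm. Qed.

Lemma intg_bigsum (I : Type) (s : seq I) (f : I -> T -> R) :
  (forall i, intg (f i)) -> intg (fun x => \sum_(i <- s) f i x).
Proof.
move=> fi; elim: s => [|i s IHs].
  under [X in intg X]eq_fun do rewrite big_nil.
  exact: integrable0.
under [X in intg X]eq_fun do rewrite big_cons.
exact: intgD.
Qed.

Lemma Rintegral_bigsum (I : Type) (s : seq I) (f : I -> T -> R) :
  (forall i, intg (f i)) ->
  \int[mu]_x (\sum_(i <- s) f i x) = \sum_(i <- s) \int[mu]_x f i x.
Proof.
move=> fi; elim: s => [|i s IHs].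
  under eq_Rintegral do rewrite big_nil.
  by rewrite big_nil /Rintegral integral0.
under eq_Rintegral do rewrite big_cons.
by rewrite RintegralD //; [rewrite IHs big_cons|exact: fi|exact: intg_bigsum].
Qed.

Lemma ae_eq_Rintegral (f g : T -> R) : measurable_fun setT f -> measurable_fun setT g ->
  {ae mu, forall x, f x = g x} -> \int[mu]_x f x = \int[mu]_x g x.
Proof.
move=> mf mg h; rewrite /Rintegral; congr fine; apply: ae_eq_integral => //.
- exact/measurable_EFinP.
- exact/measurable_EFinP.
- by apply: filterS h => x /= -> _.
Qed.

Lemma ge0_Rintegral_le (f g : T -> R) : intg f -> intg g -> (forall x, f x <= g x) ->
  \int[mu]_x f x <= \int[mu]_x g x.
Proof. by move=> fi gi h; apply: le_Rintegral. Qed.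
End real_integrals.

(** * Fourth moments and Wick's formula *)

Section wick.
Context {d : measure_display} {T : measurableType d} {R : realType}.
Variable Pr : probability T R.
Implicit Types a b c e : T -> R.

(** Products of up to four such functions are integrable, which is what both sides of Wick's formula
    require. Constants belong to the class and pad shorter products. *)
Definition L4 a := measurable_fun setT a /\ (\int[Pr]_w ((a w) ^+ 4)%:E < +oo)%E.

Lemma L4_intg a : L4 a -> intg Pr (fun w => a w ^+ 4).
Proof.
move=> [ma ha]; apply: intg_lty => //; first exact: measurable_funX.
by move=> x; rewrite exprn_even_ge0.
Qed.

Lemma norm_prod4_le (x y z t : R) : `|x * y * z * t| <= x ^+ 4 + y ^+ 4 + z ^+ 4 + t ^+ 4.
Proof.
have h (p q : R) : `|p * q| <= (p ^+ 2 + q ^+ 2) / 2.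
  rewrite ler_norml; have := sqr_ge0 (p - q); have := sqr_ge0 (p + q).
  by rewrite !expr2 => *; apply/andP; split; lra.
rewrite -mulrA; apply: le_trans (h _ _) _.
have k (p q : R) : (p * q) ^+ 2 <= (p ^+ 4 + q ^+ 4) / 2.
  have := sqr_ge0 (p ^+ 2 - q ^+ 2); rewrite exprMn sqrrB -!exprM; lra.
have := k x y; have := k z t.
have p4 (p : R) : 0 <= p ^+ 4 by rewrite exprn_even_ge0.
have := p4 x; have := p4 y; have := p4 z; have := p4 t; lra.
Qed.

Lemma L4_prod4 a b c e : L4 a -> L4 b -> L4 c -> L4 e ->
  intg Pr (fun w => a w * b w * c w * e w).
Proof.
move=> ha hb hc he.
apply: (@intg_le _ _ _ _ _ (fun w => a w ^+ 4 + b w ^+ 4 + c w ^+ 4 + e w ^+ 4)).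
- apply: measurable_funM; last exact: he.1.
  apply: measurable_funM; last exact: hc.1.
  by apply: measurable_funM; [exact: ha.1|exact: hb.1].
- by do 3?apply: intgD; exact: L4_intg.
- by move=> x; exact: norm_prod4_le.
Qed.

Lemma L4_cst (k : R) : L4 (cst k).
Proof.
split => //=; have := @integral_cst _ _ _ Pr setT measurableT (k ^+ 4)%:E.
rewrite /cst => ->.
by rewrite [X in (_ * X)%E](probability_setT Pr) mule1 ltry.
Qed.

Lemma L4_prod2 a b : L4 a -> L4 b -> intg Pr (fun w => a w * b w).
Proof.
move=> ha hb; have := L4_prod4 ha hb (L4_cst 1) (L4_cst 1).
by under [X in intg _ X -> _]eq_fun do rewrite /= !mulr1.
Qed.

Lemma L4_intg1 a : L4 a -> intg Pr a.
Proof.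
move=> ha; have := L4_prod2 ha (L4_cst 1).
by under [X in intg _ X -> _]eq_fun do rewrite /= !mulr1.
Qed.

Lemma pow4_add_le (x y : R) : (x + y) ^+ 4 <= 8 * (x ^+ 4 + y ^+ 4).
Proof.
have h (p q : R) : (p + q) ^+ 2 <= 2 * (p ^+ 2 + q ^+ 2).
  by have := sqr_ge0 (p - q); rewrite !expr2; lra.
have -> : (x + y) ^+ 4 = ((x + y) ^+ 2) ^+ 2 by rewrite -exprM.
apply: (@le_trans _ _ ((2 * (x ^+ 2 + y ^+ 2)) ^+ 2)).
  by rewrite lerXn2r ?nnegrE ?sqr_ge0 ?mulr_ge0 ?addr_ge0 ?sqr_ge0.
by rewrite exprMn; have := h (x ^+ 2) (y ^+ 2); rewrite -!exprM; lra.
Qed.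

Lemma L4D a b : L4 a -> L4 b -> L4 (fun w => a w + b w).
Proof.
move=> ha hb; have mab : measurable_fun setT (fun w => a w + b w).
  by apply: measurable_funD; [exact: ha.1|exact: hb.1].
split => //; apply: integrable_lty => //.
apply: (@intg_le _ _ _ _ _ (fun w => 8 * (a w ^+ 4 + b w ^+ 4))).
- exact: measurable_funX.
- by apply: intgZ; apply: intgD; exact: L4_intg.
- by move=> w; rewrite ger0_norm ?pow4_add_le // exprn_even_ge0.
Qed.

Lemma L4Z (k : R) a : L4 a -> L4 (fun w => k * a w).
Proof.
move=> ha; have mab : measurable_fun setT (fun w => k * a w).
  by apply: measurable_funM => //; exact: ha.1.
split => //; apply: integrable_lty => //.
under [X in _.-integrable _ X]eq_fun do rewrite exprMn.
by apply: intgZ; exact: L4_intg.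
Qed.

Lemma L4_sum (I : Type) (s : seq I) (f : I -> T -> R) :
  (forall i, L4 (f i)) -> L4 (fun w => \sum_(i <- s) f i w).
Proof.
move=> h; elim: s => [|i s IHs].
  under eq_fun do rewrite big_nil; exact: L4_cst.
by under eq_fun do rewrite big_cons; exact: L4D.
Qed.

Definition Wick a b c e :=
  \int[Pr]_w (a w * b w * c w * e w) =
    \int[Pr]_w (a w * b w) * \int[Pr]_w (c w * e w) +
    \int[Pr]_w (a w * c w) * \int[Pr]_w (b w * e w) +
    \int[Pr]_w (a w * e w) * \int[Pr]_w (b w * c w).

(** Lets a statement about the first slot be applied to each of the four slots in turn. *)
Lemma Wick_rot a b c e : Wick a b c e -> Wick b c e a.
Proof.
rewrite /Wick => h.
have -> : \int[Pr]_w (b w * c w * e w * a w) = \int[Pr]_w (a w * b w * c w * e w).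
  by apply: eq_Rintegral => w _; ring.
rewrite h.
have -> : \int[Pr]_w (e w * a w) = \int[Pr]_w (a w * e w).
  by apply: eq_Rintegral => w _; rewrite mulrC.
have -> : \int[Pr]_w (c w * a w) = \int[Pr]_w (a w * c w).
  by apply: eq_Rintegral => w _; rewrite mulrC.
have -> : \int[Pr]_w (b w * a w) = \int[Pr]_w (a w * b w).
  by apply: eq_Rintegral => w _; rewrite mulrC.
ring.
Qed.

(* Polarization of the identity E G^4 = 3 (E G^2)^2. *)
Lemma Wick_of_moments a b c e : L4 a -> L4 b -> L4 c -> L4 e ->
  (forall x y z : R, let G w := a w + x * b w + y * c w + z * e w in
     \int[Pr]_w (G w ^+ 4) = 3 * (\int[Pr]_w (G w ^+ 2)) ^+ 2) ->
  Wick a b c e.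
Proof.
move=> ha hb hc he hG; rewrite /Wick.
pose G x y z w := a w + x * b w + y * c w + z * e w.
have LG x y z : L4 (G x y z).
  by rewrite /G; do 3?apply: L4D; try exact: L4Z.
(* All eight sign triples. Weighting by x y z kills every monomial of the fourth power except a b c
   e, whose coefficient is 4! = 24; whence 192 = 8 * 24. *)
pose s : seq (R * R * R) := [:: (1, 1, 1); (-1, -1, 1); (-1, 1, -1); (1, -1, -1);
   (-1, 1, 1); (1, -1, 1); (1, 1, -1); (-1, -1, -1)].
have E4 : 192 * \int[Pr]_w (a w * b w * c w * e w) =
    \sum_(p <- s) p.1.1 * p.1.2 * p.2 * \int[Pr]_w (G p.1.1 p.1.2 p.2 w ^+ 4).
  rewrite -RintegralZl //; last exact: L4_prod4.
  transitivity (\int[Pr]_w (\sum_(p <- s) p.1.1 * p.1.2 * p.2 * G p.1.1 p.1.2 p.2 w ^+ 4)).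
    by apply: eq_Rintegral => w _; rewrite !big_cons big_nil /= /G; ring.
  rewrite Rintegral_bigsum; last by move=> p; apply: intgZ; exact: L4_intg.
  by apply: eq_bigr => p _; rewrite RintegralZl //; exact: L4_intg.
have E2 x y z : \int[Pr]_w (G x y z w ^+ 2) =
   \int[Pr]_w (a w * a w) + x ^+ 2 * \int[Pr]_w (b w * b w) +
   y ^+ 2 * \int[Pr]_w (c w * c w) + z ^+ 2 * \int[Pr]_w (e w * e w) +
   2 * x * \int[Pr]_w (a w * b w) + 2 * y * \int[Pr]_w (a w * c w) +
   2 * z * \int[Pr]_w (a w * e w) + 2 * x * y * \int[Pr]_w (b w * c w) +
   2 * x * z * \int[Pr]_w (b w * e w) + 2 * y * z * \int[Pr]_w (c w * e w).
  pose f i : T -> R := nth a [:: a; b; c; e] i.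
  pose t : seq (R * (nat * nat)) := [:: (1, (0, 0)%N); (x ^+ 2, (1, 1)%N); (y ^+ 2, (2, 2)%N);
    (z ^+ 2, (3, 3)%N); (2 * x, (0, 1)%N); (2 * y, (0, 2)%N); (2 * z, (0, 3)%N);
    (2 * x * y, (1, 2)%N); (2 * x * z, (1, 3)%N); (2 * y * z, (2, 3)%N)].
  have Lf i : L4 (f i) by rewrite /f; do 5?[case: i => [//|i]]; rewrite /= ?nth_nil.
  transitivity (\int[Pr]_w (\sum_(p <- t) p.1 * (f p.2.1 w * f p.2.2 w))).
    by apply: eq_Rintegral => w _; rewrite /t !big_cons big_nil /= /G /f /=; ring.
  rewrite Rintegral_bigsum; last by move=> p; apply: intgZ; exact: L4_prod2.
  rewrite (eq_bigr (fun p => p.1 * \int[Pr]_w (f p.2.1 w * f p.2.2 w))); last first.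
    by move=> p _; rewrite RintegralZl //; exact: L4_prod2.
  by rewrite !big_cons big_nil /= /f /=; ring.
have n192 : (192 : R) != 0 by rewrite pnatr_eq0.
apply: (mulfI n192); rewrite E4 !big_cons big_nil /= !hG -!/(G _ _ _ _) !E2.
ring.
Qed.

Lemma L4_of_bound a (v : R) : measurable_fun setT a ->
  (\int[Pr]_w ((a w) ^+ 4)%:E <= v%:E)%E -> L4 a.
Proof. by move=> ma h; split => //; apply: le_lt_trans h _; rewrite ltry. Qed.

End wick.

(** * Moments of integrals of random paths over time *)

Section time_integral.
Context {d : measure_display} {T : measurableType d} {R : realType}.
Variable Pr : probability T R.
Local Notation mu := (@lebesgue_measure R).
Variables (X : R -> T -> R) (phi : R -> R) (M : R).
Hypothesis mX : measurable_fun [set: R * T] (fun p => X p.1 p.2).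
Hypothesis iphi : intg mu phi.
(** The bound is required only where [phi] does not vanish: the moments of fractional motion are
    bounded on compact sets of times, not on the line. *)
Hypothesis XM : forall t, phi t != 0 -> (\int[Pr]_w ((X t w) ^+ 4)%:E <= M%:E)%E.

Let Z w := \int[mu]_t (phi t * X t w).

Let mXt t : measurable_fun setT (X t).
Proof. exact: (measurableT_comp mX (measurable_pair1 t)). Qed.

Let mXw w : measurable_fun setT (X ^~ w).
Proof. exact: (measurableT_comp mX (measurable_pair2 w)). Qed.

Let mphi1 : measurable_fun [set: R * T] (fun p : R * T => phi p.1).
Proof. exact: (measurableT_comp (intg_measurable iphi) measurable_fst). Qed.

Let X4 t : phi t != 0 -> L4 Pr (X t).
Proof. by move=> /XM h; apply: L4_of_bound h. Qed.

(** Joint integrability, the license for every use of Fubini below: a bound on the expectation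
    uniform in time is integrated against |phi|. *)
Lemma time_integral_int (Y : T -> R) (C : R) : measurable_fun setT Y ->
  (forall t, phi t != 0 -> intg Pr (fun w => X t w * Y w) /\ \int[Pr]_w `|X t w * Y w| <= C) ->
  (mu \x Pr)%E.-integrable [set: R * T] (fun p => (phi p.1 * (X p.1 p.2 * Y p.2))%:E).
Proof.
move=> mY h; apply/integrable12ltyP.
  apply/measurable_EFinP; apply: measurable_funM; first exact: mphi1.
  apply: measurable_funM => //; exact: (measurableT_comp mY measurable_snd).
have iC : intg mu (fun t => `|phi t| * C).
  by under [X in intg _ X]eq_fun do rewrite mulrC; apply: intgZ; exact: intg_norm.
apply: (@le_lt_trans _ _ (\int[mu]_t (`|phi t| * C)%:E)%E); last exact: integrable_lty iC.
apply: ge0_le_integral => //=.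
- by move=> x _; apply: integral_ge0.
- apply: (@measurable_fun_fubini_tonelli_F _ _ _ _ _ Pr (fun p => `|phi p.1 * (X p.1 p.2 * Y p.2)|%:E)) => //=.
  apply/measurable_EFinP; apply: measurableT_comp => //.
  apply: measurable_funM; first exact: mphi1.
  apply: measurable_funM => //; exact: (measurableT_comp mY measurable_snd).
- by apply/measurable_EFinP; exact: (intg_measurable iC).
move=> t _; have [->|nz] := eqVneq (phi t) 0.
  rewrite normr0 mul0r.
  under eq_integral do rewrite mul0r normr0.
  by rewrite integral0.
under eq_integral do rewrite normrM EFinM.
rewrite ge0_integralZl //=; last first.
  apply/measurable_EFinP; apply: measurableT_comp => //; exact: measurable_funM.
have [i1 i2] := h t nz.
rewrite intgE; last exact: intg_norm.
by rewrite -EFinM lee_fin ler_wpM2l.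
Qed.

Lemma XM1 t : phi t != 0 -> intg Pr (X t) /\ \int[Pr]_w `|X t w| <= M + 3.
Proof.
move=> nz; have i1 := L4_intg1 (X4 nz); split => //.
apply: (@le_trans _ _ (\int[Pr]_w (X t w ^+ 4 + 3))).
  apply: ge0_Rintegral_le; first exact: intg_norm.
    by apply: intgD; [exact: L4_intg (X4 nz)|exact: L4_intg1 (L4_cst _ _)].
  (* The crude bound |x| <= x^4 + 1 + 1 + 1 is the origin of the constant M + 3. *)
  move=> w; have := norm_prod4_le (X t w) 1 1 1.
  by rewrite !mulr1 !expr1n; lra.
rewrite RintegralD //; [|exact: L4_intg (X4 nz)|exact: L4_intg1 (L4_cst _ 3)].
rewrite Rintegral_cst // [X in fine X](probability_setT Pr) /= mulr1 lerD2r.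
rewrite -lee_fin -intgE; last exact: L4_intg (X4 nz).
exact: XM.
Qed.

Lemma time_integral_int1 :
  (mu \x Pr)%E.-integrable [set: R * T] (fun p => (phi p.1 * X p.1 p.2)%:E).
Proof.
have := @time_integral_int (cst 1) (M + 3).
under [X in _ -> _ -> _.-integrable _ X]eq_fun do rewrite /= mulr1.
apply => // t nz; have [i1 i2] := XM1 nz.
split; first by under [X in intg _ X]eq_fun do rewrite /= mulr1.
by under eq_Rintegral do rewrite /= mulr1.
Qed.

Lemma measurable_time_integral : measurable_fun setT Z.
Proof.
apply: measurableT_comp; first exact: fine_measurable.
exact: (measurable_fubini_G time_integral_int1).
Qed.

Lemma ae_time_integrable : {ae Pr, forall w, intg mu (fun t => phi t * X t w)}.
Proof. exact: (ae_integrable2 time_integral_int1). Qed.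

Lemma expectation_time_integral (Y : T -> R) (C : R) : measurable_fun setT Y ->
  (forall t, phi t != 0 -> intg Pr (fun w => X t w * Y w) /\ \int[Pr]_w `|X t w * Y w| <= C) ->
  \int[Pr]_w (Z w * Y w) = \int[mu]_t (phi t * \int[Pr]_w (X t w * Y w)).
Proof.
move=> mY h; have ip := time_integral_int mY h.
have := Fubini ip; rewrite /= => F.
transitivity (fine (\int[mu]_x \int[Pr]_y (phi x * (X x y * Y y))%:E)%E); last first.
  rewrite /Rintegral; congr fine; apply: eq_integral => t _.
  have [->|nz] := eqVneq (phi t) 0.
    rewrite mul0r; under eq_integral do rewrite mul0r.
    by rewrite integral0.
  have [i1 _] := h t nz.
  by rewrite -RintegralZl // -intgE //; exact: intgZ.
rewrite F /Rintegral; congr fine; apply: ae_eq_integral => //.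
- apply/measurable_EFinP; apply: measurable_funM => //; exact: measurable_time_integral.
- exact: (measurable_fubini_G ip).
- apply: filterS ae_time_integrable => w iw _ /=.
  have i2 : intg mu (fun t => phi t * (X t w * Y w)).
    by under [X in intg _ X]eq_fun do rewrite mulrA mulrC; exact: intgZ.
  rewrite (intgE i2) /Z -RintegralZr //; congr EFin; apply: eq_Rintegral => t _.
  by rewrite mulrA.
Qed.

(** Jensen's inequality for the weight |phi|, from the tangent line y^4 >= 4 m^3 y - 3 m^4 at m = I
    / (Phi + 1); the added 1 keeps [m] meaningful when [phi] vanishes. The second alternative is for
    paths whose weighted fourth power has infinite integral. *)
Lemma time_integral_pow4 w : (Z w) ^+ 4 <=
  (\int[mu]_t `|phi t| + 1) ^+ 3 * fine (\int[mu]_t (`|phi t| * X t w ^+ 4)%:E)%E \/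
   (\int[mu]_t (`|phi t| * X t w ^+ 4)%:E = +oo)%E.
Proof.
have m4 : measurable_fun setT (fun t => `|phi t| * X t w ^+ 4).
  apply: measurable_funM; last by apply: measurable_funX; exact: mXw.
  exact: (intg_measurable (intg_norm iphi)).
have p4 (p : R) : 0 <= p ^+ 4 by rewrite exprn_even_ge0.
have [foo|] := ltP (\int[mu]_t (`|phi t| * X t w ^+ 4)%:E)%E +oo%E; last first.
  by rewrite leye_eq => /eqP ->; right.
left; have i4 : intg mu (fun t => `|phi t| * X t w ^+ 4).
  by apply: intg_lty => // t; rewrite mulr_ge0.
have iabs : intg mu (fun t => `|phi t|) by exact: intg_norm.
have i1 : intg mu (fun t => `|phi t * X t w|).
  have ig : intg mu (fun t => `|phi t| * X t w ^+ 4 + 3 * `|phi t|).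
    by apply: intgD => //; apply: intgZ.
  apply: (intg_le _ ig).
  - apply: measurableT_comp => //; apply: measurable_funM; last exact: mXw.
    exact: (intg_measurable iphi).
  - move=> t; rewrite normr_id normrM [3 * _]mulrC -mulrDr ler_wpM2l //.
    have := norm_prod4_le (X t w) 1 1 1.
    by rewrite !mulr1 !expr1n; lra.
have i0 : intg mu (fun t => phi t * X t w).
  apply: (intg_le _ i1) => //.
  by apply: measurable_funM; [exact: (intg_measurable iphi)|exact: mXw].
set Phi := \int[mu]_t `|phi t|; set I := \int[mu]_t `|phi t * X t w|.
have Phi0 : 0 <= Phi by apply: Rintegral_ge0.
have I0 : 0 <= I by apply: Rintegral_ge0.
rewrite -/(Rintegral mu setT (fun t => `|phi t| * X t w ^+ 4)).
set J := \int[mu]_t (`|phi t| * X t w ^+ 4).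
have ZI : `|Z w| <= I by exact: le_normr_Rintegral.
have P0 : 0 < Phi + 1 by rewrite ltr_wpDl.
pose m := I / (Phi + 1).
have m0 : 0 <= m by rewrite divr_ge0 // ltW.
have Im : I = m * (Phi + 1) by rewrite /m divfK // gt_eqF.
have key : 4 * m ^+ 3 * I - 3 * m ^+ 4 * Phi <= J.
  have <- : \int[mu]_t (4 * m ^+ 3 * `|phi t * X t w| - 3 * m ^+ 4 * `|phi t|) =
      4 * m ^+ 3 * I - 3 * m ^+ 4 * Phi.
    by rewrite RintegralB //; [rewrite !RintegralZl|exact: intgZ|exact: intgZ].
  apply: ge0_Rintegral_le => //; first by apply: intgB; exact: intgZ.
  move=> t; rewrite normrM mulrCA [3 * _ * _]mulrC -mulrBr ler_wpM2l //.
  have -> : X t w ^+ 4 = `|X t w| ^+ 4 by rewrite -normrX ger0_norm.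
  move: `|X t w| (normr_ge0 (X t w)) => y y0.
  rewrite -subr_ge0 (_ : _ - _ = (y - m) ^+ 2 * (y ^+ 2 + 2 * m * y + 3 * m ^+ 2)); last by ring.
  apply: mulr_ge0; first exact: sqr_ge0.
  have := mulr_ge0 m0 y0; have := sqr_ge0 y; have := sqr_ge0 m; lra.
apply: (@le_trans _ _ (I ^+ 4)).
  have -> : Z w ^+ 4 = `|Z w| ^+ 4 by rewrite -normrX ger0_norm.
  by rewrite lerXn2r ?nnegrE.
have -> : I ^+ 4 = (Phi + 1) ^+ 3 * (m ^+ 3 * I) by rewrite {1}Im Im; ring.
rewrite ler_wpM2l ?exprn_ge0 ?(ltW P0) //; apply: le_trans key.
rewrite Im; have : 0 <= m ^+ 4 by [].
have -> : m ^+ 3 * (m * (Phi + 1)) = m ^+ 4 * (Phi + 1) by ring.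
have -> : 4 * m ^+ 3 * (m * (Phi + 1)) = 4 * m ^+ 4 * (Phi + 1) by ring.
lra.
Qed.

(** Jensen's bound is integrated over the outcomes and the integrals are exchanged by Tonelli. Since
    the constant is positive, the bound is also true, being infinite, on the exceptional paths. *)
Lemma L4_time_integral : L4 Pr Z.
Proof.
split; first exact: measurable_time_integral.
have p4 (p : R) : 0 <= p ^+ 4 by rewrite exprn_even_ge0.
have m4 : measurable_fun [set: R * T] (fun p => `|phi p.1| * X p.1 p.2 ^+ 4).
  apply: measurable_funM; last by apply: measurable_funX.
  exact: measurableT_comp.
pose K := (\int[mu]_t `|phi t| + 1) ^+ 3.
have K0 : 0 <= K by rewrite exprn_ge0 // addr_ge0 // Rintegral_ge0.
apply: (@le_lt_trans _ _ (\int[Pr]_w (K%:E * \int[mu]_t (`|phi t| * X t w ^+ 4)%:E))%E).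
  apply: ge0_le_integral => //=.
  - by move=> w _; rewrite lee_fin.
  - by apply/measurable_EFinP/measurable_funX; exact: measurable_time_integral.
  - apply: measurable_funeM.
    apply: (@measurable_fun_fubini_tonelli_G _ _ _ _ _ mu (fun p => (`|phi p.1| * X p.1 p.2 ^+ 4)%:E)) => //=.
      exact/measurable_EFinP.
    by move=> p; rewrite lee_fin mulr_ge0.
  move=> w _; have g0 : (0 <= \int[mu]_t (`|phi t| * X t w ^+ 4)%:E)%E.
    by apply: integral_ge0 => t _; rewrite lee_fin mulr_ge0.
  have K1 : 0 < K by rewrite exprn_gt0 // ltr_wpDl // Rintegral_ge0.
  have [h|->] := time_integral_pow4 w; last by rewrite gt0_muley ?leey // lte_fin.
  move: h g0; set J := (\int[mu]_t (`|phi t| * X t w ^+ 4)%:E)%E.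
  case: J => [r| |] //= h _.
  by rewrite gt0_muley ?leey // lte_fin.
rewrite ge0_integralZl //=; first last.
- by move=> w _; apply: integral_ge0 => t _; rewrite lee_fin mulr_ge0.
- apply: (@measurable_fun_fubini_tonelli_G _ _ _ _ _ mu (fun p => (`|phi p.1| * X p.1 p.2 ^+ 4)%:E)) => //=.
    exact/measurable_EFinP.
  by move=> p; rewrite lee_fin mulr_ge0.
rewrite -(@fubini_tonelli _ _ _ _ _ mu Pr (fun p => (`|phi p.1| * X p.1 p.2 ^+ 4)%:E)) /=; first last.
- by move=> p; rewrite lee_fin mulr_ge0.
- exact/measurable_EFinP.
have iM : intg mu (fun t => M * `|phi t|) by apply: intgZ; exact: intg_norm.
apply: (@le_lt_trans _ _ (K%:E * \int[mu]_t (M * `|phi t|)%:E)%E); last first.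
  by rewrite intgE // -EFinM ltry.
rewrite lee_wpmul2l ?lee_fin //; apply: ge0_le_integral => //=.
- by move=> t _; apply: integral_ge0 => w _; rewrite lee_fin mulr_ge0.
- apply: (@measurable_fun_fubini_tonelli_F _ _ _ _ _ Pr (fun p => (`|phi p.1| * X p.1 p.2 ^+ 4)%:E)) => //=.
    exact/measurable_EFinP.
  by move=> p; rewrite lee_fin mulr_ge0.
- by apply/measurable_EFinP; exact: (intg_measurable iM).
move=> t _; have [->|nz] := eqVneq (phi t) 0.
  rewrite normr0 mulr0; under eq_integral do rewrite mul0r.
  by rewrite integral0.
under eq_integral do rewrite EFinM.
rewrite ge0_integralZl //=; first last.
- by move=> w _; rewrite lee_fin.
- by apply/measurable_EFinP; exact: measurable_funX.
by rewrite mulrC EFinM lee_wpmul2l ?lee_fin // XM.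
Qed.

Lemma time_integral_bound4 b c e : L4 Pr b -> L4 Pr c -> L4 Pr e -> exists C, forall t, phi t != 0 ->
  intg Pr (fun w => X t w * (b w * c w * e w)) /\ \int[Pr]_w `|X t w * (b w * c w * e w)| <= C.
Proof.
move=> hb hc he.
exists (M + \int[Pr]_w (b w ^+ 4) + \int[Pr]_w (c w ^+ 4) + \int[Pr]_w (e w ^+ 4)) => t nz.
have hX := X4 nz.
have i1 : intg Pr (fun w => X t w * (b w * c w * e w)).
  by under [X in intg _ X]eq_fun do rewrite !mulrA; exact: L4_prod4.
split => //.
apply: (@le_trans _ _ (\int[Pr]_w (X t w ^+ 4 + b w ^+ 4 + c w ^+ 4 + e w ^+ 4))).
  apply: ge0_Rintegral_le; first exact: intg_norm.
    by do 3?apply: intgD; exact: L4_intg.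
  by move=> w; rewrite !mulrA; exact: norm_prod4_le.
have Li a : L4 Pr a -> Pr.-integrable setT (EFin \o (fun w => a w ^+ 4)) by move=> /L4_intg.
rewrite RintegralD //; [|do 2?apply: intgD; exact: L4_intg|exact: L4_intg].
rewrite RintegralD //; [|apply: intgD; exact: L4_intg|exact: L4_intg].
rewrite RintegralD //; [|exact: L4_intg|exact: L4_intg].
by rewrite !lerD2r -lee_fin -intgE ?XM //; exact: L4_intg.
Qed.

Lemma time_integral_cov b : L4 Pr b ->
  \int[Pr]_w (Z w * b w) = \int[mu]_t (phi t * \int[Pr]_w (X t w * b w)) /\
  intg mu (fun t => phi t * \int[Pr]_w (X t w * b w)).
Proof.
move=> hb; have [C hC] := time_integral_bound4 hb (L4_cst Pr 1) (L4_cst Pr 1).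
have hC' t : phi t != 0 -> intg Pr (fun w => X t w * b w) /\ \int[Pr]_w `|X t w * b w| <= C.
  move=> /hC; under [X in intg _ X]eq_fun do rewrite /= !mulr1.
  by under eq_Rintegral do rewrite /= !mulr1.
have mb := hb.1; split; first exact: (expectation_time_integral mb hC').
have ip := time_integral_int mb hC'.
have := integrable_fubini_F ip; rewrite /intg.
apply: eq_integrable => // t _ /=; rewrite /fubini_F /=.
have [->|nz] := eqVneq (phi t) 0.
  rewrite mul0r; under eq_integral do rewrite mul0r.
  by rewrite integral0.
have [i1 _] := hC' t nz.
by rewrite -RintegralZl // -intgE //; exact: intgZ.
Qed.

(** Both sides are linear in the first factor and commute with the integral over time, so the
    formula passes to [Z] without any knowledge of its law. *)
Lemma Wick_time_integral b c e : L4 Pr b -> L4 Pr c -> L4 Pr e ->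
  (forall t, phi t != 0 -> Wick Pr (X t) b c e) -> Wick Pr Z b c e.
Proof.
move=> hb hc he hW; rewrite /Wick.
have [C hC] := time_integral_bound4 hb hc he.
have mY : measurable_fun setT (fun w => b w * c w * e w).
  apply: measurable_funM; last exact: he.1.
  by apply: measurable_funM; [exact: hb.1|exact: hc.1].
have -> : \int[Pr]_w (Z w * b w * c w * e w) = \int[Pr]_w (Z w * (b w * c w * e w)).
  by apply: eq_Rintegral => w _; rewrite !mulrA.
rewrite (expectation_time_integral mY hC).
have [-> ib] := time_integral_cov hb.
have [-> ic] := time_integral_cov hc.
have [-> ie] := time_integral_cov he.
rewrite -!RintegralZr // -!RintegralD //; first last.
- by under [X in _.-integrable _ X]eq_fun do rewrite /= mulrC; apply: intgZ.
- by under [X in _.-integrable _ X]eq_fun do rewrite /= mulrC; apply: intgZ.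
- by under [X in _.-integrable _ X]eq_fun do rewrite /= mulrC; apply: intgZ.
- apply: intgD.
    by under [X in intg _ X]eq_fun do rewrite /= mulrC; apply: intgZ.
  by under [X in intg _ X]eq_fun do rewrite /= mulrC; apply: intgZ.
apply: eq_Rintegral => t _; have [->|nz] := eqVneq (phi t) 0; first by ring.
have -> : \int[Pr]_x (X t x * (b x * c x * e x)) = \int[Pr]_x (X t x * b x * c x * e x).
  by apply: eq_Rintegral => w _; rewrite !mulrA.
by rewrite (hW t nz); ring.
Qed.

End time_integral.

(** * Fourier uniqueness *)

Section affine_change.
Variable R : realType.
Local Notation mu := (@lebesgue_measure R).
Variables (a b : R).
Hypothesis a0 : 0 < a.

Let g : R -> measurableTypeR R := fun x => a * x + b.

Let mg : measurable_fun [set: measurableTypeR R] g.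
Proof. by apply: measurable_funD => //; apply: measurable_funM. Qed.

Lemma lebesgue_measure_affine (A : set R) : measurable A ->
  mu A = (a%:E * pushforward mu g A)%E.
Proof.
move=> mA.
have an : 0 <= a by exact: ltW.
pose k := NngNum an.
have -> : (a%:E * pushforward mu g A = mscale k (pushforward mu g) A)%E by [].
apply: lebesgue_measure_unique => //= _ [[x y]] _ <-.
rewrite /mscale /= /pushforward.
have -> : g @^-1` `]x, y] = `](x - b) / a, (y - b) / a]%classic.
  apply/seteqP; split => z /=; rewrite !in_itv /= /g ltr_pdivrMr // ler_pdivlMr // [z * a]mulrC ltrBlDr lerBrDr //.
rewrite !lebesgue_measure_itv /= !lte_fin ltr_pM2r ?invr_gt0 // ltrD2r.
case: ifPn => _; last by rewrite mule0.
rewrite -!EFinB -EFinM -mulrBl; congr EFin; field; exact: lt0r_neq0.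
Qed.

Lemma ge0_integral_affine (f : R -> \bar R) : measurable_fun setT f ->
  (forall x, (0 <= f x)%E) ->
  (\int[mu]_x f x = a%:E * \int[mu]_x f (a * x + b)%R)%E.
Proof.
move=> mf f0.
have an : 0 <= a by exact: ltW.
pose k := NngNum an.
rewrite (eq_measure_integral (mscale k (pushforward mu g))); last first.
  by move=> A mA _; exact: (lebesgue_measure_affine mA).
rewrite ge0_integral_mscale //=; congr (_ * _)%E.
by rewrite (ge0_integral_pushforward mg) // preimage_setT.
Qed.

(** Positive and negative parts are transformed separately, so that the identity also covers
    pathwise integrals that may diverge. *)
Lemma Rintegral_affine (f : R -> R) : measurable_fun setT f ->
  \int[mu]_x f x = a * \int[mu]_x f (a * x + b).
Proof.
move=> mf.
have mf' : measurable_fun [set: measurableTypeR R] (EFin \o f) by apply/measurable_EFinP.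
rewrite /Rintegral integralE [in RHS]integralE.
rewrite (ge0_integral_affine (measurable_funepos mf')) ?(ge0_integral_affine (measurable_funeneg mf')) //.
have -> : (\int[mu]_x ((EFin \o f)^\+)%E (a * x + b)%R = \int[mu]_x ((fun x => (f (a * x + b))%:E)^\+)%E x)%E.
  by apply: eq_integral => x _; rewrite ?funeposE ?funenegE.
have -> : (\int[mu]_x ((EFin \o f)^\-)%E (a * x + b)%R = \int[mu]_x ((fun x => (f (a * x + b))%:E)^\-)%E x)%E.
  by apply: eq_integral => x _; rewrite ?funeposE ?funenegE.
move: (integral _ _ _) (integral _ _ _) => [p| |] [q| |] //=;
  by rewrite ?gt0_muley ?gt0_muleNy ?lte_fin //= ?mulr0 ?mulrBr.
Qed.

Lemma intg_affine (f : R -> R) : intg mu f -> intg mu (fun x => f (a * x + b)).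
Proof.
move=> fi; have mf := intg_measurable fi.
have mfa : measurable_fun [set: measurableTypeR R] (fun x => f (a * x + b)).
  exact: (measurableT_comp mf mg).
apply/integrableP; split; first exact/measurable_EFinP.
have /integrableP[_] := fi.
rewrite (@ge0_integral_affine (fun x => `|(f x)%:E|%E)) //; last first.
  by apply: measurableT_comp => //; apply/measurable_EFinP.
move=> h; rewrite -(@lte_pmul2l _ a%:E) ?lte_fin // gt0_muley ?lte_fin //.
Qed.

End affine_change.

(** * Polynomial iterates approximating a step *)

Section smoothstep.
Variable R : realType.

(* Iterates of this polynomial on [0, 1] converge to 0 below 1/2 and to 1 above:
   composed with an affine function of a cosine they yield trigonometric
   polynomials approximating the indicator of an interval on the support of psi. *)
Definition smoothstep (z : R) : R := 3 * z ^+ 2 - 2 * z ^+ 3.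

Lemma smoothstep01 z : 0 <= z <= 1 -> 0 <= smoothstep z <= 1.
Proof.
move=> /andP[z0 z1]; apply/andP; split.
  have -> : smoothstep z = z ^+ 2 * (3 - 2 * z) by rewrite /smoothstep; ring.
  by rewrite mulr_ge0 ?sqr_ge0 //; lra.
rewrite -subr_ge0 (_ : _ - _ = (1 - z) ^+ 2 * (1 + 2 * z)); last by rewrite /smoothstep; ring.
by rewrite mulr_ge0 ?sqr_ge0 //; lra.
Qed.

Lemma iter_smoothstep01 z n : 0 <= z <= 1 -> 0 <= iter n smoothstep z <= 1.
Proof. by move=> h; elim: n => [//|n IHn]; rewrite iterS; exact: smoothstep01. Qed.

Lemma smoothstep1B z : smoothstep (1 - z) = 1 - smoothstep z.
Proof. by rewrite /smoothstep; ring. Qed.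

Lemma iter_smoothstep1B z n : iter n smoothstep (1 - z) = 1 - iter n smoothstep z.
Proof. by elim: n => [//|n IHn]; rewrite !iterS IHn smoothstep1B. Qed.

(** One step multiplies y by y (3 - 2 y), which for y <= z < 1/2 is at most q = z (3 - 2 z); and 1 -
    q = (1 - z)(1 - 2 z) is positive, so the decay is geometric. *)
Lemma cvg_iter_smoothstep0 z : 0 <= z < 2^-1 ->
  (fun n => iter n smoothstep z) @ \oo --> (0 : R).
Proof.
move=> /andP[z0 z1].
pose q := z * (3 - 2 * z).
have q0 : 0 <= q by rewrite mulr_ge0 //; lra.
have q1 : q < 1.
  rewrite -subr_gt0 (_ : 1 - q = (1 - z) * (1 - 2 * z)); last by rewrite /q; ring.
  by rewrite mulr_gt0 //; lra.
have key n : 0 <= iter n smoothstep z <= z /\ iter n smoothstep z <= geometric z q n.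
  elim: n => [|n [/andP[i0 iz] ig]]; first by rewrite /= expr0 mulr1 lexx z0.
  rewrite iterS; set y := iter n smoothstep z in i0 iz ig *.
  have e : smoothstep y = (y * (3 - 2 * y)) * y by rewrite /smoothstep; ring.
  have yq : y * (3 - 2 * y) <= q.
    rewrite -subr_ge0 /q (_ : _ - _ = (z - y) * (3 - 2 * (y + z))); last by ring.
    by rewrite mulr_ge0; lra.
  have y0 : 0 <= y * (3 - 2 * y) by rewrite mulr_ge0 //; lra.
  split; last first.
    by rewrite e /geometric /= exprS mulrCA ler_pM.
  rewrite e mulr_ge0 //=; apply: le_trans iz; rewrite ler_piMl //.
  exact: le_trans yq (ltW q1).
apply: (@squeeze_cvgr _ _ _ _ (cst 0) (geometric z q)).
- by apply: nearW => n; have [/andP[-> _] ->] := key n.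
- exact: cvg_cst.
- by apply: cvg_geometric; rewrite ger0_norm.
Qed.

Lemma cvg_iter_smoothstep1 z : 2^-1 < z <= 1 ->
  (fun n => iter n smoothstep z) @ \oo --> (1 : R).
Proof.
move=> /andP[z0 z1].
have -> : (fun n => iter n smoothstep z) = fun n => 1 - iter n smoothstep (1 - z).
  by apply/funext => n; rewrite iter_smoothstep1B subKr.
rewrite -[X in _ --> X]subr0; apply: cvgB; first exact: cvg_cst.
by apply: cvg_iter_smoothstep0; apply/andP; split; lra.
Qed.

Lemma iter_smoothstep_half n : iter n smoothstep 2^-1 = 2^-1.
Proof. by elim: n => [//|n IHn]; rewrite iterS IHn /smoothstep; field. Qed.
End smoothstep.

(** * A compactly supported integrable function with zero Fourier transform *)

Section fourier_uniqueness.
Variable R : realType.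
Local Notation mu := (@lebesgue_measure R).
Variable psi : R -> R.
Hypothesis ipsi : intg mu psi.
Hypothesis psi_cos0 : forall x, \int[mu]_t (cos (x * t) * psi t) = 0.
Hypothesis psi_sin0 : forall x, \int[mu]_t (sin (x * t) * psi t) = 0.

Lemma intg_bounded_mul (g : R -> R) (M : R) : measurable_fun setT g ->
  (forall t, `|g t| <= M) -> intg mu (fun t => g t * psi t).
Proof.
move=> mg gM.
have ig : intg mu (fun t => M * `|psi t|) by apply: intgZ; exact: intg_norm.
apply: (intg_le _ ig).
- by apply: measurable_funM => //; exact: (intg_measurable ipsi).
- by move=> t; rewrite normrM ler_wpM2r.
Qed.

Let mcos (x : R) : measurable_fun [set: R] (fun t => cos (x * t)).
Proof.
apply: continuous_measurable_fun => t.
apply: continuous_comp; [by apply: cvgM; [exact: cvg_cst|exact: cvg_id]|exact: continuous_cos].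
Qed.

Let msin (x : R) : measurable_fun [set: R] (fun t => sin (x * t)).
Proof.
apply: continuous_measurable_fun => t.
apply: continuous_comp; [by apply: cvgM; [exact: cvg_cst|exact: cvg_id]|exact: continuous_sin].
Qed.

(* The functions g for which g psi has vanishing Fourier transform. *)
Definition annih (g : R -> R) := [/\ measurable_fun setT g, exists M, forall t, `|g t| <= M,
  forall y, \int[mu]_t (cos (y * t) * g t * psi t) = 0 &
  forall y, \int[mu]_t (sin (y * t) * g t * psi t) = 0].

Lemma annih_intg (g h : R -> R) M : annih g -> measurable_fun setT h ->
  (forall t, `|h t| <= M) -> intg mu (fun t => h t * g t * psi t).
Proof.
move=> [mg [N gN] _ _] mh hM; apply: (@intg_bounded_mul (fun t => h t * g t) (M * N)).
  exact: measurable_funM.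
by move=> t; rewrite normrM ler_pM.
Qed.

Lemma annih_cst c : annih (cst c).
Proof.
split; [exact: measurable_cst|by exists (`|c|)| |] => y.
  have -> : \int[mu]_t (cos (y * t) * c * psi t) = \int[mu]_t (c * (cos (y * t) * psi t)).
    by apply: eq_Rintegral => t _; ring.
  rewrite RintegralZl ?psi_cos0 ?mulr0 //.
  by apply: (@intg_bounded_mul _ 1) => // t; exact: cos_max.
have -> : \int[mu]_t (sin (y * t) * c * psi t) = \int[mu]_t (c * (sin (y * t) * psi t)).
  by apply: eq_Rintegral => t _; ring.
rewrite RintegralZl ?psi_sin0 ?mulr0 //.
by apply: (@intg_bounded_mul _ 1) => // t; exact: sin_max.
Qed.

Lemma annihD g h : annih g -> annih h -> annih (fun t => g t + h t).
Proof.
move=> ag ah; have [mg [M gM] cg sg] := ag; have [mh [N hN] ch sh] := ah.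
split; first exact: measurable_funD.
- by exists (M + N) => t; apply: le_trans (ler_normD _ _) _; exact: lerD.
- move=> y; have -> : \int[mu]_t (cos (y * t) * (g t + h t) * psi t) =
     \int[mu]_t (cos (y * t) * g t * psi t + cos (y * t) * h t * psi t).
    by apply: eq_Rintegral => t _; ring.
  rewrite RintegralD ?cg ?ch ?addr0 //;
    by apply: (@annih_intg _ _ 1) => // t; exact: cos_max.
- move=> y; have -> : \int[mu]_t (sin (y * t) * (g t + h t) * psi t) =
     \int[mu]_t (sin (y * t) * g t * psi t + sin (y * t) * h t * psi t).
    by apply: eq_Rintegral => t _; ring.
  rewrite RintegralD ?sg ?sh ?addr0 //;
    by apply: (@annih_intg _ _ 1) => // t; exact: sin_max.
Qed.

(* The product formulas for cos and sin keep the frequencies inside the line. *)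
Lemma annih_mulcos g k u : annih g -> annih (fun t => cos (k * t - u) * g t).
Proof.
move=> ag; have [mg [M gM] cg sg] := ag.
have comb (c1 c2 c3 c4 y1 y2 : R) : \int[mu]_t (c1 * (cos (y1 * t) * g t * psi t) +
   c2 * (sin (y1 * t) * g t * psi t) + c3 * (cos (y2 * t) * g t * psi t) +
   c4 * (sin (y2 * t) * g t * psi t)) = 0.
  have ic y : intg mu (fun t => cos (y * t) * g t * psi t).
    by apply: (@annih_intg _ _ 1) => // t; exact: cos_max.
  have is_ y : intg mu (fun t => sin (y * t) * g t * psi t).
    by apply: (@annih_intg _ _ 1) => // t; exact: sin_max.
  rewrite RintegralD //; [|by do 2?apply: intgD; apply: intgZ|exact: intgZ].
  rewrite RintegralD //; [|by apply: intgD; apply: intgZ|exact: intgZ].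
  rewrite RintegralD //; [|exact: intgZ|exact: intgZ].
  have ec c y : \int[mu]_t (c * (cos (y * t) * g t * psi t)) = 0.
    by rewrite RintegralZl ?cg ?mulr0 //; exact: ic.
  have es c y : \int[mu]_t (c * (sin (y * t) * g t * psi t)) = 0.
    by rewrite RintegralZl ?sg ?mulr0 //; exact: is_.
  by rewrite !ec !es !addr0.
have mc : measurable_fun [set: R] (fun t => cos (k * t - u)).
  apply: continuous_measurable_fun => t; apply: continuous_comp; last exact: continuous_cos.
  apply: cvgB; last exact: cvg_cst.
  by apply: cvgM; [exact: cvg_cst|exact: cvg_id].
split; first exact: measurable_funM.
- by exists M => t; rewrite normrM -[leRHS]mul1r ler_pM ?cos_max.
- move=> y; rewrite -(comb (cos u / 2) (sin u / 2) (cos u / 2) (- sin u / 2) (k + y) (y - k)).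
  apply: eq_Rintegral => t _; rewrite cosB !mulrDl !(cosD, sinD) !mulNr !cosN !sinN.
  by field.
- move=> y; rewrite -(comb (- sin u / 2) (cos u / 2) (sin u / 2) (cos u / 2) (k + y) (y - k)).
  apply: eq_Rintegral => t _; rewrite cosB !mulrDl !(cosD, sinD) !mulNr !cosN !sinN.
  by field.
Qed.

Lemma annih_poly (p : {poly R}) k u : annih (fun t => p.[cos (k * t - u)]).
Proof.
elim/poly_ind: p => [|p c IHp].
  by under [X in annih X]eq_fun do rewrite horner0; exact: annih_cst.
under [X in annih X]eq_fun do rewrite hornerMXaddC mulrC.
by apply: annihD; [exact: annih_mulcos|exact: annih_cst].
Qed.

Fixpoint smoothpoly (p0 : {poly R}) n := if n is m.+1 then
  let p := smoothpoly p0 m in (3%:P * p ^+ 2 - 2%:P * p ^+ 3)%R else p0.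

Lemma horner_smoothpoly p0 n x : (smoothpoly p0 n).[x] = iter n (@smoothstep R) p0.[x].
Proof.
elim: n => [//|n IHn]; rewrite iterS -IHn /= /smoothstep.
by rewrite !hornerE /=; ring.
Qed.

Variables (A B : R).
Hypothesis supp : forall t, psi t != 0 -> A <= t <= B.

Lemma Rintegral_ball0 x r : 0 < r -> r < 1 -> \int[mu]_(t in `]x - r, x + r[%classic) psi t = 0.
Proof.
move=> r0 r1.
(* With frequency k = 1 / L the angles k |t - x|, for t in [A, B], and k r lie in [0, 1], inside
   [0, pi], where the cosine is decreasing and so decides whether |t - x| < r. *)
pose L := 1 + `|A| + `|B| + `|x|.
have L1 : 1 <= L by rewrite /L -!addrA lerDl !addr_ge0.
have L0 : 0 < L by exact: lt_le_trans L1.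
pose k := L^-1; have k0 : 0 < k by rewrite invr_gt0.
have k1 : k <= 1 by rewrite invf_le1.
pose th := cos (k * r).
pose p0 : {poly R} := (4^-1)%:P * ('X - th%:P) + (2^-1)%:P.
pose y t := p0.[cos (k * t - k * x)].
have yE t : y t = (cos (k * t - k * x) - th) / 4 + 2^-1.
  by rewrite /y /p0 !hornerE mulrC.
have y01 t : 0 <= y t <= 1.
  have := cos_le1 (k * t - k * x); have := cos_geN1 (k * t - k * x).
  have := cos_le1 (k * r); have := cos_geN1 (k * r); rewrite -/th yE => *.
  by apply/andP; split; lra.
have pi1 : 1 <= pi :> R by apply: le_trans (@pi_ge2 R); rewrite ler1n.
have ang t : A <= t <= B -> k * `|t - x| \in `[0, pi].
  move=> /andP[At tB]; rewrite in_itv /= mulr_ge0 ?(ltW k0) //=.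
  apply: le_trans pi1; rewrite ler_pdivrMl // mulr1 /L.
  have := ler_norm (- A); have := ler_norm B; rewrite normrN => *.
  have := ler_norm (- x); have := ler_norm x; rewrite normrN => *.
  have := normr_ge0 A; have := normr_ge0 B => *.
  by rewrite ler_norml; apply/andP; split; lra.
have angr : k * r \in `[0, pi].
  rewrite in_itv /= mulr_ge0 ?(ltW k0) ?(ltW r0) //=; apply: le_trans pi1.
  by rewrite mulr_ile1 // ltW.
have cosE t : cos (k * t - k * x) = cos (k * `|t - x|).
  have -> : k * `|t - x| = `|k * t - k * x| by rewrite -mulrBr normrM (gtr0_norm k0).
  by rewrite cos_norm.
pose lim t : R := if `|t - x| < r then 1 else if `|t - x| == r then 2^-1 else 0.
have cvgl t : A <= t <= B -> (fun n => iter n (@smoothstep R) (y t)) @ \oo --> lim t.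
  move=> tAB; rewrite /lim.
  have [lt|gt|e] := ltgtP `|t - x| r.
  - apply: cvg_iter_smoothstep1; have /andP[_ ->] := y01 t; rewrite andbT yE cosE.
    rewrite ltrDr divr_gt0 // subr_gt0 /th ltr_cos ?ang //.
    by rewrite ltr_pM2l.
  - apply: cvg_iter_smoothstep0; have /andP[-> _] := y01 t; rewrite yE cosE /=.
    rewrite gtrDr pmulr_llt0 ?invr_gt0 // subr_lt0 /th ltr_cos ?ang //.
    by rewrite ltr_pM2l.
  - have -> : y t = 2^-1 by rewrite yE cosE e /th subrr mul0r add0r.
    under eq_fun do rewrite iter_smoothstep_half.
    exact: cvg_cst.
pose F n t := iter n (@smoothstep R) (y t) * psi t.
have an n := annih_poly (smoothpoly p0 n) k (k * x).
have FE n t : F n t = (smoothpoly p0 n).[cos (k * t - k * x)] * psi t.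
  by rewrite horner_smoothpoly.
have F0 n : (\int[mu]_t (F n t)%:E = 0)%E.
  have ia : intg mu (F n).
    have [mg [M gM] _ _] := an n; rewrite (_ : F n = fun t => (smoothpoly p0 n).[cos (k * t - k * x)] * psi t); last exact/funext.
    exact: intg_bounded_mul gM.
  rewrite intgE //; congr EFin; have [_ _ /(_ 0) <- _] := an n.
  by apply: eq_Rintegral => t _; rewrite FE mul0r cos0 mul1r.
have mF n : measurable_fun [set: R] (F n).
  have [mg _ _ _] := an n; rewrite (_ : F n = fun t => (smoothpoly p0 n).[cos (k * t - k * x)] * psi t); last exact/funext.
  by apply: measurable_funM => //; exact: (intg_measurable ipsi).
have mball (u : R) : measurable_fun [set: R] (fun t : R => `|t - u|).
  by apply: measurableT_comp => //; exact: measurable_funB.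
have mlim : measurable_fun [set: R] lim.
  apply: measurable_fun_if => //; first exact: measurable_fun_ltr.
  by apply: measurable_funTS; apply: measurable_fun_if => //; exact: measurable_fun_eqr.
have limpsi : (\int[mu]_t (lim t * psi t)%:E = 0)%E.
  suff : (fun n => \int[mu]_t (F n t)%:E)%E @ \oo --> (\int[mu]_t (lim t * psi t)%:E)%E.
    under eq_fun do rewrite F0.
    by move=> /(cvg_unique _ (cvg_cst 0%E)) <-.
  apply: (@dominated_cvg _ _ R mu setT measurableT (fun n t => (F n t)%:E)
    (fun t => (lim t * psi t)%:E) (fun t => `|psi t|%:E)).
  - by move=> n; apply/measurable_EFinP; exact: mF.
  - move=> t _; apply: cvg_EFin; first exact: nearW.
    rewrite /F; have [->|nz] := eqVneq (psi t) 0.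
      by rewrite mulr0; under eq_fun do rewrite /= mulr0; exact: cvg_cst.
    by apply: cvgM; [apply: cvgl; exact: supp|exact: cvg_cst].
  - by [].
  - exact: intg_norm.
  - move=> n t _; rewrite lee_fin /F normrM ler_piMl //.
    by have /andP[i0 i1] := iter_smoothstep01 n (y01 t); rewrite ger0_norm.
rewrite Rintegral_mkcond -[RHS]/(fine 0%E) -limpsi.
apply: ae_eq_Rintegral.
- apply/(measurable_restrictT _ _).1 => //; apply: measurable_funTS; exact: (intg_measurable ipsi).
- by apply: measurable_funM => //; exact: (intg_measurable ipsi).
(* The pointwise limit differs from the indicator only at the two endpoints, where it is 1/2. *)
exists ([set x - r] `|` [set x + r]); split.
- by apply: measurableU.
- apply/eqP; rewrite -measure_le0.
  apply: le_trans (measureU2 _ _ _) _; try exact: measurable_set1.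
  rewrite -[leRHS](adde0 0%E).
  by apply: leeD; rewrite le_eqVlt; apply/orP; left; apply/eqP; exact: lebesgue_measure_set1.
move=> t /=; apply: contra_notP => /not_orP[n1 n2].
rewrite /patch; case: ifPn => tb.
  move: tb; rewrite inE /= in_itv /= => tb.
  by rewrite /lim ltr_distl tb mul1r.
rewrite /lim; have -> : (`|t - x| < r) = false.
  by apply/negP => h; move/negP: tb; apply; rewrite inE /= in_itv /= -ltr_distl.
have -> : (`|t - x| == r) = false; last by rewrite mul0r.
apply/negP; rewrite eqr_norml (ltW r0) andbT => /orP[/eqP e|/eqP e].
  by apply: n2; rewrite -e addrC subrK.
by apply: n1; rewrite -e addrC subrK.
Qed.

(** At a Lebesgue point x the mean of |psi - psi(x)| over small balls tends to 0; but it is at least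
    |psi(x)|, because the integral of psi over each of these balls is 0. *)
Lemma fourier_uniqueness : {ae mu, forall x, psi x = 0}.
Proof.
have loc : locally_integrable setT psi by apply: open_integrable_locally => //; exact: openT.
apply: filterS (lebesgue_differentiation loc); first exact: (ae_filter_ringOfSetsType mu).
move=> x; rewrite /lebesgue_pt => dav.
apply/eqP; rewrite -normr_le0 -lee_fin.
apply: (cvge_ge _ dav).
near=> r.
have r0 : 0 < r by near: r; exact: nbhs_right_gt.
have r1 : r < 1 by near: r; exact: nbhs_right_lt.
rewrite /davg /iavg lebesgue_measure_ball ?(ltW r0) //.
rewrite ball_itv; set U : set R := `]x - r, x + r[%classic.
have r2 : 0 < r *+ 2 by rewrite mulr2n addr_gt0.
have mb : measurable (U : set (measurableTypeR R)) by exact: measurable_itv.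
have ib : mu.-integrable U (EFin \o psi).
  by apply: integrableS ipsi.
have mub : mu U = (r *+ 2)%:E.
  by rewrite /U -ball_itv lebesgue_measure_ball ?(ltW r0).
rewrite inver gt_eqF // lee_pdivlMl //.
have ige0 : (\int[mu]_(y in U) (psi y)%:E = 0)%E.
  have := @Rintegral_ball0 x r r0 r1; rewrite /Rintegral => h.
  by rewrite -(fineK (integral_fune_fin_num _ ib)) //; congr EFin.
have icst : mu.-integrable U (fun=> (psi x)%:E).
  apply/integrableP; split; first exact: measurable_cst.
  by rewrite integral_cst //= [X in (_ * X)%E]mub -EFinM ltry.
have -> : ((r *+ 2)%:E * `|psi x|%:E = `|\int[mu]_(y in U) ((psi y)%:E - (psi x)%:E)|)%E.
  rewrite (@integralB _ _ _ _ _ mb (fun y => (psi y)%:E) (fun=> (psi x)%:E)) // ige0 sub0e.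
  have -> : (\int[mu]_(y in U) (psi x)%:E = (psi x)%:E * (r *+ 2)%:E)%E.
    by rewrite integral_cst //; congr (_ * _)%E; exact: mub.
  by rewrite -EFinM -EFinN abse_EFin normrN normrM (gtr0_norm r2) mulrC.
apply: le_trans (le_abse_integral _ mb _) _ => //.
  by apply: emeasurable_funB; [case/integrableP: ib|case/integrableP: icst].
Unshelve. all: by end_near.
Qed.

End fourier_uniqueness.

(** * Wiener integrals and the covariance of OFBM *)

Section complex_integral.
Context {d : measure_display} {T : measurableType d} {R : realType}.
Variable mu : {measure set T -> \bar R}.
Local Notation C := R[i].
Implicit Types f g : T -> C.

Definition cintg f := intg mu (fun x => complex.Re (f x)) /\
  intg mu (fun x => complex.Im (f x)).
Definition cint f : C := (\int[mu]_x complex.Re (f x)) +i* (\int[mu]_x complex.Im (f x)).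

Lemma ReD (a b : C) : complex.Re (a + b) = complex.Re a + complex.Re b.
Proof. by case: a => ? ?; case: b. Qed.
Lemma ImD (a b : C) : complex.Im (a + b) = complex.Im a + complex.Im b.
Proof. by case: a => ? ?; case: b. Qed.
Lemma ReM (a b : C) :
  complex.Re (a * b) = complex.Re a * complex.Re b - complex.Im a * complex.Im b.
Proof. by case: a => ? ?; case: b. Qed.
Lemma ImM (a b : C) :
  complex.Im (a * b) = complex.Re a * complex.Im b + complex.Im a * complex.Re b.
Proof. by case: a => ? ?; case: b => ? ?. Qed.

Lemma cintgD f g : cintg f -> cintg g -> cintg (fun x => f x + g x).
Proof.
move=> [f1 f2] [g1 g2]; split.
  by under [X in intg mu X]eq_fun do rewrite ReD; exact: intgD.
by under [X in intg mu X]eq_fun do rewrite ImD; exact: intgD.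
Qed.

Lemma cintD f g : cintg f -> cintg g -> cint (fun x => f x + g x) = cint f + cint g.
Proof.
move=> [f1 f2] [g1 g2]; rewrite /cint.
have -> : \int[mu]_x complex.Re (f x + g x) = \int[mu]_x (complex.Re (f x) + complex.Re (g x)).
  by apply: eq_Rintegral => x _; exact: ReD.
have -> : \int[mu]_x complex.Im (f x + g x) = \int[mu]_x (complex.Im (f x) + complex.Im (g x)).
  by apply: eq_Rintegral => x _; exact: ImD.
by rewrite !RintegralD.
Qed.

Lemma cintgZ (c : C) f : cintg f -> cintg (fun x => c * f x).
Proof.
move=> [f1 f2]; split.
  by under [X in intg mu X]eq_fun do rewrite ReM; apply: intgB; exact: intgZ.
by under [X in intg mu X]eq_fun do rewrite ImM; apply: intgD; exact: intgZ.
Qed.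

Lemma cintZ (c : C) f : cintg f -> cint (fun x => c * f x) = c * cint f.
Proof.
move=> [f1 f2]; rewrite /cint.
have -> : \int[mu]_x complex.Re (c * f x) = \int[mu]_x (complex.Re c * complex.Re (f x) - complex.Im c * complex.Im (f x)).
  by apply: eq_Rintegral => x _; exact: ReM.
have -> : \int[mu]_x complex.Im (c * f x) = \int[mu]_x (complex.Re c * complex.Im (f x) + complex.Im c * complex.Re (f x)).
  by apply: eq_Rintegral => x _; exact: ImM.
rewrite RintegralB ?RintegralD; try exact: intgZ; try by [].
by rewrite !RintegralZl //; case: c.
Qed.

Lemma cintg0 : cintg (fun=> 0).
Proof. by split; apply: integrable0. Qed.

Lemma cint0 : cint (fun=> 0) = 0.
Proof. by rewrite /cint /= /Rintegral integral0. Qed.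

Lemma cintg_sum (I : Type) (s : seq I) (f : I -> T -> C) :
  (forall i, cintg (f i)) -> cintg (fun x => \sum_(i <- s) f i x).
Proof.
move=> h; elim: s => [|i s IHs].
  by under [X in cintg X]eq_fun do rewrite big_nil; exact: cintg0.
by under [X in cintg X]eq_fun do rewrite big_cons; exact: cintgD.
Qed.

Lemma cint_sum (I : Type) (s : seq I) (f : I -> T -> C) :
  (forall i, cintg (f i)) -> cint (fun x => \sum_(i <- s) f i x) = \sum_(i <- s) cint (f i).
Proof.
move=> h; elim: s => [|i s IHs].
  by under [X in cint X]eq_fun do rewrite big_nil; rewrite big_nil cint0.
rewrite big_cons -IHs -cintD //; last exact: cintg_sum.
by congr cint; apply/funext => x; rewrite big_cons.
Qed.

Lemma cintg_real (f : T -> R) : intg mu f -> cintg (fun x => (f x)%:C).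
Proof. by move=> fi; split => //; exact: integrable0. Qed.

Lemma cint_real (f : T -> R) : cint (fun x => (f x)%:C) = (\int[mu]_x f x)%:C.
Proof. by rewrite /cint /= [X in _ +i* X]/Rintegral integral0. Qed.

(** Used both for the random measure and for indicators: the isometry on simple functions then
    amounts to the equality of two Gram matrices. *)
Lemma gram_sqn (K : Type) (s : seq K) (c : K -> C) (xi : K -> T -> C) :
  (forall a b, cintg (fun w => xi a w * (xi b w)^*)) ->
  intg mu (fun w => sqn (\sum_(a <- s) c a * xi a w)) /\
  (\int[mu]_w sqn (\sum_(a <- s) c a * xi a w))%:C =
    \sum_(a <- s) \sum_(b <- s) c a * (c b)^* * cint (fun w => xi a w * (xi b w)^*).
Proof.
move=> h.
have e w : (sqn (\sum_(a <- s) c a * xi a w))%:C =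
    \sum_(a <- s) \sum_(b <- s) (c a * (c b)^*) * (xi a w * (xi b w)^*).
  rewrite -sqn_mulC rmorph_sum /= mulr_suml; apply: eq_bigr => a _.
  rewrite mulr_sumr; apply: eq_bigr => b _.
  by rewrite rmorphM /= mulrACA.
have ia a b : cintg (fun w => (c a * (c b)^*) * (xi a w * (xi b w)^*)) by exact: cintgZ.
have [i1 _] : cintg (fun w => (sqn (\sum_(a <- s) c a * xi a w))%:C).
  under [X in cintg X]eq_fun do rewrite e.
  by apply: cintg_sum => a; exact: cintg_sum.
split=> //; rewrite -cint_real.
under [X in cint X]eq_fun do rewrite e.
rewrite cint_sum; last by move=> a; exact: cintg_sum.
by apply: eq_bigr => a _; rewrite cint_sum //; apply: eq_bigr => b _; rewrite cintZ.
Qed.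
End complex_integral.

(** * Convergence of squared norms along mean-square approximations *)

Section L2_limit.
Context {d : measure_display} {T : measurableType d} {R : realType}.
Variable mu : {measure set T -> \bar R}.
Variables (N : T -> R) (Nk Dk : nat -> T -> R).
Hypothesis mN : measurable_fun setT N.
Hypothesis N0 : forall w, 0 <= N w.
Hypothesis iNk : forall k, intg mu (Nk k).
Hypothesis mDk : forall k, measurable_fun setT (Dk k).
Hypothesis D0 : forall k w, 0 <= Dk k w.
(* The two comparisons hold with N = |f|^2, Nk = |f_k|^2 and Dk = |f - f_k|^2. *)
Hypothesis NNk : forall eta, 0 < eta -> forall k w,
  N w <= (1 + eta) * Nk k w + (1 + eta^-1) * Dk k w.
Hypothesis NkN : forall eta, 0 < eta -> forall k w,
  Nk k w <= (1 + eta) * N w + (1 + eta^-1) * Dk k w.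
Hypothesis Dk0 : (fun k => \int[mu]_w (Dk k w)%:E)%E @ \oo --> 0%E.

(** Stated for nonnegative functions rather than for a norm, so that it serves both on the line and
    on the probability space. The two weighted comparisons play the role of the triangle inequality
    in L^2; integrability of [N] is the case eta = 1. *)
Lemma L2_limit : intg mu N /\ (fun k => \int[mu]_w Nk k w) @ \oo --> \int[mu]_w N w.
Proof.
have /fine_cvgP[fD' e0'] := Dk0.
have fD : \forall k \near \oo, (\int[mu]_w (Dk k w)%:E < +oo)%E.
  by apply: filterS fD' => k; rewrite ge0_fin_numE // integral_ge0 // => w _; rewrite lee_fin.
have iD : \forall k \near \oo, intg mu (Dk k).
  by apply: filterS fD => k; exact: intg_lty.
have iN : intg mu N.
  have [k /= iDk] := filter_ex iD.
  have ib : intg mu (fun w => (1 + 1) * Nk k w + (1 + 1^-1) * Dk k w).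
    by apply: intgD; apply: intgZ.
  by apply: (intg_le mN ib) => w; rewrite ger0_norm // NNk.
split=> //.
set x := \int[mu]_w N w.
pose e k := \int[mu]_w Dk k w.
have e0 : e @ \oo --> 0 by exact: e0'.
have x0 : 0 <= x by apply: Rintegral_ge0.
have b1 eta : 0 < eta -> \forall k \near \oo, x <= (1 + eta) * (\int[mu]_w Nk k w) + (1 + eta^-1) * e k.
  move=> eta0; apply: filterS iD => k iDk.
  apply: (@le_trans _ _ (\int[mu]_w ((1 + eta) * Nk k w + (1 + eta^-1) * Dk k w))).
    apply: ge0_Rintegral_le => //; last exact: NNk.
    by apply: intgD; exact: intgZ.
  rewrite RintegralD //; [by rewrite !RintegralZl //; exact: iNk|by apply: intgZ; try exact: iNk|exact: intgZ].
have b2 eta : 0 < eta -> \forall k \near \oo, \int[mu]_w Nk k w <= (1 + eta) * x + (1 + eta^-1) * e k.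
  move=> eta0; apply: filterS iD => k iDk.
  apply: (@le_trans _ _ (\int[mu]_w ((1 + eta) * N w + (1 + eta^-1) * Dk k w))).
    apply: ge0_Rintegral_le => //; last exact: NkN.
    by apply: intgD; exact: intgZ.
  rewrite RintegralD //; [by rewrite !RintegralZl //; exact: iNk|by apply: intgZ; try exact: iNk|exact: intgZ].
apply/cvgrPdist_le => /= eps eps0.
(* eta is small relative to [eps / (x + 1)], then [e k] relative to eta *)
pose eta := Num.min 1 (eps / (4 * (x + 1))).
have x1 : 0 < x + 1 by rewrite ltr_wpDl.
have eta0 : 0 < eta by rewrite lt_min ltr01 divr_gt0 ?mulr_gt0.
have eta1 : eta <= 1 by rewrite ge_min lexx.
have etax : eta * (x + 1) <= eps / 4.
  rewrite -ler_pdivlMr // ge_min; apply/orP; right.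
  by rewrite -mulrA -invfM.
have i0 : 0 < 1 + eta^-1 by rewrite addr_gt0 ?invr_gt0.
pose ee := eps / 8 / (1 + eta^-1).
have ee0 : 0 < ee by rewrite !divr_gt0.
have eN : \forall k \near \oo, (1 + eta^-1) * e k <= eps / 8.
  have /cvgr_le := e0; move=> /(_ ee ee0); apply: filterS => k.
  by rewrite /ee ler_pdivlMr // mulrC.
near=> k.
have h1 : x <= (1 + eta) * (\int[mu]_w Nk k w) + (1 + eta^-1) * e k by near: k; exact: b1.
have h2 : \int[mu]_w Nk k w <= (1 + eta) * x + (1 + eta^-1) * e k by near: k; exact: b2.
have h3 : (1 + eta^-1) * e k <= eps / 8 by near: k; exact: eN.
move: h1 h2 h3; set p := \int[mu]_w Nk k w; set t := (1 + eta^-1) * e k => h1 h2 h3.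
rewrite ler_norml; apply/andP; split; first nra.
have : eta * p <= eta * ((1 + eta) * x + t) by rewrite ler_wpM2l // ltW.
nra.
Unshelve. all: by end_near.
Qed.
End L2_limit.

(** * The Wiener integral and its isometry *)

Section wiener.
Variable R : realType.
Local Notation C := R[i].
Local Notation mu := (@lebesgue_measure R).
Context {d : measure_display} {T : measurableType d}.
Variables (Pr : probability T R) (n : nat) (B : set R -> T -> 'cV[C]_n).
Hypothesis hB : gaussian_random_measure Pr B.

(** A simple function is kept as a list of coefficients and sets. Its integral is then a function of
    the list, with nothing to check about different representations, and addition is
    concatenation. *)
Definition elem := ('rV[C]_n * {E : set R | finite_borel E})%type.
Implicit Types s : seq elem.

Definition simf s (x : R) : 'rV[C]_n := \sum_(p <- s) (\1_(sval p.2) x)%:C *: p.1.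
Definition simB s (w : T) : C := (\sum_(p <- s) p.1 *m B (sval p.2) w) 0 0.

Lemma L4_B (E : set R) i : finite_borel E ->
  L4 Pr (fun w => complex.Re (B E w i 0)) /\ L4 Pr (fun w => complex.Im (B E w i 0)).
Proof.
move=> bE.
have lin (c : C) : L4 Pr (fun w => complex.Re (c * B E w i 0)).
  have := @grm_gaussian _ _ _ _ _ _ hB 1%N (fun=> c *: delta_mx 0 i) (fun=> E) (fun=> bE).
  under [X in centered_normal _ X]eq_fun do
    rewrite big_ord_recl big_ord0 addr0 -scalemxAl mxE -rowE mxE.
  move=> h; split; first by case: h.
  by have [v _ [_ ->]] := centered_normal_moments h; rewrite ltry.
split.
  by have := lin 1; under eq_fun do rewrite mul1r.
(* Re(-i z) = Im z, so the imaginary part is covered by the Gaussian hypothesis on real parts. *)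
have := lin (- 'i%C); congr L4; apply/funext => w.
by case: (B E w i 0) => x y /=; ring.
Qed.

Lemma B_cov (E F : set R) i k : finite_borel E -> finite_borel F ->
  cintg Pr (fun w => B E w i 0 * (B F w k 0)^*) /\
  cint Pr (fun w => B E w i 0 * (B F w k 0)^*) = ((i == k)%:R * fine (mu (E `&` F)))%:C.
Proof.
move=> bE bF; have [e1 e2] := L4_B i bE; have [f1 f2] := L4_B k bF; split.
  split.
    have -> : (fun w => complex.Re (B E w i 0 * (B F w k 0)^*)) = (fun w =>
        complex.Re (B E w i 0) * complex.Re (B F w k 0) + complex.Im (B E w i 0) * complex.Im (B F w k 0)).
      by apply/funext => w; rewrite ReM /=; case: (B F w k 0) => a b /=; rewrite mulrN opprK.
    by apply: intgD; exact: L4_prod2.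
  have -> : (fun w => complex.Im (B E w i 0 * (B F w k 0)^*)) = (fun w =>
      complex.Im (B E w i 0) * complex.Re (B F w k 0) - complex.Re (B E w i 0) * complex.Im (B F w k 0)).
    by apply/funext => w; rewrite ImM /=; case: (B F w k 0) => a b /=; rewrite mulrN addrC.
  by apply: intgB; exact: L4_prod2.
by rewrite -(grm_cov hB bE bF) /cplx_expectation /cint unlock.
Qed.

Lemma indic_cov (E F : set R) : finite_borel E -> finite_borel F ->
  cintg mu (fun x => (\1_E x)%:C * ((\1_F x)%:C)^*) /\
  cint mu (fun x => (\1_E x)%:C * ((\1_F x)%:C)^*) = (fine (mu (E `&` F)))%:C.
Proof.
move=> [mE fE] [mF fF].
have mEF : measurable (E `&` F : set (measurableTypeR R)) by exact: measurableI.
have e : (fun x => (\1_E x)%:C * ((\1_F x)%:C)^*) = (fun x => (\1_(E `&` F) x : R)%:C :> C).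
  apply/funext => x; rewrite indicI /= rmorphM /=; congr (_ * _); exact: conjc_real.
have lt : (mu (E `&` F) < +oo)%E.
  by apply: le_lt_trans fE; apply: le_measure => //; rewrite inE.
rewrite e; split.
  by apply: cintg_real; apply: intg_lty => //; rewrite integral_indic // setIT.
by rewrite cint_real /Rintegral integral_indic // setIT.
Qed.

Lemma simBE s w : simB s w =
  \sum_(q <- [seq (p, i) | p <- s, i <- enum 'I_n]) q.1.1 0 q.2 * B (sval q.1.2) w q.2 0.
Proof.
rewrite /simB summxE big_allpairs /=; apply: eq_bigr => p _.
by rewrite mxE big_enum.
Qed.

Lemma simple_isometry s : [/\ intg Pr (fun w => sqn (simB s w)),
  intg mu (fun x => mxnorm2 (simf s x)) &
  \int[Pr]_w sqn (simB s w) = \int[mu]_x mxnorm2 (simf s x)].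
Proof.
have fb (p : elem) : finite_borel (sval p.2) by exact: svalP.
have [i1 e1] := @gram_sqn _ _ _ Pr _ [seq (p, i) | p <- s, i <- enum 'I_n]
  (fun q : elem * 'I_n => q.1.1 0 q.2) (fun q w => B (sval q.1.2) w q.2 0)
  (fun a b => (B_cov a.2 b.2 (fb a.1) (fb b.1)).1).
have h2 i := @gram_sqn _ _ _ mu _ s (fun p : elem => p.1 0 i) (fun p x => (\1_(sval p.2) x)%:C)
  (fun a b => (indic_cov (fb a) (fb b)).1).
have nE x : mxnorm2 (simf s x) = \sum_i sqn (\sum_(p <- s) p.1 0 i * (\1_(sval p.2) x)%:C).
  rewrite mxnorm2_row; apply: eq_bigr => i _; congr sqn.
  by rewrite /simf summxE; apply: eq_bigr => p _; rewrite mxE mulrC.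
split.
- by under [X in intg _ X]eq_fun do rewrite simBE.
- under [X in intg _ X]eq_fun do rewrite nE.
  by apply: intg_bigsum => i; exact: (h2 i).1.
apply: (@complexI R).
have -> : \int[Pr]_w sqn (simB s w) = \int[Pr]_w sqn (\sum_(a <- [seq (p, i) | p <- s, i <- enum 'I_n])
    a.1.1 0 a.2 * B (sval a.1.2) w a.2 0).
  by apply: eq_Rintegral => w _; rewrite simBE.
have -> : \int[mu]_x mxnorm2 (simf s x) = \int[mu]_x \sum_i sqn (\sum_(p <- s) p.1 0 i * (\1_(sval p.2) x)%:C).
  by apply: eq_Rintegral => x _; exact: nE.
rewrite e1 Rintegral_bigsum; last by move=> i; exact: (h2 i).1.
rewrite rmorph_sum /= big_allpairs /=.
under [RHS]eq_bigr do rewrite (h2 _).2.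
rewrite [RHS]exchange_big /=; apply: eq_bigr => p _.
rewrite big_enum /=; apply: eq_bigr => i _.
rewrite big_allpairs /=; apply: eq_bigr => p' _.
rewrite big_enum /= (bigD1 i) //= big1 ?addr0; last first.
  by move=> k ki; rewrite (B_cov _ _ (fb p) (fb p')).2 eq_sym (negbTE ki) mul0r mulr0.
by rewrite (B_cov _ _ (fb p) (fb p')).2 (indic_cov (fb p) (fb p')).2 eqxx mul1r.
Qed.

Definition measurable_row (g : R -> 'rV[C]_n) := forall i,
  measurable_fun setT (fun x => complex.Re (g x 0 i)) /\
  measurable_fun setT (fun x => complex.Im (g x 0 i)).

(** The scalar form of [is_wiener_integral], for a single row. It is closed under addition, so that
    covariances follow from norms by polarization. *)
Definition wiener_row (g : R -> 'rV[C]_n) (Z : T -> C) :=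
  [/\ measurable_row g,
      measurable_fun setT (fun w => complex.Re (Z w)) /\
      measurable_fun setT (fun w => complex.Im (Z w)) &
  exists s : nat -> seq elem,
   (fun k => \int[mu]_x (mxnorm2 (g x - simf (s k) x))%:E)%E @ \oo --> 0%E /\
   (fun k => \int[Pr]_w (sqn (Z w - simB (s k) w))%:E)%E @ \oo --> 0%E].

Lemma sqn_peter_paul (eta : R) (a b : C) : 0 < eta ->
  sqn a <= (1 + eta) * sqn b + (1 + eta^-1) * sqn (a - b).
Proof.
move=> e0; case: a b => [a1 a2] [b1 b2]; rewrite /sqn /=.
have key (x y : R) : x ^+ 2 <= (1 + eta) * y ^+ 2 + (1 + eta^-1) * (x - y) ^+ 2.
  rewrite -subr_ge0.
  have -> : (1 + eta) * y ^+ 2 + (1 + eta^-1) * (x - y) ^+ 2 - x ^+ 2 =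
    eta^-1 * ((x - y) - eta * y) ^+ 2 by field; exact: lt0r_neq0.
  by rewrite mulr_ge0 ?sqr_ge0 // invr_ge0 ltW.
have := key a1 b1; have := key a2 b2; lra.
Qed.

Lemma sqnB (a b : C) : sqn (a - b) = sqn (b - a).
Proof. by case: a b => [a1 a2] [b1 b2]; rewrite /sqn /=; ring. Qed.

Lemma mxnorm2_peter_paul (eta : R) (a b : 'rV[C]_n) : 0 < eta ->
  mxnorm2 a <= (1 + eta) * mxnorm2 b + (1 + eta^-1) * mxnorm2 (a - b).
Proof.
move=> e0; rewrite !mxnorm2_row !mulr_sumr -big_split /=.
by apply: ler_sum => i _; rewrite !mxE; exact: sqn_peter_paul.
Qed.

Lemma mxnorm2B (a b : 'rV[C]_n) : mxnorm2 (a - b) = mxnorm2 (b - a).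
Proof. by rewrite !mxnorm2_row; apply: eq_bigr => i _; rewrite !mxE sqnB. Qed.

Lemma measurable_sqn d' (T' : measurableType d') (Z : T' -> C) :
  measurable_fun setT (fun w => complex.Re (Z w)) ->
  measurable_fun setT (fun w => complex.Im (Z w)) -> measurable_fun setT (fun w => sqn (Z w)).
Proof. by move=> h1 h2; apply: measurable_funD; exact: measurable_funX. Qed.

Lemma measurable_row_norm g : measurable_row g -> measurable_fun setT (fun x => mxnorm2 (g x)).
Proof.
move=> mg; under eq_fun do rewrite mxnorm2_row.
by apply: measurable_sum => i; apply: measurable_sqn; case: (mg i).
Qed.

Lemma measurable_rowD g h : measurable_row g -> measurable_row h ->
  measurable_row (fun x => g x + h x).
Proof.
move=> mg mh i; have [g1 g2] := mg i; have [h1 h2] := mh i; split.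
  by under eq_fun do rewrite mxE ReD; exact: measurable_funD.
by under eq_fun do rewrite mxE ImD; exact: measurable_funD.
Qed.

Lemma ReN (a : C) : complex.Re (- a) = - complex.Re a. Proof. by case: a. Qed.
Lemma ImN (a : C) : complex.Im (- a) = - complex.Im a. Proof. by case: a. Qed.

Lemma measurable_rowB g h : measurable_row g -> measurable_row h ->
  measurable_row (fun x => g x - h x).
Proof.
move=> mg mh; apply: measurable_rowD => // i; have [h1 h2] := mh i; split.
  by under eq_fun do rewrite mxE ReN; exact: measurableT_comp.
by under eq_fun do rewrite mxE ImN; exact: measurableT_comp.
Qed.

Lemma Re_bigsum (I : Type) (r : seq I) (F : I -> C) :
  complex.Re (\sum_(i <- r) F i) = \sum_(i <- r) complex.Re (F i).
Proof. by elim: r => [|i r IHr]; rewrite ?big_nil // !big_cons ReD IHr. Qed.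
Lemma Im_bigsum (I : Type) (r : seq I) (F : I -> C) :
  complex.Im (\sum_(i <- r) F i) = \sum_(i <- r) complex.Im (F i).
Proof. by elim: r => [|i r IHr]; rewrite ?big_nil // !big_cons ImD IHr. Qed.

Lemma measurable_simf s : measurable_row (simf s).
Proof.
move=> i; rewrite /simf; split.
  under eq_fun do rewrite summxE Re_bigsum.
  apply: measurable_sum => p; under eq_fun do rewrite mxE ReM /= mul0r subr0.
  by apply: measurable_funM => //; apply: measurable_indic; case: (svalP p.2).
under eq_fun do rewrite summxE Im_bigsum.
apply: measurable_sum => p; under eq_fun do rewrite mxE ImM /= mul0r addr0.
by apply: measurable_funM => //; apply: measurable_indic; case: (svalP p.2).
Qed.

Lemma measurable_simB s : measurable_fun setT (fun w => complex.Re (simB s w)) /\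
  measurable_fun setT (fun w => complex.Im (simB s w)).
Proof.
have L (p : elem) i := L4_B i (svalP p.2).
split.
  under eq_fun do rewrite simBE Re_bigsum.
  apply: measurable_sum => q; under eq_fun do rewrite ReM.
  by have [[? _] [? _]] := L q.1 q.2; apply: measurable_funB; apply: measurable_funM.
under eq_fun do rewrite simBE Im_bigsum.
apply: measurable_sum => q; under eq_fun do rewrite ImM.
by have [[? _] [? _]] := L q.1 q.2; apply: measurable_funD; apply: measurable_funM.
Qed.

Lemma wiener_row_isometry g Z : wiener_row g Z ->
  [/\ intg Pr (fun w => sqn (Z w)), intg mu (fun x => mxnorm2 (g x)) &
  \int[Pr]_w sqn (Z w) = \int[mu]_x mxnorm2 (g x)].
Proof.
move=> [mg [mZ1 mZ2] [s [cg cZ]]].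
have [ig lg] := @L2_limit _ _ _ mu (fun x => mxnorm2 (g x)) (fun k x => mxnorm2 (simf (s k) x))
  (fun k x => mxnorm2 (g x - simf (s k) x))
  (measurable_row_norm mg) (fun=> mxnorm2_ge0 _) (fun k => let: And3 _ h _ := simple_isometry (s k) in h)
  (fun k => measurable_row_norm (measurable_rowB mg (measurable_simf (s k)))) (fun _ _ => mxnorm2_ge0 _)
  (fun eta e0 k x => mxnorm2_peter_paul _ _ e0)
  (fun eta e0 k x => eq_ind_r (fun z => _ <= _ + _ * z) (mxnorm2_peter_paul _ _ e0) (mxnorm2B _ _)) cg.
have mD k : measurable_fun setT (fun w => sqn (Z w - simB (s k) w)).
  have [b1 b2] := measurable_simB (s k).
  apply: measurable_sqn.
    by under eq_fun do rewrite ReD ReN; exact: measurable_funB.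
  by under eq_fun do rewrite ImD ImN; exact: measurable_funB.
have [iZ lZ] := @L2_limit _ _ _ Pr (fun w => sqn (Z w)) (fun k w => sqn (simB (s k) w))
  (fun k w => sqn (Z w - simB (s k) w))
  (measurable_sqn mZ1 mZ2) (fun=> sqn_ge0 _) (fun k => let: And3 h _ _ := simple_isometry (s k) in h)
  mD (fun _ _ => sqn_ge0 _)
  (fun eta e0 k x => sqn_peter_paul _ _ e0)
  (fun eta e0 k x => eq_ind_r (fun z => _ <= _ + _ * z) (sqn_peter_paul _ _ e0) (sqnB _ _)) cZ.
split=> //.
have e : (fun k => \int[Pr]_w sqn (simB (s k) w)) = (fun k => \int[mu]_x mxnorm2 (simf (s k) x)).
  by apply/funext => k; have [_ _ ->] := simple_isometry (s k).
by move: lZ; rewrite e => lZ; apply: (cvg_unique _ lZ lg).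
Qed.

Lemma simf_cat s1 s2 x : simf (s1 ++ s2) x = simf s1 x + simf s2 x.
Proof. by rewrite /simf big_cat. Qed.

Lemma simB_cat s1 s2 w : simB (s1 ++ s2) w = simB s1 w + simB s2 w.
Proof. by rewrite /simB big_cat /= mxE. Qed.

Lemma cvg_ge0_dominated (d' : measure_display) (T' : measurableType d') (m : {measure set T' -> \bar R})
    (F G D : nat -> T' -> R) (c1 c2 : R) : 0 <= c1 -> 0 <= c2 ->
  (forall k, measurable_fun setT (F k)) -> (forall k, measurable_fun setT (G k)) ->
  (forall k, measurable_fun setT (D k)) ->
  (forall k x, 0 <= F k x) -> (forall k x, 0 <= G k x) -> (forall k x, 0 <= D k x) ->
  (forall k x, D k x <= c1 * F k x + c2 * G k x) ->
  (fun k => \int[m]_x (F k x)%:E)%E @ \oo --> 0%E ->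
  (fun k => \int[m]_x (G k x)%:E)%E @ \oo --> 0%E ->
  (fun k => \int[m]_x (D k x)%:E)%E @ \oo --> 0%E.
Proof.
move=> c10 c20 mF mG mD F0 G0 D0 DFG cF cG.
apply: (@squeeze_cvge _ _ _ _ (cst 0%E) _ (fun k => c1%:E * \int[m]_x (F k x)%:E + c2%:E * \int[m]_x (G k x)%:E)%E).
- apply: nearW => k.
  have mEF : measurable_fun setT (fun x => (F k x)%:E) by apply/measurable_EFinP.
  have mEG : measurable_fun setT (fun x => (G k x)%:E) by apply/measurable_EFinP.
  have F0E x : setT x -> (0 <= (F k x)%:E)%E by rewrite lee_fin.
  have G0E x : setT x -> (0 <= (G k x)%:E)%E by rewrite lee_fin.
  have mcF : measurable_fun setT (fun x => c1%:E * (F k x)%:E)%E by exact: measurable_funeM.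
  have mcG : measurable_fun setT (fun x => c2%:E * (G k x)%:E)%E by exact: measurable_funeM.
  have cF0 x : setT x -> (0 <= c1%:E * (F k x)%:E)%E by move=> _; rewrite -EFinM lee_fin mulr_ge0.
  have cG0 x : setT x -> (0 <= c2%:E * (G k x)%:E)%E by move=> _; rewrite -EFinM lee_fin mulr_ge0.
  apply/andP; split; first by apply: integral_ge0 => x _; rewrite lee_fin.
  rewrite -!ge0_integralZl // -ge0_integralD //.
  apply: ge0_le_integral => //.
  + by move=> x _; rewrite lee_fin.
  + by apply/measurable_EFinP.
  + exact: emeasurable_funD.
  + by move=> x _; rewrite -!EFinM -EFinD lee_fin.
- exact: cvg_cst.
- rewrite -[X in _ --> X](_ : c1%:E * 0 + c2%:E * 0 = 0)%E; last by rewrite !mule0 adde0.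
  apply: cvgeD; [by rewrite !mule0|exact: cvgeZl|exact: cvgeZl].
Qed.

Lemma sqnD_le (a b : C) : sqn (a + b) <= 2 * sqn a + 2 * sqn b.
Proof.
case: a b => [a1 a2] [b1 b2]; rewrite /sqn /= -subr_ge0.
rewrite [X in 0 <= X](_ : _ = (a1 - b1) ^+ 2 + (a2 - b2) ^+ 2); last by ring.
by rewrite addr_ge0 ?sqr_ge0.
Qed.

Lemma mxnorm2D_le (a b : 'rV[C]_n) : mxnorm2 (a + b) <= 2 * mxnorm2 a + 2 * mxnorm2 b.
Proof.
rewrite !mxnorm2_row !mulr_sumr -big_split /=.
by apply: ler_sum => i _; rewrite !mxE; exact: sqnD_le.
Qed.

Lemma wiener_rowD g Z g' Z' : wiener_row g Z -> wiener_row g' Z' ->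
  wiener_row (fun x => g x + g' x) (fun w => Z w + Z' w).
Proof.
move=> [mg [mZ1 mZ2] [s [cg cZ]]] [mg' [mZ1' mZ2'] [s' [cg' cZ']]].
split.
- exact: measurable_rowD.
- split; first by under eq_fun do rewrite ReD; exact: measurable_funD.
  by under eq_fun do rewrite ImD; exact: measurable_funD.
have mB (Y : T -> C) t : measurable_fun setT (fun w => complex.Re (Y w)) ->
    measurable_fun setT (fun w => complex.Im (Y w)) -> measurable_fun setT (fun w => sqn (Y w - simB t w)).
  move=> h1 h2; have [b1 b2] := measurable_simB t.
  apply: measurable_sqn.
    by under eq_fun do rewrite ReD ReN; exact: measurable_funB.
  by under eq_fun do rewrite ImD ImN; exact: measurable_funB.
exists (fun k => s k ++ s' k); split.
  apply: (cvg_ge0_dominated (c1 := 2) (c2 := 2) _ _ _ _ _ _ _ _ _ cg cg') => //;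
   try (by move=> *; exact: mxnorm2_ge0);
   try (by move=> k; apply: measurable_row_norm; apply: measurable_rowB => //; try exact: measurable_rowD; exact: measurable_simf).
  by move=> k x; rewrite simf_cat opprD addrACA; exact: mxnorm2D_le.
apply: (cvg_ge0_dominated (c1 := 2) (c2 := 2) _ _ _ _ _ _ _ _ _ cZ cZ') => //;
   try (by move=> *; exact: sqn_ge0);
   try (by move=> k; exact: mB).
- move=> k; apply: mB.
    by under eq_fun do rewrite ReD; exact: measurable_funD.
  by under eq_fun do rewrite ImD; exact: measurable_funD.
- by move=> k w; rewrite simB_cat opprD addrACA; exact: sqnD_le.
Qed.

Lemma measurable_mxnorm2 d' (T' : measurableType d') m p (M : T' -> 'M[C]_(m, p)) :
  (forall i j, measurable_fun setT (fun x => complex.Re (M x i j)) /\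
     measurable_fun setT (fun x => complex.Im (M x i j))) ->
  measurable_fun setT (fun x => mxnorm2 (M x)).
Proof.
move=> mM; apply: measurable_sum => i; apply: measurable_sum => j.
under eq_fun do rewrite normc_sqn.
by case: (mM i j); exact: measurable_sqn.
Qed.

Lemma measurable_mulmx_entry d' (T' : measurableType d') m p q (U : T' -> 'M[C]_(m, p))
    (V : T' -> 'M[C]_(p, q)) i j :
  (forall i j, measurable_fun setT (fun x => complex.Re (U x i j)) /\
     measurable_fun setT (fun x => complex.Im (U x i j))) ->
  (forall i j, measurable_fun setT (fun x => complex.Re (V x i j)) /\
     measurable_fun setT (fun x => complex.Im (V x i j))) ->
  measurable_fun setT (fun x => complex.Re ((U x *m V x) i j)) /\
  measurable_fun setT (fun x => complex.Im ((U x *m V x) i j)).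
Proof.
move=> mU mV; split.
  under eq_fun do rewrite mxE Re_bigsum.
  apply: measurable_sum => k; under eq_fun do rewrite ReM.
  have [? ?] := mU i k; have [? ?] := mV k j.
  by apply: measurable_funB; exact: measurable_funM.
under eq_fun do rewrite mxE Im_bigsum.
apply: measurable_sum => k; under eq_fun do rewrite ImM.
have [? ?] := mU i k; have [? ?] := mV k j.
by apply: measurable_funD; exact: measurable_funM.
Qed.

Lemma sqn_mul_le (u : 'rV[C]_n) (y : 'cV[C]_n) :
  sqn ((u *m y) 0 0) <= n%:R * mxnorm2 u * mxnorm2 y.
Proof.
rewrite mxE; apply: le_trans (sqn_sum_le _) _; rewrite card_ord -mulrA ler_wpM2l //.
have -> : mxnorm2 y = \sum_i sqn (y i 0).
  by apply: eq_bigr => i _; rewrite big_ord_recl big_ord0 addr0 normc_sqn.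
rewrite mxnorm2_row mulr_suml; apply: ler_sum => i _; rewrite sqnM.
rewrite ler_wpM2l ?sqn_ge0 // (bigD1 i) //= lerDl sumr_ge0 // => k _; exact: sqn_ge0.
Qed.

Lemma wiener_row_of (f : R -> 'M[C]_n) (Y : T -> 'cV[C]_n) (u : 'rV[C]_n) :
  (forall i j, measurable_fun setT (fun x => complex.Re (f x i j)) /\
     measurable_fun setT (fun x => complex.Im (f x i j))) ->
  is_wiener_integral Pr B f Y ->
  wiener_row (fun x => u *m f x) (fun w => (u *m Y w) 0 0).
Proof.
move=> mf [mY [m [c [E [bE cf cY]]]]].
have mY' (i : 'I_n) (j : 'I_1) : measurable_fun setT (fun x => complex.Re (Y x i j)) /\
    measurable_fun setT (fun x => complex.Im (Y x i j)) by rewrite (ord1 j); exact: mY.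
pose s k : seq elem := [seq (u *m c k l, exist _ (E k l) (bE k l)) | l : 'I_(m k)].
have sf k x : simf (s k) x = u *m \sum_(l < m k) (\1_(E k l) x)%:C *: c k l.
  rewrite /simf /s big_map big_enum /= mulmx_sumr; apply: eq_bigr => l _.
  by rewrite scalemxAr.
have sB k w : simB (s k) w = (u *m \sum_(l < m k) c k l *m B (E k l) w) 0 0.
  rewrite /simB /s big_map big_enum /= mulmx_sumr; congr (fun_of_matrix _ 0 0).
  by apply: eq_bigr => l _; rewrite mulmxA.
have mg : measurable_row (fun x => u *m f x).
  by move=> i; apply: measurable_mulmx_entry.
have mZ : measurable_fun setT (fun w => complex.Re ((u *m Y w) 0 0)) /\
     measurable_fun setT (fun w => complex.Im ((u *m Y w) 0 0)).
  by apply: measurable_mulmx_entry.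
split=> //; exists s; split.
  pose c0 := n%:R * mxnorm2 u.
  have c00 : 0 <= c0 by rewrite mulr_ge0 ?mxnorm2_ge0.
  have mF k : measurable_fun [set: R] (fun x => mxnorm2 (f x - \sum_(l < m k) (\1_(E k l) x)%:C *: c k l)).
    apply: measurable_mxnorm2 => i j; have [f1 f2] := mf i j; split.
      under eq_fun do rewrite mxE ReD mxE ReN summxE Re_bigsum.
      apply: measurable_funB => //; apply: measurable_sum => l.
      under eq_fun do rewrite mxE ReM /= mul0r subr0.
      by apply: measurable_funM => //; apply: measurable_indic; case: (bE k l).
    under eq_fun do rewrite mxE ImD mxE ImN summxE Im_bigsum.
    apply: measurable_funB => //; apply: measurable_sum => l.
    under eq_fun do rewrite mxE ImM /= mul0r addr0.
    by apply: measurable_funM => //; apply: measurable_indic; case: (bE k l).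
  apply: (cvg_ge0_dominated c00 (lexx 0) _ _ _ _ _ _ _ cf cf);
    try (by move=> *; exact: mxnorm2_ge0); try exact: mF.
    by move=> k; apply: measurable_row_norm; apply: measurable_rowB => //; exact: measurable_simf.
  move=> k x; rewrite mul0r addr0 sf -mulmxBr.
  by apply: le_trans (mxnorm2_mulmx _ _) _; rewrite /c0 mulrAC.
pose c0 := n%:R * mxnorm2 u.
have c00 : 0 <= c0 by rewrite mulr_ge0 ?mxnorm2_ge0.
have mF k : measurable_fun [set: T] (fun w => mxnorm2 (Y w - \sum_(l < m k) c k l *m B (E k l) w)).
  have mB l (i : 'I_n) (j : 'I_1) : measurable_fun setT (fun x => complex.Re ((c k l *m B (E k l) x) i j)) /\
    measurable_fun setT (fun x => complex.Im ((c k l *m B (E k l) x) i j)).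
    apply: measurable_mulmx_entry => // i' j'; rewrite (ord1 j').
    by have [[? _] [? _]] := L4_B i' (bE k l).
  apply: measurable_mxnorm2 => i j; have [f1 f2] := mY' i j; split.
    under eq_fun do rewrite mxE ReD mxE ReN summxE Re_bigsum.
    by apply: measurable_funB => //; apply: measurable_sum => l; case: (mB l i j).
  under eq_fun do rewrite mxE ImD mxE ImN summxE Im_bigsum.
  by apply: measurable_funB => //; apply: measurable_sum => l; case: (mB l i j).
apply: (cvg_ge0_dominated c00 (lexx 0) mF mF _ _ _ _ _ cY cY);
  try (by move=> *; exact: mxnorm2_ge0); try (by move=> *; exact: sqn_ge0).
  move=> k; have [z1 z2] := mZ; have [b1 b2] := measurable_simB (s k).
  apply: measurable_sqn.
    by under eq_fun do rewrite ReD ReN; exact: measurable_funB.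
  by under eq_fun do rewrite ImD ImN; exact: measurable_funB.
move=> k w; rewrite mul0r addr0 sB.
have -> : (u *m Y w) 0 0 - (u *m \sum_(l < m k) c k l *m B (E k l) w) 0 0 =
   (u *m (Y w - \sum_(l < m k) c k l *m B (E k l) w)) 0 0.
  by rewrite mulmxBr [in RHS]mxE; congr (_ + _); rewrite [in RHS]mxE.
exact: sqn_mul_le.
Qed.

Lemma sqnD (a b : C) : sqn (a + b) = sqn a + sqn b + 2 * rin a b.
Proof. by case: a b => [a1 a2] [b1 b2]; rewrite /sqn /rin /=; ring. Qed.

(** Polarization of the isometry. As the integrals are real, the square of a sum suffices, and its
    counterpart for the rows is the real inner product. *)
Lemma wiener_row_cov g g' (z z' : T -> R) :
  wiener_row g (fun w => (z w)%:C) -> wiener_row g' (fun w => (z' w)%:C) ->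
  intg mu (fun x => \sum_i rin (g x 0 i) (g' x 0 i)) /\
  \int[Pr]_w (z w * z' w) = \int[mu]_x \sum_i rin (g x 0 i) (g' x 0 i).
Proof.
move=> hg hg'.
have [a1 a2 a3] := wiener_row_isometry hg.
have [b1 b2 b3] := wiener_row_isometry hg'.
have [c1 c2 c3] := wiener_row_isometry (wiener_rowD hg hg').
have eg x : \sum_i rin (g x 0 i) (g' x 0 i) =
    2^-1 * (mxnorm2 (g x + g' x) - mxnorm2 (g x) - mxnorm2 (g' x)).
  rewrite !mxnorm2_row -!sumrB mulr_sumr; apply: eq_bigr => i _.
  by rewrite mxE sqnD; field.
have ez w : z w * z' w = 2^-1 * (sqn ((z w)%:C + (z' w)%:C) - sqn (z w)%:C - sqn (z' w)%:C).
  by rewrite /sqn /=; field.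
split.
  by under [X in intg _ X]eq_fun do rewrite eg; apply: intgZ; apply: intgB => //; exact: intgB.
have -> : \int[Pr]_w (z w * z' w) = \int[Pr]_w (2^-1 * (sqn ((z w)%:C + (z' w)%:C) - sqn (z w)%:C - sqn (z' w)%:C)).
  by apply: eq_Rintegral => w _; exact: ez.
have -> : \int[mu]_x \sum_i rin (g x 0 i) (g' x 0 i) =
    \int[mu]_x (2^-1 * (mxnorm2 (g x + g' x) - mxnorm2 (g x) - mxnorm2 (g' x))).
  by apply: eq_Rintegral => x _; exact: eg.
rewrite [LHS]RintegralZl //; last by apply: intgB => //; exact: intgB.
rewrite [RHS]RintegralZl //; last by apply: intgB => //; exact: intgB.
rewrite [in LHS]RintegralB //; last exact: intgB.
rewrite [in LHS]RintegralB //.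
rewrite [in RHS]RintegralB //; last exact: intgB.
rewrite [in RHS]RintegralB //.
by rewrite a3 b3 c3.
Qed.
End wiener.

(** Inversion is discontinuous at 0, so it is written through exp and ln on each half-line. *)
Lemma measurable_invr (R : realType) : measurable_fun [set: R] (fun x : R => x^-1).
Proof.
have -> : (fun x : R => x^-1) = (fun x => if 0 < x then expR (- ln x) else
    if x < 0 then - expR (- ln (- x)) else 0).
  apply/funext => x; have [x0|x0|<-] := ltgtP 0 x; last by rewrite invr0.
    by rewrite expRN lnK.
  by rewrite expRN lnK ?posrE ?oppr_gt0 // invrN opprK.
have ml : measurable_fun [set: R] (fun x : R => expR (- ln x)).
  by apply: measurableT_comp => //; apply: measurableT_comp.
apply: measurable_fun_if => //; first exact: measurable_fun_ltr.
  exact: measurable_funTS.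
apply: measurable_funTS; apply: measurable_fun_if => //; first exact: measurable_fun_ltr.
apply: measurable_funTS; apply: measurableT_comp => //.
by apply: (measurableT_comp ml); exact: oppr_measurable.
Qed.

(** * The kernel of the harmonizable representation *)

Section kernel.
Variable R : realType.
Local Notation C := R[i].
Local Notation mu := (@lebesgue_measure R).
Variables (n : nat) (H : 'M[R]_n) (A : 'M[C]_n).
Hypothesis hAim : map_mx (@complex.Im R) (A *m adjmx A) = 0.
Let G := map_mx (@complex.Re R) (A *m adjmx A).
Local Notation D := (H - (2^-1)%:M).

Lemma AadjA : A *m adjmx A = cplxmx G.
Proof.
apply/matrixP => i j; rewrite !mxE.
have := congr1 (fun M => fun_of_matrix M i j) hAim; rewrite !mxE.
by move: (\sum_(_ < _) _) => -[a b] /= ->.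
Qed.

Definition spec (x : R) : 'M[R]_n :=
  x ^- 2 *: (powmx0 `|x| (- D) *m G *m (powmx0 `|x| (- D))^T).

Let amp x : 'M[C]_n := cplxmx (powmx0 (Num.max x 0) (- D)) *m A +
     cplxmx (powmx0 (Num.max (- x) 0) (- D)) *m Defs.conjmx A.

Lemma powmx00 (M : 'M[R]_n) : powmx0 0 M = 0.
Proof. by rewrite /powmx0 ltxx. Qed.

Lemma cplxmx0 m p : cplxmx (0 : 'M[R]_(m, p)) = 0.
Proof. by apply/matrixP => i j; rewrite !mxE. Qed.

Lemma conj_cplxmx m p (M : 'M[R]_(m, p)) : Defs.conjmx (cplxmx M) = cplxmx M.
Proof. by apply/matrixP => i j; rewrite !mxE /= oppr0. Qed.

Lemma conjmxM m p q (M : 'M[C]_(m, p)) (N : 'M[C]_(p, q)) :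
  Defs.conjmx (M *m N) = Defs.conjmx M *m Defs.conjmx N.
Proof.
apply/matrixP => i j; rewrite !mxE rmorph_sum; apply: eq_bigr => k _.
by rewrite !mxE rmorphM.
Qed.

Lemma adjmx_conj m p (M : 'M[C]_(m, p)) : adjmx (Defs.conjmx M) = Defs.conjmx (adjmx M).
Proof. by apply/matrixP => i j; rewrite !mxE. Qed.

(** Here the vanishing of the imaginary part enters: on the negative half-line the conjugate of A
    has the conjugate Gram matrix, which is again G, so the density is even. *)
Lemma amp_adj x : amp x *m adjmx (amp x) =
  cplxmx (powmx0 `|x| (- D) *m G *m (powmx0 `|x| (- D))^T).
Proof.
rewrite /amp; have [x0|x0|->] := ltgtP x 0.
- rewrite (max_idPl _) ?oppr_ge0 ?(ltW x0) // powmx00 cplxmx0 mul0mx add0r.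
  rewrite ltr0_norm // adjmxM mulmxA -[_ *m Defs.conjmx A *m _]mulmxA adjmx_conj -conjmxM AadjA.
  by rewrite conj_cplxmx adjmx_cplxmx !cplxmxM.
- rewrite (max_idPr _) ?oppr_le0 ?(ltW x0) // powmx00 cplxmx0 mul0mx addr0.
  rewrite gtr0_norm // adjmxM mulmxA -[_ *m A *m _]mulmxA AadjA.
  by rewrite adjmx_cplxmx !cplxmxM.
- by rewrite oppr0 maxxx normr0 powmx00 cplxmx0 !mul0mx addr0 mul0mx cplxmx0.
Qed.

Lemma kernel_scalarE t x : (expi (t * x) - 1) / ('i%C * x%:C) =
  (sin (t * x) / x) +i* ((1 - cos (t * x)) / x) :> C.
Proof.
have [->|x0] := eqVneq x 0; first by rewrite [X in _ / X](_ : _ = 0) ?mulr0 // !invr0 !mulr0.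
have x0' : 'i%C * x%:C != 0 :> C.
  by apply/eqP => /(congr1 (@complex.Im R)) /= /eqP; rewrite mul0r mul1r add0r (negbTE x0).
apply: (mulIf x0'); rewrite divfK // /expi.
by apply/eqP; rewrite eq_complex /=; apply/andP; split; apply/eqP; field.
Qed.

(** The scalar factor is the real part of (e^(isx) - 1) times the conjugate of (e^(itx) - 1); the
    matrix factor is real. At x = 0 both sides are 0 by the convention on inverses. *)
Lemma kernel_cov s t i l x :
  \sum_j rin (((delta_mx 0 i : 'rV[C]_n) *m ofbm_kernel H A s x) 0 j) (((delta_mx 0 l : 'rV[C]_n) *m ofbm_kernel H A t x) 0 j)
  = (1 - cos (s * x) - cos (t * x) + cos ((s - t) * x)) * spec x i l.
Proof.
have rinE (a b : C) : rin a b = complex.Re (a * conjc b).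
  by case: a b => [a1 a2] [b1 b2]; rewrite /rin /= mulrN opprK.
pose k t : C := (sin (t * x) / x) +i* ((1 - cos (t * x)) / x).
have kE t' i' j : ((delta_mx 0 i' : 'rV[C]_n) *m ofbm_kernel H A t' x) 0 j = k t' * amp x i' j.
  by rewrite -rowE mxE /ofbm_kernel kernel_scalarE mxE.
under eq_bigr do rewrite !kE rinE.
set k1 := k s; set k2 := k t.
have -> : \sum_j complex.Re (k1 * amp x i j * conjc (k2 * amp x l j)) =
   complex.Re (k1 * conjc k2 * (amp x *m adjmx (amp x)) i l).
  rewrite mxE mulr_sumr Re_bigsum; apply: eq_bigr => j _; congr complex.Re.
  by rewrite rmorphM /= mulrACA !mxE.
rewrite amp_adj /spec; move: (_ *m G *m _) => N; rewrite !mxE ReM /= mulr0 subr0.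
have -> : (s - t) * x = s * x - t * x by ring.
rewrite cosB [RHS]mulrA; congr (_ * N i l).
have [->|x0] := eqVneq x 0; last by field.
by rewrite expr0n /= invr0 !mulr0 mul0r subrr.
Qed.

Lemma measurable_expmx (M : 'M[R]_n) i j : measurable_fun setT (fun t : R => expmx (t *: M) i j).
Proof.
apply: continuous_measurable_fun => t; apply: differentiable_continuous.
by apply/derivable1_diffP; have /(_ t i j) := expmx_derivr M; case.
Qed.

Lemma measurable_powmx0 (M : 'M[R]_n) (g : R -> R) i j : measurable_fun setT g ->
  measurable_fun setT (fun x : R => powmx0 (g x) M i j).
Proof.
move=> mg.
have -> : (fun x => powmx0 (g x) M i j) = (fun x => if 0 < g x then expmx (ln (g x) *: M) i j else 0).
  by apply/funext => x; rewrite /powmx0; case: ifP => // _; rewrite mxE.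
apply: measurable_fun_if => //.
- exact: measurable_fun_ltr.
- apply: measurable_funTS; apply: (measurableT_comp (measurable_expmx M i j)).
  exact: measurableT_comp.
Qed.

Lemma measurable_cplxmx_powmx0 (M : 'M[R]_n) (g : R -> R) (N : 'M[C]_n) i j : measurable_fun setT g ->
  measurable_fun setT (fun x => complex.Re ((cplxmx (powmx0 (g x) M) *m N) i j)) /\
  measurable_fun setT (fun x => complex.Im ((cplxmx (powmx0 (g x) M) *m N) i j)).
Proof.
move=> mg; apply: measurable_mulmx_entry => [i' j'|//]; split.
  by under eq_fun do rewrite mxE /=; exact: measurable_powmx0.
by under eq_fun do rewrite mxE /=; exact: measurable_cst.
Qed.

Lemma measurable_amp i j : measurable_fun setT (fun x => complex.Re (amp x i j)) /\
  measurable_fun setT (fun x => complex.Im (amp x i j)).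
Proof.
have m1 : measurable_fun setT (fun x : R => Num.max x 0) by exact: measurable_maxr.
have m2 : measurable_fun setT (fun x : R => Num.max (- x) 0).
  by apply: measurable_maxr => //; exact: measurableT_comp.
have [a1 a2] := measurable_cplxmx_powmx0 (- D) A i j m1.
have [b1 b2] := measurable_cplxmx_powmx0 (- D) (Defs.conjmx A) i j m2.
split.
  by under eq_fun do rewrite mxE ReD; exact: measurable_funD.
by under eq_fun do rewrite mxE ImD; exact: measurable_funD.
Qed.

Lemma measurable_kernel t i j :
  measurable_fun setT (fun x => complex.Re (ofbm_kernel H A t x i j)) /\
  measurable_fun setT (fun x => complex.Im (ofbm_kernel H A t x i j)).
Proof.
have [a1 a2] := measurable_amp i j.
have mi : measurable_fun [set: R] (fun x : R => x^-1) by exact: measurable_invr.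
have mt : measurable_fun [set: R] (fun x : R => t * x) by exact: measurable_funM.
have ms : measurable_fun [set: R] (fun x : R => sin (t * x) / x).
  by apply: measurable_funM => //; apply: measurableT_comp mt; apply: continuous_measurable_fun; exact: continuous_sin.
have mc : measurable_fun [set: R] (fun x : R => (1 - cos (t * x)) / x).
  apply: measurable_funM => //; apply: measurable_funB => //.
  by apply: measurableT_comp mt; apply: continuous_measurable_fun; exact: continuous_cos.
split.
  under eq_fun do rewrite mxE kernel_scalarE -/(amp _) ReM /=.
  by apply: measurable_funB; exact: measurable_funM.
under eq_fun do rewrite mxE kernel_scalarE -/(amp _) ImM /=.
by apply: measurable_funD; exact: measurable_funM.
Qed.
End kernel.

(** * Transfer of moments between probability spaces *)

Section pair_law.
Context {R : realType} {d : measure_display} {T : measurableType d}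
  {d' : measure_display} {T' : measurableType d'}.
Variables (Pr : probability T R) (Pr' : probability T' R).
Variables (a b : T -> R) (a' b' : T' -> R).
Hypotheses (ma : measurable_fun setT a) (mb : measurable_fun setT b)
  (ma' : measurable_fun setT a') (mb' : measurable_fun setT b').
Hypothesis rect : forall E F : set R, measurable E -> measurable F ->
  Pr [set w | E (a w) /\ F (b w)] = Pr' [set w | E (a' w) /\ F (b' w)].

Let mU : measurable_fun setT (fun w => (a w, b w)).
Proof. exact: measurable_fun_pair. Qed.
Let mU' : measurable_fun setT (fun w => (a' w, b' w)).
Proof. exact: measurable_fun_pair. Qed.
Let U_mixin := isMeasurableFun.Build _ _ _ _ _ mU.
Let U : {mfun T >-> (R * R)%type} := HB.pack (fun w => (a w, b w)) U_mixin.
Let U'_mixin := isMeasurableFun.Build _ _ _ _ _ mU'.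
Let U' : {mfun T' >-> (R * R)%type} := HB.pack (fun w => (a' w, b' w)) U'_mixin.

(** Measurable rectangles are stable under intersection and generate the product sigma-algebra, so
    they determine the joint law of the pair. *)
Lemma pair_law (f : R * R -> R) : measurable_fun setT f -> (forall x, 0 <= f x) ->
  \int[Pr]_w f (a w, b w) = \int[Pr']_w f (a' w, b' w).
Proof.
move=> mf f0; rewrite /Rintegral; congr fine.
rewrite (@ge0_integral_law _ _ _ Pr _ _ U (pushforward Pr U)) //.
rewrite (@ge0_integral_law _ _ _ Pr' _ _ U' (pushforward Pr U)) //.
move=> E mE; apply/esym.
apply: (@measure_unique _ R (R * R)%type
  [set A `*` B | A in measurable & B in measurable] (fun=> setT) _ _ _ _
  (pushforward Pr U) (pushforward Pr' U')) => //.
- exact: measurable_prod_measurableType.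
- move=> _ _ [A1 mA1 [B1 mB1 <-]] [A2 mA2 [B2 mB2 <-]].
  exists (A1 `&` A2); first exact: measurableI.
  by exists (B1 `&` B2); [exact: measurableI|rewrite setXI].
- by move=> _; exists setT => //; exists setT => //; rewrite setXTT.
- by rewrite bigcup_const //; exists 0%N.
- by move=> _ [A1 mA1 [B1 mB1 <-]]; exact: rect.
- move=> _; apply: (@le_lt_trans _ _ 1%E); last by rewrite ltry.
  exact: (probability_le1 Pr measurableT).
Qed.
End pair_law.

Section ofbm_covariance.
Context {R : realType} {d : measure_display} {T : measurableType d}.
Local Notation C := R[i].
Local Notation mu := (@lebesgue_measure R).
Variables (Pr : probability T R) (n : nat) (H : 'M[R]_n) (A : 'M[C]_n)
  (X : R -> T -> 'cV[R]_n).

Lemma gaussian_L4 t i : centered_gaussian_process Pr X -> L4 Pr (fun w => X t w i 0).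
Proof.
move=> hX; have := hX 1%N (fun=> delta_mx 0 i) (fun=> t).
under [Y in centered_normal _ Y]eq_fun do
  rewrite big_ord_recl big_ord0 addr0 -rowE mxE.
move=> h; split; first by case: h.
by have [v _ [_ ->]] := centered_normal_moments h; rewrite ltry.
Qed.

(** The isometry gives the covariance of [Y] on the space of the random measure, and the two-point
    laws carry it over to [X]. As [pair_law] is for nonnegative functions, the product is polarized
    into three squares. *)
Lemma ofbm_cov : is_ofbm H A Pr X -> map_mx (@complex.Im R) (A *m adjmx A) = 0 ->
  forall s t i l,
  intg mu (fun x => (1 - cos (s * x) - cos (t * x) + cos ((s - t) * x)) * spec H A x i l) /\
  \int[Pr]_w (X s w i 0 * X t w l 0) =
  \int[mu]_x ((1 - cos (s * x) - cos (t * x) + cos ((s - t) * x)) * spec H A x i l).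
Proof.
move=> [_ gX [d' [T' [Pr' [B [Y [hB hY fdd]]]]]]] hAim s t i l.
have wr r k : wiener_row Pr' B (fun x => delta_mx 0 k *m ofbm_kernel H A r x) (fun w => (Y r w k 0)%:C).
  have := wiener_row_of hB (delta_mx 0 k) (measurable_kernel H A r) (hY r).
  by under [Z in wiener_row _ _ _ Z]eq_fun do rewrite -rowE !mxE.
have [iq cq] := wiener_row_cov hB (wr s i) (wr t l).
have e x := kernel_cov H hAim s t i l x.
split; first by move: iq; under [Z in intg _ Z]eq_fun do rewrite e.
have -> : \int[mu]_x ((1 - cos (s * x) - cos (t * x) + cos ((s - t) * x)) * spec H A x i l) =
  \int[Pr']_w (Y s w i 0 * Y t w l 0).
  by rewrite cq; apply: eq_Rintegral => x _; rewrite e.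
have a4 := gaussian_L4 s i gX; have b4 := gaussian_L4 t l gX.
have [ma _] := a4; have [mb _] := b4.
have sq r k : measurable_fun setT (fun w => Y r w k 0) /\ intg Pr' (fun w => Y r w k 0 ^+ 2).
  have [i1 _ _] := wiener_row_isometry hB (wr r k).
  have [_ [m1 _] _] := wr r k; split => //.
  by move: i1; under [Z in intg _ Z]eq_fun do rewrite /sqn /= expr0n /= addr0.
have [ma' ia'] := sq s i; have [mb' ib'] := sq t l.
have [id _ _] := wiener_row_isometry hB (wiener_rowD hB (wr s i) (wr t l)).
have id' : intg Pr' (fun w => (Y s w i 0 + Y t w l 0) ^+ 2).
  by move: id; under [Z in intg _ Z]eq_fun do rewrite /sqn /= addr0 expr0n /= addr0.
have rect (E F : set R) : measurable E -> measurable F ->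
    Pr [set w | E (X s w i 0) /\ F (X t w l 0)] = Pr' [set w | E (Y s w i 0) /\ F (Y t w l 0)].
  move=> mE mF.
  pose tt (k : 'I_2) := if k == 0 then s else t.
  (* Finite-dimensional laws constrain all coordinates at both times: [EE] is [E] for coordinate [i]
     at the first time, [F] for coordinate [l] at the second, and the whole line otherwise. *)
  pose EE (k : 'I_2) (j : 'I_n) : set R := [set x | (k == 0 -> j = i -> E x) /\ (k != 0 -> j = l -> F x)].
  have mEE k j : measurable (EE k j).
    have imp (P Q : Prop) (S : set R) : measurable S -> measurable [set x | P -> Q -> S x].
      move=> mS; have [p|np] := pselect P; last first.
        by rewrite (_ : [set x | _] = setT) //; apply/seteqP; split => x //= _ p; case: (np p).
      have [q|nq] := pselect Q; last first.
        by rewrite (_ : [set x | _] = setT) //; apply/seteqP; split => x //= _ _ q; case: (nq q).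
      by rewrite (_ : [set x | _] = S) //; apply/seteqP; split => x /=; [apply|].
    by apply: measurableI; exact: imp.
  have ev (T0 : Type) (Z : R -> T0 -> 'cV[R]_n) : [set w | E (Z s w i 0) /\ F (Z t w l 0)] =
      [set w | forall k j, EE k j (Z (tt k) w j 0)].
    apply/seteqP; split => w /=.
      by move=> [h1 h2] k j; rewrite /EE /tt /=; case: eqP => _; split => // _ ->.
    move=> h; split.
      by have [+ _] := h 0 i; apply.
    by have [_ +] := h 1 l; apply.
  by rewrite !ev; exact: fdd.
have L f mf f0 := @pair_law R _ _ _ _ Pr Pr' _ _ _ _ ma mb ma' mb' rect f mf f0.
have m1 : measurable_fun setT (fun p : R * R => p.1) by exact: measurable_fst.
have m2 : measurable_fun setT (fun p : R * R => p.2) by exact: measurable_snd.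
have l1 := L (fun p => p.1 ^+ 2) (measurable_funX _ m1) (fun=> sqr_ge0 _).
have l2 := L (fun p => p.2 ^+ 2) (measurable_funX _ m2) (fun=> sqr_ge0 _).
have l3 := L (fun p => (p.1 + p.2) ^+ 2) (measurable_funX _ (measurable_funD m1 m2)) (fun=> sqr_ge0 _).
move: l1 l2 l3 => /= l1 l2 l3.
have pol (d0 : measure_display) (T0 : measurableType d0) (P0 : probability T0 R) (u v : T0 -> R) :
  intg P0 (fun w => u w ^+ 2) -> intg P0 (fun w => v w ^+ 2) -> intg P0 (fun w => (u w + v w) ^+ 2) ->
  \int[P0]_w (u w * v w) = 2^-1 * (\int[P0]_w ((u w + v w) ^+ 2) - \int[P0]_w (u w ^+ 2) - \int[P0]_w (v w ^+ 2)).
  move=> h1 h2 h3; rewrite -!RintegralB //; last exact: intgB.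
  rewrite -RintegralZl //; last by apply: intgB => //; exact: intgB.
  by apply: eq_Rintegral => w _; field.
have p2 u : L4 Pr u -> intg Pr (fun w => u w ^+ 2).
  by move=> h; under [Z in intg _ Z]eq_fun do rewrite expr2; exact: L4_prod2.
have i3 : intg Pr (fun w => (X s w i 0 + X t w l 0) ^+ 2) by apply: p2; exact: L4D.
have e1 := pol _ _ Pr (fun w => X s w i 0) (fun w => X t w l 0) (p2 _ a4) (p2 _ b4) i3.
have e2 := pol _ _ Pr' (fun w => Y s w i 0) (fun w => Y t w l 0) ia' ib' id'.
by rewrite e1 e2 l1 l2 l3.
Qed.
End ofbm_covariance.

(** * Riemann-Lebesgue and the spectral form of wavelet covariances *)

Section real_fubini.
Context {d1 d2 : measure_display} {T1 : measurableType d1} {T2 : measurableType d2} {R : realType}.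
Variables (m1 : {sigma_finite_measure set T1 -> \bar R}) (m2 : {sigma_finite_measure set T2 -> \bar R}).
Variables (f : T1 * T2 -> R) (g : T1 -> R).
Hypothesis mf : measurable_fun setT f.
Hypothesis f1 : forall x, intg m2 (fun y => f (x, y)).
Hypothesis f2 : forall y, intg m1 (fun x => f (x, y)).
Hypothesis ig : intg m1 g.
Hypothesis fg : forall x, \int[m2]_y `|f (x, y)| <= g x.

Let mF : measurable_fun setT (fun x => \int[m2]_y `|f (x, y)|).
Proof.
apply: measurableT_comp; first exact: fine_measurable.
apply: (@measurable_fun_fubini_tonelli_F _ _ _ _ _ m2 (fun p => `|f p|%:E)) => //=.
by apply/measurable_EFinP; apply: measurableT_comp.
Qed.

Let iF : intg m1 (fun x => \int[m2]_y `|f (x, y)|).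
Proof.
apply: (intg_le mF ig) => x; rewrite ger0_norm //.
by apply: Rintegral_ge0.
Qed.

Let abs_le : (\int[m1]_x \int[m2]_y `|(f (x, y))%:E| <= (\int[m1]_x g x)%:E)%E.
Proof.
have -> : (\int[m1]_x \int[m2]_y `|(f (x, y))%:E| = \int[m1]_x (\int[m2]_y `|f (x, y)|)%:E)%E.
  apply: eq_integral => x _; rewrite -intgE //; exact: intg_norm.
by rewrite intgE // lee_fin; exact: ge0_Rintegral_le.
Qed.

Let ip : (m1 \x m2)%E.-integrable setT (EFin \o f).
Proof.
apply/integrable12ltyP; first exact/measurable_EFinP.
by apply: le_lt_trans abs_le _; rewrite ltry.
Qed.

(** The last clause bounds the result in L^1; it supplies the domination required by a second
    exchange of integrals. *)
Lemma Rfubini : [/\ \int[m1]_x \int[m2]_y f (x, y) = \int[m2]_y \int[m1]_x f (x, y),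
  intg m1 (fun x => \int[m2]_y f (x, y)),
  intg m2 (fun y => \int[m1]_x f (x, y)) &
  \int[m2]_y `|\int[m1]_x f (x, y)| <= \int[m1]_x g x].
Proof.
have e1 x : (\int[m2]_y (f (x, y))%:E)%E = (\int[m2]_y f (x, y))%:E by exact: intgE.
have e2 y : (\int[m1]_x (f (x, y))%:E)%E = (\int[m1]_x f (x, y))%:E by exact: intgE.
have i1 : intg m1 (fun x => \int[m2]_y f (x, y)).
  have := integrable_fubini_F ip; congr integrable.
  by apply/funext => x; exact: e1.
have m2f : measurable_fun setT (fun y => \int[m1]_x f (x, y)).
  by apply: measurableT_comp; [exact: fine_measurable|exact: (measurable_fubini_G ip)].
have le2 : (\int[m2]_y (`|\int[m1]_x f (x, y)|)%:E <= (\int[m1]_x g x)%:E)%E.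
  apply: le_trans abs_le; rewrite (@fubini_tonelli _ _ _ _ _ _ _ (fun p => `|(f p)%:E|%E)) //; last first.
    by apply: measurableT_comp => //; exact/measurable_EFinP.
  have -> : (\int[m2]_y \int[m1]_x `|(f (x, y))%:E| = \int[m2]_y (\int[m1]_x `|f (x, y)|)%:E)%E.
    by apply: eq_integral => y _; rewrite -intgE //; exact: intg_norm.
  apply: ge0_le_integral => //.
  - by apply/measurable_EFinP; apply: measurableT_comp.
  - apply/measurable_EFinP; apply: measurableT_comp; first exact: fine_measurable.
    apply: (@measurable_fun_fubini_tonelli_G _ _ _ _ _ m1 (fun p => `|f p|%:E)) => //=.
    by apply/measurable_EFinP; apply: measurableT_comp.
  - by move=> y _; rewrite lee_fin; exact: (le_normr_Rintegral measurableT (f2 y)).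
have i2 : intg m2 (fun y => \int[m1]_x f (x, y)).
  apply/integrableP; split; first exact/measurable_EFinP.
  by apply: le_lt_trans le2 _; rewrite ltry.
split=> //; last by rewrite -lee_fin -intgE //; exact: intg_norm.
apply: EFin_inj; rewrite -!intgE //.
have := Fubini ip => /= h.
transitivity (\int[m1]_x \int[m2]_y (f (x, y))%:E)%E; first by apply: eq_integral => x _.
by rewrite h; apply: eq_integral => y _.
Qed.
End real_fubini.

Section riemann_lebesgue.
Variable R : realType.
Local Notation mu := (@lebesgue_measure R).
Let Eset (N : nat) : set R := `[- N%:R, N%:R[%classic.
Let mE N : measurable (Eset N : set (measurableTypeR R)).
Proof. exact: measurable_itv. Qed.
Let EsetE N x : (Eset N x) = (- N%:R <= x < N%:R :> Prop).
Proof. by rewrite /Eset /= in_itv. Qed.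
Let muE N : (mu (Eset N) < +oo)%E.
Proof. by rewrite lebesgue_measure_itv /=; case: ifP => // _; rewrite -EFinB ltry. Qed.

Lemma intg_cosM (f : R -> R) (y : R) : intg mu f -> intg mu (fun x => f x * cos (y * x)).
Proof.
move=> fi; apply: (intg_le _ (intg_norm fi)).
  apply: measurable_funM; first exact: (intg_measurable fi).
  apply: continuous_measurable_fun => t.
  apply: continuous_comp; [by apply: cvgM; [exact: cvg_cst|exact: cvg_id]|exact: continuous_cos].
by move=> x; rewrite normrM ler_piMr // cos_max.
Qed.

(* Translating by half a period of [cos (m x)] changes its sign. *)
Lemma cos_integral_shift (f : R -> R) (m : R) : intg mu f -> 0 < m ->
  `|\int[mu]_x (f x * cos (m * x))| <= \int[mu]_x `|f x - f (x + pi / m)|.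
Proof.
move=> fi m0.
have fs : intg mu (fun x => f (x + pi / m)).
  have := @intg_affine R 1 (pi / m) ltr01 f fi.
  by under [X in intg _ X]eq_fun do rewrite mul1r.
have ic := intg_cosM m fi; have ics := intg_cosM m fs.
have e : \int[mu]_x (f x * cos (m * x)) = - \int[mu]_x (f (x + pi / m) * cos (m * x)).
  rewrite (@Rintegral_affine R 1 (pi / m) ltr01); last exact: (intg_measurable ic).
  rewrite mul1r -mulN1r -RintegralZl //; apply: eq_Rintegral => x _.
  have -> : m * (1 * x + pi / m) = m * x + pi by field; exact: lt0r_neq0.
  by rewrite cosD cospi sinpi mul1r; ring.
have e2 : \int[mu]_x (f x * cos (m * x)) = 2^-1 * \int[mu]_x ((f x - f (x + pi / m)) * cos (m * x)).
  transitivity (2^-1 * (\int[mu]_x (f x * cos (m * x)) - \int[mu]_x (f (x + pi / m) * cos (m * x)))).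
    have -> : \int[mu]_x (f (x + pi / m) * cos (m * x)) = - \int[mu]_x (f x * cos (m * x)).
      by rewrite e opprK.
    by field.
  congr (_ * _); rewrite -RintegralB //; apply: eq_Rintegral => x _; ring.
have id : intg mu (fun x => f x - f (x + pi / m)) by exact: intgB.
rewrite e2 normrM ger0_norm // ler_pdivrMl //.
apply: (@le_trans _ _ (\int[mu]_x `|f x - f (x + pi / m)|)); last first.
  by rewrite ler_peMl ?ler1n //; apply: Rintegral_ge0.
have idc := intg_cosM m id.
apply: le_trans (le_normr_Rintegral _ idc) _ => //.
apply: ge0_Rintegral_le; [exact: intg_norm|exact: intg_norm|].
by move=> x; rewrite normrM ler_piMr // cos_max.
Qed.

Lemma cvg_tail (f : R -> R) : intg mu f ->
  (fun N => \int[mu]_x `|f x - \1_(Eset N) x * f x|) @ \oo --> (0 : R).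
Proof.
move=> fi.
have mi N : measurable_fun setT (fun x => `|f x - \1_(Eset N) x * f x|).
  apply: measurableT_comp => //; apply: measurable_funB; first exact: (intg_measurable fi).
  by apply: measurable_funM; [by apply: measurable_indic; exact: mE|exact: (intg_measurable fi)].
have b N x : `|f x - \1_(Eset N) x * f x| <= `|f x|.
  rewrite indicE; case: (_ \in _); rewrite ?mul1r ?mul0r ?subr0 //.
  by rewrite subrr normr0.
suff : (fun N => \int[mu]_x (`|f x - \1_(Eset N) x * f x|)%:E)%E @ \oo --> (\int[mu]_x (0 : R)%:E)%E.
  by rewrite integral0 => /fine_cvgP[_].
apply: (@dominated_cvg _ _ R mu setT measurableT _ (fun=> 0%:E) (fun x => `|f x|%:E)).
- by move=> N; apply/measurable_EFinP; exact: mi.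
- move=> x _; apply: cvg_EFin; first exact: nearW.
  apply: cvg_near_cst.
  have : \forall N \near \oo, `|x| < N%:R :> R.
    exact: (cvgry_gt (@cvgr_idn R)).
  apply: filterS => N xN.
  rewrite /= indicE mem_set ?mul1r ?subrr ?normr0 // EsetE.
  by move: xN; rewrite ltr_norml => /andP[h ->]; rewrite ltW.
- by [].
- exact: intg_norm.
- by move=> N x _; rewrite lee_fin normr_id.
Qed.

(** Continuity of translations in L^1 for a truncated continuous function. The window is closed on
    the left and the shifts are positive, so that every point, endpoints included, eventually stays
    on its side of the boundary: convergence holds everywhere, dominated on the window enlarged by
    1. *)
Lemma cvg_shift (g : R -> R) N (h : nat -> R) : continuous g ->
  (forall m, 0 < h m <= 1) -> h @ \oo --> (0 : R) ->
  let p x := \1_(Eset N) x * g x in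
  intg mu p /\ (fun m => \int[mu]_x `|p x - p (x + h m)|) @ \oo --> (0 : R).
Proof.
move=> cg h01 h0 p.
have [B B0 gB] : exists2 B, 0 <= B & forall x, Eset N x -> `|g x| <= B.
  have NN : - N%:R <= N%:R :> R by rewrite -subr_ge0 opprK addr_ge0.
  have cn : {within `[- N%:R, N%:R], continuous (fun x => `|g x|)}.
    apply: continuous_subspaceT => x; apply: continuous_comp; [exact: cg|exact: norm_continuous].
  have [c _ hc] := EVT_max NN cn.
  exists `|g c| => // x; rewrite EsetE => /andP[x1 x2]; apply: hc.
  by rewrite in_itv /= x1 ltW.
have mp : measurable_fun setT p.
  apply: measurable_funM; first by apply: measurable_indic; exact: mE.
  exact: continuous_measurable_fun.
have pB x : `|p x| <= B * \1_(Eset N) x.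
  rewrite /p indicE; case: (asboolP (Eset N x)) => xE.
    by rewrite mem_set // mul1r mulr1 gB.
  by rewrite memNset // mul0r mulr0 normr0.
have iE M : intg mu (fun x => B * \1_(Eset M) x).
  apply: intgZ; apply: intg_lty => //.
    by rewrite integral_indic ?setIT; [exact: muE| |exact: mE].
have ip : intg mu p by exact: (intg_le _ (iE N)).
split=> //.
have mps m : measurable_fun [set: R] (fun x : R => p (x + h m)).
  by apply: (measurableT_comp mp); exact: measurable_funD.
have mi m : measurable_fun [set: R] (fun x : R => `|p x - p (x + h m)|).
  by apply: measurableT_comp => //; exact: measurable_funB.
have p_in y : Eset N y -> p y = g y by move=> Ny; rewrite /p indicE mem_set // mul1r.
have p_out y : ~ Eset N y -> p y = 0 by move=> Ny; rewrite /p indicE memNset // mul0r.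
pose D (x : R) : R := B * \1_(Eset N.+1) x + B * \1_(Eset N.+1) x.
have sub (x k : R) : 0 <= k <= 1 -> \1_(Eset N) (x + k) <= \1_(Eset N.+1) x :> R.
  move=> /andP[k0 k1]; rewrite !indicE; case: (asboolP (Eset N (x + k))) => xE; last first.
    by rewrite (memNset xE) ler0n.
  rewrite (mem_set xE) mem_set ?lexx // EsetE; move: xE; rewrite EsetE -natr1 => /andP[h1 h2].
  apply/andP; split; lra.
have dom m (x : R) : `|p x - p (x + h m)| <= D x.
  apply: le_trans (ler_normB _ _) _; apply: lerD.
    apply: le_trans (pB x) _; rewrite ler_wpM2l //.
    by have := sub x 0; rewrite addr0 lexx ler01; apply.
  apply: le_trans (pB _) _; rewrite ler_wpM2l //; apply: sub.
  by have /andP[h1 ->] := h01 m; rewrite ltW.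
suff : (fun m => \int[mu]_x (`|p x - p (x + h m)|)%:E)%E @ \oo --> (\int[mu]_x (0 : R)%:E)%E.
  by rewrite integral0 => /fine_cvgP[_].
apply: (@dominated_cvg _ _ R mu setT measurableT _ (fun=> 0%:E) (fun x => (D x)%:E)).
- by move=> m; apply/measurable_EFinP; exact: mi.
- move=> x _; apply: cvg_EFin; first exact: nearW.
  have hlt e : 0 < e -> \forall m \near \oo, h m < e.
    by move=> e0; move/cvgr_lt : h0; apply.
  have [xN|xN] := ltP x (- N%:R).
    apply: cvg_near_cst.
    have : \forall m \near \oo, h m < - N%:R - x by apply: hlt; rewrite subr_gt0.
    apply: filterS => m hm; have /andP[hm0 _] := h01 m.
    by rewrite /= (p_out x) ?(p_out (x + h m)) ?subrr ?normr0 // EsetE; apply/negP;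
      rewrite negb_and -!ltNge -?leNgt; apply/orP; left; lra.
  have [Nx|Nx] := leP N%:R x.
    apply: cvg_near_cst; apply: nearW => m; have /andP[hm0 _] := h01 m.
    by rewrite /= (p_out x) ?(p_out (x + h m)) ?subrr ?normr0 // EsetE; apply/negP;
      rewrite negb_and -!leNgt; apply/orP; right; lra.
  have cgx : (fun m => `|g x - g (x + h m)|) @ \oo --> (0 : R).
    rewrite -(normr0 R) -(subrr (g x)); apply: cvg_norm; apply: cvgB; first exact: cvg_cst.
    apply: (@cvg_comp _ _ _ (fun m => x + h m) g); last exact: cg.
    have -> : nbhs x = nbhs (x + 0) by rewrite addr0.
    by apply: cvgD => //; exact: cvg_cst.
  apply: cvg_trans cgx; apply: near_eq_cvg.
  have : \forall m \near \oo, h m < N%:R - x by apply: hlt; rewrite subr_gt0.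
  apply: filterS => m hm; have /andP[hm0 _] := h01 m.
  by rewrite /= (p_in x) ?(p_in (x + h m)) // EsetE; apply/andP; split; lra.
- by [].
- by apply: intgD; exact: iE.
- by move=> m x _; rewrite lee_fin normr_id; exact: dom.
Qed.

Lemma riemann_lebesgue (f : R -> R) : intg mu f ->
  (fun m : nat => \int[mu]_x (f x * cos (m%:R * x))) @ \oo --> (0 : R).
Proof.
move=> fi; apply/cvgrPdist_le => /= e e0.
have e3 : 0 < e / 3 by rewrite divr_gt0.
have [N hN] : exists N, \int[mu]_x `|f x - \1_(Eset N) x * f x| <= e / 3.
  have /cvgr_le /(_ (e / 3) e3) h := cvg_tail fi.
  by have [N ?] := filter_ex h; exists N.
have iE : mu.-integrable (Eset N) (EFin \o f) by exact: integrableS fi.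
have [g_ [cg ig cvg]] := approximation_continuous_integrable (mE N) (muE N) iE.
have [k hk] : exists k, (\int[mu]_(z in Eset N) `|(f z - g_ k z)%:E| < (e / 3)%:E)%E.
  have /fine_cvgP[fi0 c0] := cvg.
  have /cvgr_lt /(_ (e / 3) e3) h := c0.
  have [k [h1 h2]] := filter_ex (filterI fi0 h); exists k.
  by rewrite -(fineK h1) lte_fin.
pose g := g_ k; pose p x := \1_(Eset N) x * g x.
(* Half a period at frequency m + 4; the 4 makes the shift at most 1, since pi <= 4. *)
pose h m : R := pi / (m%:R + 4).
have h01 m : 0 < h m <= 1.
  rewrite divr_gt0 ?pi_gt0 ?ltr_wpDl //= ler_pdivrMr ?ltr_wpDl // mul1r.
  by apply: (@le_trans _ _ 4); [have := @pihalf_lt2 R; rewrite ltr_pdivrMr // => /ltW; lra|rewrite lerDr].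
have h0 : h @ \oo --> (0 : R).
  rewrite -(mulr0 pi); apply: cvgM; first exact: cvg_cst.
  apply/gtr0_cvgV0; first by apply: nearW => m; rewrite ltr_wpDl.
  apply/cvgryPge => B0.
  have [M _ hM] := cvgry_ge (@cvgr_idn R) B0.
  by exists M => // m /= Mm; apply: le_trans (hM m Mm) _; rewrite lerDl.
have [ip cp] := cvg_shift N (cg k) h01 h0.
have ifE : intg mu (fun x => \1_(Eset N) x * f x).
  have ia := intg_norm fi; apply: (intg_le _ ia).
    by apply: measurable_funM; [by apply: measurable_indic; exact: mE|exact: (intg_measurable fi)].
  move=> x; rewrite indicE; case: (_ \in _); rewrite ?mul1r ?mul0r // normr0 //.
have d2 : \int[mu]_x `|\1_(Eset N) x * f x - p x| <= e / 3.
  rewrite -lee_fin -intgE; last by apply: intg_norm; exact: intgB.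
  apply: le_trans (ltW hk); rewrite [leRHS]integral_mkcond.
  rewrite le_eqVlt; apply/orP; left; apply/eqP; apply: eq_integral => x _.
  rewrite /p /patch indicE; case: ifP => xE.
    by rewrite !mul1r.
  by rewrite !mul0r subrr normr0.
have dfp : \int[mu]_x `|f x - p x| <= e / 3 + e / 3.
  apply: le_trans (lerD hN d2); rewrite -RintegralD //; last 2 first.
    by apply: intg_norm; exact: intgB.
    by apply: intg_norm; exact: intgB.
  apply: ge0_Rintegral_le.
  - by apply: intg_norm; exact: intgB.
  - by apply: intgD; apply: intg_norm; exact: intgB.
  - by move=> x; apply: le_trans (ler_normD _ _); rewrite subrKA.
have cp' : \forall m \near \oo, \int[mu]_x `|p x - p (x + h m)| <= e / 3.
  by move/cvgr_le : cp; apply.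
have : \forall m \near \oo, `|\int[mu]_x (f x * cos (m.+4%:R * x))| <= e.
  apply: filterS cp' => m hm.
  have m4 : m.+4%:R = m%:R + 4 :> R by rewrite -natrD addn4.
  have m40 : 0 < m.+4%:R :> R by rewrite ltr0n.
  have ifp : intg mu (fun x => f x - p x) by exact: intgB.
  have -> : \int[mu]_x (f x * cos (m.+4%:R * x)) =
     \int[mu]_x ((f x - p x) * cos (m.+4%:R * x)) + \int[mu]_x (p x * cos (m.+4%:R * x)).
    rewrite -RintegralD //; try exact: intg_cosM.
    by apply: eq_Rintegral => x _; ring.
  apply: le_trans (ler_normD _ _) _.
  have -> : e = (e / 3 + e / 3) + e / 3 by field.
  apply: lerD; last first.
    by apply: le_trans (cos_integral_shift ip m40) _; rewrite m4.
  apply: le_trans dfp; apply: le_trans (le_normr_Rintegral _ (intg_cosM _ ifp)) _ => //.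
  apply: ge0_Rintegral_le; [exact: intg_norm (intg_cosM _ ifp)|exact: intg_norm|].
  by move=> x; rewrite normrM ler_piMr // cos_max.
move=> [M _ hM]; exists (M + 4)%N => // m /= Mm.
have m4 : (4 <= m)%N by apply: leq_trans Mm; rewrite leq_addl.
rewrite sub0r normrN -(subnK m4) addn4; apply: hM => /=.
by rewrite leq_subRL // addnC.
Qed.
End riemann_lebesgue.

(** * Cosine and sine transforms *)

Section trigonometric_transform.
Variable R : realType.
Local Notation mu := (@lebesgue_measure R).
Variable phi : R -> R.
Hypothesis iphi : intg mu phi.

Definition Cf (x : R) : R := \int[mu]_t (cos (x * t) * phi t).
Definition Sf (x : R) : R := \int[mu]_t (sin (x * t) * phi t).

Let ccos (x : R) : continuous (fun t : R => cos (x * t)).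
Proof.
move=> t; apply: continuous_comp; [by apply: cvgM; [exact: cvg_cst|exact: cvg_id]|exact: continuous_cos].
Qed.
Let csin (x : R) : continuous (fun t : R => sin (x * t)).
Proof.
move=> t; apply: continuous_comp; [by apply: cvgM; [exact: cvg_cst|exact: cvg_id]|exact: continuous_sin].
Qed.

Lemma intg_cos_phi x : intg mu (fun t => cos (x * t) * phi t).
Proof.
apply: (@intg_bounded_mul _ _ iphi (fun t => cos (x * t)) 1).
  exact: continuous_measurable_fun.
by move=> t; exact: cos_max.
Qed.

Lemma intg_sin_phi x : intg mu (fun t => sin (x * t) * phi t).
Proof.
apply: (@intg_bounded_mul _ _ iphi (fun t => sin (x * t)) 1).
  exact: continuous_measurable_fun.
by move=> t; exact: sin_max.
Qed.

Lemma continuous_Cf : continuous Cf.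
Proof.
move=> x.
have := @continuity_under_integral R _ _ mu (fun x t => cos (x * t) * phi t) setT measurableT
  (x - 1) (x + 1) (fun y _ => intg_cos_phi y) _ (fun t => `|phi t|) (intg_norm iphi) _.
apply.
- apply: aeW => t _ y _; apply: cvgM; last exact: cvg_cst.
  by have := @ccos t y; under eq_fun do rewrite mulrC; rewrite /continuous_at mulrC.
- move=> y _; apply: aeW => t _; rewrite normrM ler_piMl //; exact: cos_max.
- by rewrite inE /= in_itv /=; apply/andP; split; lra.
Qed.

Lemma continuous_Sf : continuous Sf.
Proof.
move=> x.
have := @continuity_under_integral R _ _ mu (fun x t => sin (x * t) * phi t) setT measurableT
  (x - 1) (x + 1) (fun y _ => intg_sin_phi y) _ (fun t => `|phi t|) (intg_norm iphi) _.
apply.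
- apply: aeW => t _ y _; apply: cvgM; last exact: cvg_cst.
  by have := @csin t y; under eq_fun do rewrite mulrC; rewrite /continuous_at mulrC.
- move=> y _; apply: aeW => t _; rewrite normrM ler_piMl //; exact: sin_max.
- by rewrite inE /= in_itv /=; apply/andP; split; lra.
Qed.
End trigonometric_transform.

(** * Covariances of time integrals in spectral form *)

Section spectral_covariance.
Variable R : realType.
Local Notation mu := (@lebesgue_measure R).

(* [x^2] times the real part of the product of one kernel with the conjugate
   of the other. *)
Definition hker (u v x : R) : R := 1 - cos (u * x) - cos (v * x) + cos ((u - v) * x).

Lemma hkerE u v x :
  hker u v x = (1 - cos (u * x)) * (1 - cos (v * x)) + sin (u * x) * sin (v * x).
Proof. by rewrite /hker mulrBl cosB; ring. Qed.

(** |Re z w| <= (|z|^2 + |w|^2) / 2, together with |e^(iux) - 1|^2 = 2 (1 - cos(ux)). *)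
Lemma hker_le u v x : `|hker u v x| <= (1 - cos (u * x)) + (1 - cos (v * x)).
Proof.
rewrite hkerE.
have := cos2Dsin2 (u * x); have := cos2Dsin2 (v * x).
move: (cos (u * x)) (sin (u * x)) (cos (v * x)) (sin (v * x)) => a b c d h1 h2.
rewrite ler_norml -subr_ge0 -[X in _ && X]subr_ge0.
have -> : (1 - a) * (1 - c) + b * d - - (1 - a + (1 - c)) =
    2^-1 * (((1 - a) + (1 - c)) ^+ 2 + (b + d) ^+ 2 - (a ^+ 2 + b ^+ 2 - 1) - (c ^+ 2 + d ^+ 2 - 1)) by field.
have -> : 1 - a + (1 - c) - ((1 - a) * (1 - c) + b * d) =
    2^-1 * ((a - c) ^+ 2 + (b - d) ^+ 2 - (a ^+ 2 + b ^+ 2 - 1) - (c ^+ 2 + d ^+ 2 - 1)) by field.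
rewrite h1 h2 !subrr !subr0.
by apply/andP; split; rewrite mulr_ge0 // addr_ge0 ?sqr_ge0.
Qed.

(** To be applied with [q] an entry of the spectral density and [w] its trace. They need not be
    integrable near 0; multiplication by 1 - cos makes them so, with bounds uniform on compact sets
    of times. *)
Variables q w : R -> R.
Hypothesis mq : measurable_fun setT q.
Hypothesis qw : forall x, `|q x| <= w x.
Hypothesis iw : forall t, intg mu (fun x => (1 - cos (t * x)) * w x).
Variables (L M : R).
Hypothesis wM : forall t, `|t| <= L -> \int[mu]_x ((1 - cos (t * x)) * w x) <= M.

Definition Kcov (u v : R) : R := \int[mu]_x (hker u v x * q x).

Let mcosm d (T : measurableType d) (f : T -> R) : measurable_fun setT f ->
  measurable_fun setT (fun x => cos (f x)).
Proof. by apply: measurableT_comp; apply: continuous_measurable_fun; exact: continuous_cos. Qed.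
Let msinm d (T : measurableType d) (f : T -> R) : measurable_fun setT f ->
  measurable_fun setT (fun x => sin (f x)).
Proof. by apply: measurableT_comp; apply: continuous_measurable_fun; exact: continuous_sin. Qed.

Let mhker u : measurable_fun [set: R * R] (fun p : R * R => hker u p.1 p.2).
Proof.
apply: measurable_funD; last first.
  apply: mcosm; apply: measurable_funM; last exact: measurable_snd.
  by apply: measurable_funB => //; exact: measurable_fst.
apply: measurable_funB; last first.
  by apply: mcosm; apply: measurable_funM; [exact: measurable_fst|exact: measurable_snd].
apply: measurable_funB => //; apply: mcosm.
by apply: measurable_funM => //; exact: measurable_snd.
Qed.

Let mhkerx u v : measurable_fun [set: R] (fun x => hker u v x).
Proof.
have h := measurableT_comp (mhker u) (measurable_fun_pair (@measurable_cst _ _ R R setT v) (@measurable_id _ R setT)).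
exact: h.
Qed.
Let mhkerv u x : measurable_fun [set: R] (fun v => hker u v x).
Proof.
have h := measurableT_comp (mhker u) (measurable_fun_pair (@measurable_id _ R setT) (@measurable_cst _ _ R R setT x)).
exact: h.
Qed.

Let bound u v x : `|hker u v x * q x| <= (1 - cos (u * x)) * w x + (1 - cos (v * x)) * w x.
Proof. by rewrite normrM -mulrDl ler_pM // hker_le. Qed.

Lemma intg_hker u v : intg mu (fun x => hker u v x * q x).
Proof.
have ib := intgD (iw u) (iw v); apply: (intg_le _ ib) => [|x]; last exact: bound.
by apply: measurable_funM => //; exact: mhkerx.
Qed.

Let abs_bound u v : `|u| <= L -> `|v| <= L -> \int[mu]_x `|hker u v x * q x| <= M + M.
Proof.
move=> uL vL; apply: le_trans (lerD (wM uL) (wM vL)).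
rewrite -RintegralD //; [|exact: iw|exact: iw].
apply: ge0_Rintegral_le; [exact: intg_norm (intg_hker u v)|exact: intgD|exact: bound].
Qed.

Section one_variable.
Variable phi : R -> R.
Hypothesis iphi : intg mu phi.
Hypothesis phi0 : \int[mu]_t phi t = 0.
Hypothesis supp : forall t, phi t != 0 -> `|t| <= L.

Let h2 u x := (cos (u * x) - 1) * Cf phi x + sin (u * x) * Sf phi x.

Let inner u x : intg mu (fun v => phi v * (hker u v x * q x)) /\
  \int[mu]_v (phi v * (hker u v x * q x)) = h2 u x * q x.
Proof.
have e v : phi v * (hker u v x * q x) = q x * ((1 - cos (u * x)) * phi v +
    ((cos (u * x) - 1) * (cos (x * v) * phi v) + sin (u * x) * (sin (x * v) * phi v))).
  by rewrite hkerE [v * x]mulrC; ring.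
have ic := intg_cos_phi iphi x; have is_ := intg_sin_phi iphi x.
have i2 : intg mu (fun v => (cos (u * x) - 1) * (cos (x * v) * phi v) + sin (u * x) * (sin (x * v) * phi v)).
  by apply: intgD; exact: intgZ.
have i3 : intg mu (fun v => (1 - cos (u * x)) * phi v +
    ((cos (u * x) - 1) * (cos (x * v) * phi v) + sin (u * x) * (sin (x * v) * phi v))).
  by apply: intgD => //; exact: intgZ.
split; first by under [X in intg _ X]eq_fun do rewrite e; exact: intgZ.
transitivity (q x * \int[mu]_v ((1 - cos (u * x)) * phi v +
    ((cos (u * x) - 1) * (cos (x * v) * phi v) + sin (u * x) * (sin (x * v) * phi v)))).
  by rewrite -RintegralZl //; apply: eq_Rintegral => v _; exact: e.
rewrite mulrC; congr (_ * _).
rewrite RintegralD //; last exact: intgZ.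
rewrite RintegralZl // phi0 mulr0 add0r.
by rewrite RintegralD //; [rewrite !RintegralZl|exact: intgZ|exact: intgZ].
Qed.

(** Integration over the second time: the vanishing integral of [phi] removes the part of [hker]
    that is constant in v. The bound in L^1 prepares the integration over the first time. *)
Lemma Kcov_transform u : `|u| <= L -> [/\
  \int[mu]_v (phi v * Kcov u v) = \int[mu]_x (h2 u x * q x),
  intg mu (fun v => phi v * Kcov u v),
  intg mu (fun x => h2 u x * q x) &
  \int[mu]_x `|h2 u x * q x| <= (M + M) * \int[mu]_v `|phi v|].
Proof.
move=> uL.
have i1 v : intg mu (fun x => phi v * (hker u v x * q x)) by apply: intgZ; exact: intg_hker.
have ig : intg mu (fun v => (M + M) * `|phi v|) by apply: intgZ; exact: intg_norm.
have mf : measurable_fun [set: R * R] (fun p : R * R => phi p.1 * (hker u p.1 p.2 * q p.2)).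
  apply: measurable_funM; first exact: (measurableT_comp (intg_measurable iphi) measurable_fst).
  by apply: measurable_funM => //; exact: (measurableT_comp mq measurable_snd).
have [] := @Rfubini _ _ _ _ R mu mu _ (fun v => (M + M) * `|phi v|) mf i1 (fun x => (inner u x).1) ig.
  move=> v /=; have [->|nz] := eqVneq (phi v) 0.
    rewrite normr0 mulr0; under eq_Rintegral do rewrite mul0r normr0.
    by rewrite /Rintegral integral0.
  under eq_Rintegral do rewrite normrM.
  rewrite RintegralZl //; last by apply: intg_norm; exact: intg_hker.
  by rewrite mulrC ler_wpM2r // abs_bound // supp.
rewrite /= => e1 j1 j2 b.
have e2 x : \int[mu]_v (phi v * (hker u v x * q x)) = h2 u x * q x by exact: (inner u x).2.
have e3 v : \int[mu]_x (phi v * (hker u v x * q x)) = phi v * Kcov u v.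
  by rewrite RintegralZl //; exact: intg_hker.
split.
- transitivity (\int[mu]_v \int[mu]_x (phi v * (hker u v x * q x))).
    by apply: eq_Rintegral => v _.
  by rewrite e1; apply: eq_Rintegral => x _.
- by move: j1; under [X in intg _ X -> _]eq_fun do rewrite e3.
- by move: j2; under [X in intg _ X -> _]eq_fun do rewrite e2.
- rewrite -RintegralZl //; last exact: intg_norm.
  by apply: le_trans b; under [leLHS]eq_Rintegral do rewrite -e2.
Qed.
End one_variable.

Variables phi1 phi2 : R -> R.
Hypotheses (i1 : intg mu phi1) (i2 : intg mu phi2).
Hypotheses (int10 : \int[mu]_t phi1 t = 0) (int20 : \int[mu]_t phi2 t = 0).
Hypotheses (supp1 : forall t, phi1 t != 0 -> `|t| <= L) (supp2 : forall t, phi2 t != 0 -> `|t| <= L).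

(** Integration over the first time: the vanishing integral of [phi1] removes the remaining
    constant, leaving the real part of the transform of [phi1] times the conjugate of that of
    [phi2]. *)
Lemma spectral_cov :
  [/\ intg mu (fun u => phi1 u * \int[mu]_v (phi2 v * Kcov u v)), intg mu (fun x => (Cf phi1 x * Cf phi2 x + Sf phi1 x * Sf phi2 x) * q x) &
  \int[mu]_u (phi1 u * \int[mu]_v (phi2 v * Kcov u v)) =
  \int[mu]_x ((Cf phi1 x * Cf phi2 x + Sf phi1 x * Sf phi2 x) * q x)].
Proof.
pose h2 u x := (cos (u * x) - 1) * Cf phi2 x + sin (u * x) * Sf phi2 x.
have mC : measurable_fun [set: R] (Cf phi2) by apply: continuous_measurable_fun; exact: continuous_Cf.
have mS : measurable_fun [set: R] (Sf phi2) by apply: continuous_measurable_fun; exact: continuous_Sf.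
have mf : measurable_fun [set: R * R] (fun p : R * R => phi1 p.1 * (h2 p.1 p.2 * q p.2)).
  have m12 : measurable_fun [set: R * R] (fun p : R * R => p.1 * p.2).
    by apply: measurable_funM; [exact: measurable_fst|exact: measurable_snd].
  apply: measurable_funM; first exact: (measurableT_comp (intg_measurable i1) measurable_fst).
  apply: measurable_funM; last exact: (measurableT_comp mq measurable_snd).
  apply: measurable_funD; apply: measurable_funM.
  - by apply: measurable_funB => //; exact: mcosm.
  - exact: (measurableT_comp mC measurable_snd).
  - exact: msinm.
  - exact: (measurableT_comp mS measurable_snd).
have inn x : intg mu (fun u => phi1 u * (h2 u x * q x)) /\
  \int[mu]_u (phi1 u * (h2 u x * q x)) = (Cf phi1 x * Cf phi2 x + Sf phi1 x * Sf phi2 x) * q x.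
  have e u : phi1 u * (h2 u x * q x) = q x * ((- Cf phi2 x) * phi1 u +
      (Cf phi2 x * (cos (x * u) * phi1 u) + Sf phi2 x * (sin (x * u) * phi1 u))).
    by rewrite /h2 [u * x]mulrC; ring.
  have ic := intg_cos_phi i1 x; have is_ := intg_sin_phi i1 x.
  have ia : intg mu (fun u => Cf phi2 x * (cos (x * u) * phi1 u) + Sf phi2 x * (sin (x * u) * phi1 u)).
    by apply: intgD; exact: intgZ.
  have ib : intg mu (fun u => (- Cf phi2 x) * phi1 u +
      (Cf phi2 x * (cos (x * u) * phi1 u) + Sf phi2 x * (sin (x * u) * phi1 u))).
    by apply: intgD => //; exact: intgZ.
  split; first by under [X in intg _ X]eq_fun do rewrite e; exact: intgZ.
  transitivity (q x * \int[mu]_u ((- Cf phi2 x) * phi1 u +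
      (Cf phi2 x * (cos (x * u) * phi1 u) + Sf phi2 x * (sin (x * u) * phi1 u)))).
    by rewrite -RintegralZl //; apply: eq_Rintegral => u _; exact: e.
  rewrite mulrC; congr (_ * _).
  rewrite RintegralD //; last exact: intgZ.
  rewrite RintegralZl // int10 mulr0 add0r.
  rewrite RintegralD //; [rewrite !RintegralZl // -/(Cf phi1 x) -/(Sf phi1 x)|exact: intgZ|exact: intgZ].
  by rewrite [Cf phi2 x * _]mulrC [Sf phi2 x * _]mulrC.
have tr u := @Kcov_transform _ i2 int20 supp2 u.
have if1 u : intg mu (fun x => phi1 u * (h2 u x * q x)).
  have [->|nz] := eqVneq (phi1 u) 0.
    by under [X in intg _ X]eq_fun do rewrite mul0r; exact: integrable0.
  by apply: intgZ; have [] := tr u (supp1 nz).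
pose c := (M + M) * \int[mu]_v `|phi2 v|.
have ig : intg mu (fun u => c * `|phi1 u|) by apply: intgZ; exact: intg_norm.
have [] := @Rfubini _ _ _ _ R mu mu _ (fun u => c * `|phi1 u|) mf if1 (fun x => (inn x).1) ig.
  move=> u /=; have [->|nz] := eqVneq (phi1 u) 0.
    rewrite normr0 mulr0; under eq_Rintegral do rewrite mul0r normr0.
    by rewrite /Rintegral integral0.
  have [_ _ j b] := tr u (supp1 nz).
  under eq_Rintegral do rewrite normrM.
  rewrite RintegralZl //; last exact: intg_norm.
  by rewrite mulrC ler_wpM2r.
rewrite /= => e1 j1 j2 _.
have e2 x := (inn x).2.
have e3 u : \int[mu]_x (phi1 u * (h2 u x * q x)) = phi1 u * \int[mu]_v (phi2 v * Kcov u v).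
  have [->|nz] := eqVneq (phi1 u) 0.
    rewrite mul0r; under eq_Rintegral do rewrite mul0r.
    by rewrite /Rintegral integral0.
  have [e _ j _] := tr u (supp1 nz).
  by rewrite e RintegralZl.
split.
- by move: j1; under [X in intg _ X -> _]eq_fun do rewrite e3.
- by move: j2; under [X in intg _ X -> _]eq_fun do rewrite e2.
transitivity (\int[mu]_u \int[mu]_x (phi1 u * (h2 u x * q x))).
  by apply: eq_Rintegral => u _.
by rewrite e1; apply: eq_Rintegral => x _.
Qed.
End spectral_covariance.

(** * The spectral density *)

Section quadratic_forms.
Variable R : realType.
Local Notation C := R[i].
Variable n : nat.

Lemma qfZ a (S : 'M[R]_n) v : qf (a *: S) v = a * qf S v.
Proof.
rewrite /qf; have -> : cplxmx (a *: S) = a%:C *: cplxmx S.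
  by apply/matrixP => i j; rewrite !mxE rmorphM.
by rewrite -scalemxAr -scalemxAl mxE ReM /= mul0r subr0.
Qed.

Lemma qf_rowE (S : 'M[R]_n) (v : 'rV[C]_n) :
  qf S v = \sum_i \sum_j S i j * rin (v 0 i) (v 0 j).
Proof.
rewrite /qf mxE Re_bigsum exchange_big /=; apply: eq_bigr => j _.
rewrite mxE mulr_suml Re_bigsum; apply: eq_bigr => i _.
rewrite !mxE; case: (v 0 i) (v 0 j) => [a b] [c d]; rewrite /rin /=; ring.
Qed.

Lemma delta_rowE i k : (delta_mx 0 i : 'rV[C]_n) 0 k = (if k == i then 1 else 0 : R)%:C.
Proof. by rewrite mxE eqxx /=; case: (k == i). Qed.

Lemma qf_delta2 (S : 'M[R]_n) i l (a : R) : S^T = S -> i != l ->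
  qf S (delta_mx 0 i + a%:C *: delta_mx 0 l) = S i i + 2 * a * S i l + a ^+ 2 * S l l.
Proof.
move=> Ssym il; rewrite qf_rowE.
have li : l != i by rewrite eq_sym.
pose b k : R := (if k == i then 1 else 0) + a * (if k == l then 1 else 0).
have vE k : ((delta_mx 0 i + a%:C *: delta_mx 0 l : 'rV[C]_n) 0 k) = (b k)%:C.
  rewrite mxE [X in _ + X]mxE !delta_rowE /b.
  by apply/eqP; rewrite eq_complex /= !mul0r mulr0 subr0 !addr0 !eqxx.
have rinr (x y : R) : rin x%:C y%:C = x * y by rewrite /rin /= mulr0 addr0.
have bi : b i = 1 by rewrite /b eqxx (negbTE il) mulr0 addr0.
have bl : b l = a by rewrite /b eqxx (negbTE li) mulr1 add0r.
have bk k : k != i -> k != l -> b k = 0.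
  by move=> /negbTE ki /negbTE kl; rewrite /b ki kl mulr0 addr0.
under eq_bigr do under eq_bigr do rewrite !vE rinr.
have inner j : \sum_k S j k * (b j * b k) = b j * (S j i + a * S j l).
  rewrite (bigD1 i) //= (bigD1 l) //= big1; last first.
    by move=> k /andP[ki kl]; rewrite (bk k ki kl) !mulr0.
  rewrite bi bl; ring.
under eq_bigr do rewrite inner.
rewrite (bigD1 i) //= (bigD1 l) //= big1; last first.
  by move=> k /andP[ki kl]; rewrite (bk k ki kl) mul0r.
rewrite bi bl.
have -> : S l i = S i l by rewrite -[in LHS]Ssym mxE.
ring.
Qed.

Lemma qf_delta (S : 'M[R]_n) i : qf S (delta_mx 0 i) = S i i.
Proof.
rewrite qf_rowE; under eq_bigr do under eq_bigr do rewrite !delta_rowE /rin /= mulr0 addr0.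
rewrite (bigD1 i) //= (bigD1 i) //= !big1 ?eqxx ?mulr1 ?addr0 //.
- by move=> k /negbTE ->; rewrite big1 // => j _; rewrite mul0r mulr0.
- by move=> k /negbTE ->; rewrite !mulr0.
Qed.

(** The test vectors e_i + e_l and e_i - e_l give 2 |S_il| <= S_ii + S_ll. *)
Lemma psd_entry_le_trace (S : 'M[R]_n) i l : S^T = S -> (forall v, 0 <= qf S v) ->
  `|S i l| <= \tr S.
Proof.
move=> Ssym S0.
have d0 k : 0 <= S k k by rewrite -qf_delta.
have dtr k : S k k <= \tr S.
  by rewrite /mxtrace (bigD1 k) //= lerDl sumr_ge0.
have [->|il] := eqVneq i l; first by rewrite ger0_norm.
have h1 := S0 (delta_mx 0 i + 1%:C *: delta_mx 0 l).
have h2 := S0 (delta_mx 0 i + (-1)%:C *: delta_mx 0 l).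
move: h1 h2; rewrite !qf_delta2 // => h1 h2.
have := dtr i; have := dtr l; have := d0 i; have := d0 l => *.
by rewrite ler_norml; apply/andP; split; nra.
Qed.

Lemma mulmx_congr_entry (E S : 'M[R]_n) i l :
  (E *m S *m E^T) i l = \sum_j \sum_k E i j * S j k * E l k.
Proof.
rewrite mxE exchange_big /=; apply: eq_bigr => k _.
by rewrite !mxE mulr_suml.
Qed.

Lemma congr_diag_le (E S : 'M[R]_n) i :
  (E *m S *m E^T) i i <= (\sum_j \sum_k `|S j k|) * mxnorm2 ((delta_mx 0 i : 'rV_n) *m cplxmx E).
Proof.
have eE : mxnorm2 ((delta_mx 0 i : 'rV_n) *m cplxmx E) = \sum_j E i j ^+ 2.
  rewrite mxnorm2_row -rowE; apply: eq_bigr => j _.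
  by rewrite !mxE /sqn /= expr0n addr0.
rewrite mulmx_congr_entry eE mulr_suml; apply: ler_sum => j _.
rewrite mulr_suml; apply: ler_sum => k _.
have le1 m : E i m ^+ 2 <= \sum_m E i m ^+ 2.
  by rewrite [leRHS](bigD1 m) //= lerDl sumr_ge0 // => *; exact: sqr_ge0.
apply: le_trans (ler_norm _) _; rewrite mulrAC normrM mulrC ler_wpM2l //.
rewrite ler_norml; have := le1 j; have := le1 k.
have := sqr_ge0 (E i j - E i k); have := sqr_ge0 (E i j + E i k).
move: (\sum_m _) (E i j) (E i k) => s x y *; apply/andP; split; nra.
Qed.
End quadratic_forms.

Section shifted_exponential.
Variables (R : realType) (n : nat) (H : 'M[R]_n).

Lemma expmx_sub_scalar (a t : R) :
  expmx (t *: (H - a%:M)) = expR (- (a * t)) *: expmx (t *: H).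
Proof.
pose F s := expR (- (a * s)) *: expmx (s *: H).
suff h : mderiv F (fun t => F t *m (H - a%:M)).
  have -> : expR (- (a * t)) *: expmx (t *: H) = F t by [].
  by rewrite (expmx_ode h) /F mulr0 oppr0 expR0 expmx0 scale1r mul1mx.
move=> s i j.
have dE := expmx_derivr H s i j.
have de : is_derive s (1 : R) (fun s : R => expR (- a * s)) (expR (- a * s) * (- a)).
  apply: (@is_derive1_comp _ expR (fun s => - a * s)).
  have /= := is_deriveM (is_derive_cst (- a) s (1 : R)) (is_derive_id s (1 : R)).
  by rewrite /GRing.scale /= mulr0 addr0 mulr1; exact.
have -> : (fun s => F s i j) = (fun s => expR (- a * s) * expmx (s *: H) i j).
  by apply/funext => r; rewrite mxE mulNr.
have := is_deriveM de dE; move=> /is_derive_eq; apply.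
rewrite mulmxBr -!scalemxAl mul_mx_scalar /F !mxE mulNr /GRing.scale /=; ring.
Qed.
End shifted_exponential.

Section spectral_density.
Variable R : realType.
Local Notation C := R[i].
Local Notation mu := (@lebesgue_measure R).
Variables (n : nat) (H : 'M[R]_n) (A : 'M[C]_n).
Hypothesis hAre : \rank (map_mx (@complex.Re R) (A *m adjmx A)) = n.
Hypothesis hAim : map_mx (@complex.Im R) (A *m adjmx A) = 0.
Local Notation G := (map_mx (@complex.Re R) (A *m adjmx A)).
Local Notation D := (H - (2^-1)%:M).
Local Notation q := (spec H A).

Lemma cplxmx_inj m p : injective (@cplxmx R m p).
Proof.
move=> M N /matrixP h; apply/matrixP => i j; have := h i j; rewrite !mxE.
by move=> /(congr1 (@complex.Re R)).
Qed.

Lemma G_sym : G^T = G.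
Proof.
apply: cplxmx_inj; rewrite -adjmx_cplxmx -(AadjA hAim) adjmxM adjmxK //.
Qed.

Lemma qf_G v : qf G v = mxnorm2 (v *m A).
Proof. by rewrite /qf -(AadjA hAim) mulmxA -mulmxA -adjmxM row_adjmx. Qed.

Lemma mxnorm2_eq0 m (v : 'rV[C]_m) : mxnorm2 v = 0 -> v = 0.
Proof.
rewrite mxnorm2_row => /eqP; rewrite psumr_eq0; last by move=> i _; exact: sqn_ge0.
move=> /allP h; apply/rowP => i; have := h i; rewrite mem_index_enum => /(_ isT) /=.
rewrite paddr_eq0 ?sqr_ge0 // !sqrf_eq0 mxE.
by case: (v 0 i) => a b /= /andP[/eqP -> /eqP ->].
Qed.

Lemma qf_G_gt0 v : v != 0 -> 0 < qf G v.
Proof.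
move=> v0; rewrite lt_def qf_G mxnorm2_ge0 andbT; apply: contra v0 => /eqP /mxnorm2_eq0 h.
have uG : G \in unitmx by rewrite -row_full_unit /row_full hAre.
have uG' : cplxmx G \in unitmx.
  have : cplxmx G *m cplxmx (invmx G) = 1%:M.
    by rewrite -cplxmxM mulmxV //; apply/matrixP => i j; rewrite !mxE rmorph_nat.
  by move=> /mulmx1_unit [].
have : v *m cplxmx G = 0 by rewrite -(AadjA hAim) mulmxA h mul0mx.
by move=> /(congr1 (mulmx^~ (invmx (cplxmx G)))); rewrite mulmxK // mul0mx => ->.
Qed.

Lemma spec_sym x : (q x)^T = q x.
Proof. by rewrite /spec linearZ /= !trmx_mul trmxK G_sym mulmxA. Qed.

Lemma qf_spec x v : qf (q x) v = x ^- 2 * qf G (v *m cplxmx (powmx0 `|x| (- D))).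
Proof. by rewrite /spec qfZ qf_congr. Qed.

Lemma qf_spec_ge0 x v : 0 <= qf (q x) v.
Proof. by rewrite qf_spec mulr_ge0 ?invr_ge0 ?sqr_ge0 // qf_G mxnorm2_ge0. Qed.

Lemma qf_spec_gt0 x v : x != 0 -> v != 0 -> 0 < qf (q x) v.
Proof.
move=> x0 v0; rewrite qf_spec mulr_gt0 ?invr_gt0 ?exprn_even_gt0 //.
apply: qf_G_gt0; apply: contra v0 => /eqP h.
have x1 : 0 < `|x| by rewrite normr_gt0.
have : v *m cplxmx (powmx0 `|x| (- D)) *m cplxmx (expmx (- ln `|x| *: (- D))) = 0.
  by rewrite h mul0mx.
rewrite /powmx0 x1 -mulmxA -cplxmxM expmxNK => <-; apply/eqP.
by rewrite (_ : cplxmx 1%:M = 1%:M) ?mulmx1 //; apply/matrixP => i j; rewrite !mxE rmorph_nat.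
Qed.

Lemma spec_le_trace x i l : `|q x i l| <= \tr (q x).
Proof. by apply: psd_entry_le_trace; [exact: spec_sym|exact: qf_spec_ge0]. Qed.

Lemma measurable_spec i l : measurable_fun setT (fun x => q x i l).
Proof.
have -> : (fun x => q x i l) = (fun x => x^-1 ^+ 2 * \sum_j \sum_k
    powmx0 `|x| (- D) i j * G j k * powmx0 `|x| (- D) l k).
  by apply/funext => x; rewrite mxE mulmx_congr_entry exprVn.
have mn : measurable_fun [set: R] (fun x : R => `|x|) by exact: measurableT_comp.
apply: measurable_funM; first by apply: measurable_funX; exact: measurable_invr.
apply: measurable_sum => j; apply: measurable_sum => k.
apply: measurable_funM; last exact: measurable_powmx0.
by apply: measurable_funM => //; exact: measurable_powmx0.
Qed.

(** Self-similarity at the level of the density. The factor [c] is c^2 from x^(-2) times c^(-1) from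
    the shift 1/2 in D, which acts on both sides of G. *)
Lemma spec_scale c x : 0 < c ->
  q (x / c) = c *: (expmx (ln c *: H) *m q x *m (expmx (ln c *: H))^T).
Proof.
move=> c0; have cn0 : c != 0 by exact: lt0r_neq0.
have [->|x0] := eqVneq x 0.
  rewrite mul0r /spec normr0 !powmx00 !mul0mx scaler0 mulmx0 mul0mx scaler0 //.
have x1 : 0 < `|x| by rewrite normr_gt0.
have xc : 0 < `|x / c| by rewrite normr_gt0 mulf_neq0 // invr_eq0.
have -> : q (x / c) = (x / c) ^- 2 *: (powmx0 `|x / c| (- D) *m G *m (powmx0 `|x / c| (- D))^T) by [].
have pE : powmx0 `|x / c| (- D) = expR (- (2^-1 * ln c)) *: (expmx (ln c *: H) *m powmx0 `|x| (- D)).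
  rewrite /powmx0 xc x1 /powmx.
  have -> : ln `|x / c| = - ln c + ln `|x|.
    by rewrite normrM (gtr0_norm (_ : 0 < c^-1)) ?invr_gt0 // lnM ?posrE ?invr_gt0 // lnV ?posrE // addrC.
  by rewrite expmxDl scaleNr -scalerN opprK expmx_sub_scalar scalemxAl.
set e := expR _ in pE *; set E := expmx _ in pE *; set p := powmx0 `|x| _ in pE *.
have ee : e * e = c^-1.
  by rewrite -expRD -opprD -mulrDl (_ : 2^-1 + 2^-1 = 1 :> R) ?mul1r ?expRN ?lnK //; field.
have key (M G0 : 'M[R]_n) : (e *: M) *m G0 *m (e *: M)^T = c^-1 *: (M *m G0 *m M^T).
  by rewrite [(e *: M)^T]linearZ /= -!scalemxAl -scalemxAr scalerA ee.
have -> : q x = x ^- 2 *: (p *m G *m p^T) by [].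
rewrite pE key scalerA trmx_mul -scalemxAr -scalemxAl scalerA !mulmxA; congr (_ *: _).
by field; apply/andP.
Qed.

Hypothesis ik : forall s t i l, intg mu (fun x => hker s t x * q x i l).

Definition Kmat s t : 'M[R]_n := \matrix_(i, l) \int[mu]_x (hker s t x * q x i l).

(** The Jacobian of the substitution of x / c for x cancels the scalar factor of [spec_scale]. *)
Lemma Kmat_scale c s t : 0 < c ->
  Kmat (c * s) (c * t) = expmx (ln c *: H) *m Kmat s t *m (expmx (ln c *: H))^T.
Proof.
move=> c0; apply/matrixP => i l; rewrite mulmx_congr_entry mxE.
have c0' : 0 < c^-1 by rewrite invr_gt0.
rewrite (@Rintegral_affine R c^-1 0 c0'); last exact: intg_measurable (ik _ _ _ _).
set E := expmx (ln c *: H).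
have e x : hker (c * s) (c * t) (c^-1 * x + 0) * q (c^-1 * x + 0) i l =
   c * \sum_j \sum_k (E i j * E l k) * (hker s t x * q x j k).
  rewrite addr0 [c^-1 * x]mulrC spec_scale // mxE mulmx_congr_entry.
  have -> : hker (c * s) (c * t) (x / c) = hker s t x.
    rewrite /hker -mulrBr.
    have cx (y : R) : c * y * (x / c) = y * x by field; exact: lt0r_neq0.
    by rewrite !cx.
  rewrite mulrCA mulr_sumr; congr (_ * _); apply: eq_bigr => j _.
  by rewrite mulr_sumr; apply: eq_bigr => k _; ring.
transitivity (c^-1 * \int[mu]_x (c * \sum_j \sum_k (E i j * E l k) * (hker s t x * q x j k))).
  by congr (_ * _); apply: eq_Rintegral => x _; exact: e.
have ijk j k : intg mu (fun x => (E i j * E l k) * (hker s t x * q x j k)) by apply: intgZ.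
have ij j : intg mu (fun x => \sum_k (E i j * E l k) * (hker s t x * q x j k)) by exact: intg_bigsum.
rewrite RintegralZl //; last exact: intg_bigsum.
rewrite mulKf ?gt_eqF // Rintegral_bigsum //; apply: eq_bigr => j _.
rewrite Rintegral_bigsum //; apply: eq_bigr => k _.
have -> : Kmat s t j k = \int[mu]_x (hker s t x * q x j k) by rewrite mxE.
rewrite RintegralZl; [|by []|exact: ik].
by rewrite mulrAC.
Qed.

Lemma hker_diag (t x : R) : hker t t x = 2 * (1 - cos (t * x)).
Proof. by rewrite /hker subrr mul0r cos0; ring. Qed.

Lemma Kmat_opp t : Kmat (- t) (- t) = Kmat t t.
Proof.
apply/matrixP => i l; rewrite !mxE; apply: eq_Rintegral => x _.
by rewrite !hker_diag mulNr cosN.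
Qed.

Lemma Kmat0 : Kmat 0 0 = 0.
Proof.
apply/matrixP => i l; rewrite !mxE; under eq_Rintegral do rewrite hker_diag mul0r cos0 subrr mulr0 mul0r.
by rewrite /Rintegral integral0.
Qed.

Section bound.
Variables (n' : nat) (h : 'I_n' -> C) (sz : 'I_n' -> nat)
  (hsz : (\sum_(i < n') sz i)%N = n) (P : 'M[C]_n).
Hypothesis uP : P \in unitmx.
Hypothesis HJ : cplxmx H =
     P *m castmx (hsz, hsz) (\mxdiag_(i < n') Jordan_block (h i) (sz i)) *m invmx P.
Hypothesis h0 : forall i, 0 < complex.Re (h i) < 1.

(** By scaling, K(t, t) is K(1, 1) congruent by t^H for t > 0. This is bounded for t <= 1 because
    the eigenvalues of H have positive real parts, and for t in [1, L] by the growth estimate;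
    negative times follow by evenness. *)
Lemma Kmat_bound L : exists M, forall t, `|t| <= L -> forall i, Kmat t t i i <= M.
Proof.
have [c c0 hc] : exists2 c, 0 < c & forall i, c <= complex.Re (h i).
  exists (\big[Num.min/1]_i complex.Re (h i)).
    by elim/big_ind: _ => // [x y x0 y0|i _]; [rewrite lt_min x0|case/andP: (h0 i)].
  by move=> i; rewrite (bigD1 i) //= ge_min lexx.
have [K1 K10 hK1] := expmx_upper_neg uP HJ hc c0.
have [K2 K20 hK2] := expmx_upper uP HJ (fun i => ltW (proj2 (andP (h0 i)))) ltr01.
pose B := \sum_j \sum_k `|Kmat 1 1 j k|.
have B0 : 0 <= B by apply: sumr_ge0 => j _; exact: sumr_ge0.
pose M := B * K1 + B * (K2 * expR (4 * ln (Num.max L 1))).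
have M1 : 0 <= B * K1 by rewrite mulr_ge0 // ltW.
have M2 : 0 <= B * (K2 * expR (4 * ln (Num.max L 1))) by rewrite !mulr_ge0 ?expR_ge0 // ltW.
have e1 i : mxnorm2 (delta_mx 0 i : 'rV[C]_n) = 1.
  rewrite mxnorm2_row (bigD1 i) //= big1; last first.
    by move=> k /negbTE ki; rewrite mxE ki andbF /sqn /= expr0n addr0.
  by rewrite mxE !eqxx /sqn /= expr0n expr1n !addr0.
have pos t : 0 < t -> t <= L -> forall i, Kmat t t i i <= M.
  move=> t0 tL i.
  have -> : Kmat t t = expmx (ln t *: H) *m Kmat 1 1 *m (expmx (ln t *: H))^T.
    by rewrite -Kmat_scale // mulr1.
  apply: le_trans (congr_diag_le _ _ _) _; rewrite -/B.
  have [t1|t1] := leP t 1.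
    apply: (@le_trans _ _ (B * K1)); last by rewrite lerDl.
    have lt0 : ln t <= 0 by rewrite ln_le0.
    rewrite ler_wpM2l //; apply: le_trans (hK1 _ _ lt0) _.
    by rewrite subrr mulr0 mul0r expR0 e1 !mulr1.
  apply: (@le_trans _ _ (B * (K2 * expR (4 * ln (Num.max L 1))))); last by rewrite lerDr.
  have lt0 : 0 <= ln t by rewrite ln_ge0 // ltW.
  rewrite ler_wpM2l //; apply: le_trans (hK2 _ _ lt0) _.
  rewrite e1 mulr1 ler_wpM2l ?(ltW K20) // ler_expR.
  have -> : 2 * (1 + 1) = 4 :> R by ring.
  rewrite ler_wpM2l // ler_ln ?posrE // ?le_max ?tL // lt_max ltr01 orbT //.
exists M => t tL i; have [t0|t0|->] := ltgtP t 0.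
- by rewrite -Kmat_opp; apply: pos; rewrite ?oppr_gt0 // -(ltr0_norm t0).
- by apply: pos => //; rewrite -(gtr0_norm t0).
- by rewrite Kmat0 mxE addr_ge0.
Qed.
End bound.
End spectral_density.

(** * Normalized wavelet coefficients *)

Section wick_linear.
Context {d : measure_display} {T : measurableType d} {R : realType}.
Variable Pr : probability T R.

Lemma Wick_lin (I : Type) (s : seq I) (a : I -> R) (f : I -> T -> R) b c e :
  (forall j, L4 Pr (f j)) -> L4 Pr b -> L4 Pr c -> L4 Pr e ->
  (forall j, Wick Pr (f j) b c e) -> Wick Pr (fun w => \sum_(j <- s) a j * f j w) b c e.
Proof.
move=> hf hb hc he hW; rewrite /Wick.
have i4 j : intg Pr (fun w => a j * (f j w * b w * c w * e w)) by apply: intgZ; exact: L4_prod4.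
have i2 g j : L4 Pr g -> intg Pr (fun w => a j * (f j w * g w)).
  by move=> hg; apply: intgZ; exact: L4_prod2.
have E2 g : L4 Pr g -> \int[Pr]_w ((\sum_(j <- s) a j * f j w) * g w) =
    \sum_(j <- s) a j * \int[Pr]_w (f j w * g w).
  move=> hg; transitivity (\int[Pr]_w \sum_(j <- s) a j * (f j w * g w)).
    by apply: eq_Rintegral => w _; rewrite mulr_suml; apply: eq_bigr => j _; rewrite mulrA.
  rewrite Rintegral_bigsum; last by move=> j; exact: i2.
  by apply: eq_bigr => j _; rewrite RintegralZl //; exact: L4_prod2.
rewrite !E2 // !mulr_suml -!big_split /=.
transitivity (\int[Pr]_w \sum_(j <- s) a j * (f j w * b w * c w * e w)).
  apply: eq_Rintegral => w _; rewrite !mulr_suml; apply: eq_bigr => j _; ring.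
rewrite Rintegral_bigsum //; apply: eq_bigr => j _.
rewrite RintegralZl //; last exact: L4_prod4.
by rewrite hW; ring.
Qed.
End wick_linear.

(** * Double sums over lags *)

Section cesaro_double.
Variable R : realType.
Variable g : nat -> R.
Hypothesis g0 : forall m, 0 <= g m.

Definition absd (k l : nat) : nat := (k - l + (l - k))%N.

(** For fixed [k] each lag occurs at most twice, once on either side of [k]. *)
Lemma sum_absd_le K k : (0 < k <= K)%N ->
  \sum_(1 <= l < K.+1) g (absd k l) <= 2 * \sum_(0 <= m < K) g m.
Proof.
move=> /andP[k0 kK].
have sub a b : (b <= K)%N -> \sum_(a <= m < b) g m <= \sum_(0 <= m < K) g m.
  move=> bK; have [ab|ba] := leqP a b; last first.
    by rewrite big_geq ?(ltnW ba) // sumr_ge0.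
  rewrite [leRHS](@big_cat_nat _ _ _ a) //=; last exact: leq_trans ab bK.
  rewrite [X in _ <= _ + X](@big_cat_nat _ _ _ b) //=.
  rewrite addrCA lerDl addr_ge0 //; exact: sumr_ge0.
rewrite (@big_cat_nat _ _ _ k.+1) //= mulr2n mulrDl !mul1r; apply: lerD.
  rewrite big_nat_rev /= big_add1 /=.
  rewrite (eq_big_nat _ _ (F2 := g)); first exact: sub.
  move=> i /andP[_ ik]; congr g; rewrite /absd; lia.
have -> : k.+1 = (1 + k)%N by rewrite add1n.
rewrite big_addn.
rewrite (eq_big_nat _ _ (F2 := g)); first by apply: sub; lia.
move=> i /andP[i1 _]; congr g; rewrite /absd; lia.
Qed.

Lemma double_sum_absd_le K : (0 < K)%N ->
  (K%:R ^- 2) * \sum_(1 <= k < K.+1) \sum_(1 <= l < K.+1) g (absd k l)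
  <= 2 * (K%:R^-1 * \sum_(0 <= m < K) g m).
Proof.
move=> K0; have K0' : 0 < K%:R :> R by rewrite ltr0n.
set S := \sum_(0 <= m < K) g m.
have : \sum_(1 <= k < K.+1) \sum_(1 <= l < K.+1) g (absd k l) <= \sum_(1 <= k < K.+1) (2 * S).
  rewrite big_nat [leRHS]big_nat; apply: ler_sum => k kK; exact: sum_absd_le.
rewrite sumr_const_nat subSS subn0 -mulr_natr => h.
apply: le_trans (ler_wpM2l _ h) _; first by rewrite invr_ge0 exprn_ge0 // ltW.
by rewrite le_eqVlt; apply/orP; left; apply/eqP; field; exact: lt0r_neq0.
Qed.

Lemma cvg_mean : g @ \oo --> (0 : R) ->
  (fun K : nat => K%:R^-1 * \sum_(0 <= m < K) g m) @ \oo --> (0 : R).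
Proof.
move=> /cesaro h; rewrite -(cvg_shiftn 1) /=.
apply: cvg_trans h; apply: near_eq_cvg; apply: nearW => K.
by rewrite /arithmetic_mean /series /= addn1.
Qed.
End cesaro_double.

(** * Second and fourth moments of the wavelet coefficients *)

Section wavelet_process.
Context {R : realType} {d : measure_display} {T : measurableType d}.
Local Notation C := R[i].
Local Notation mu := (@lebesgue_measure R).
Variables (Pr : probability T R) (n : nat) (H : 'M[R]_n) (A : 'M[C]_n)
  (X : R -> T -> 'cV[R]_n).
Hypothesis hX : is_ofbm H A Pr X.
Hypothesis hXm : measurable_process X.
Hypothesis hAre : \rank (map_mx (@complex.Re R) (A *m adjmx A)) = n.
Hypothesis hAim : map_mx (@complex.Im R) (A *m adjmx A) = 0.
Variables (n' : nat) (h : 'I_n' -> C) (sz : 'I_n' -> nat)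
  (hsz : (\sum_(i < n') sz i)%N = n) (P : 'M[C]_n).
Hypothesis uP : P \in unitmx.
Hypothesis HJ : cplxmx H =
     P *m castmx (hsz, hsz) (\mxdiag_(i < n') Jordan_block (h i) (sz i)) *m invmx P.
Hypothesis h01 : forall i, 0 < complex.Re (h i) < 1.
Variables (psi : R -> R) (L0 : R).
Hypothesis ipsi : intg mu psi.
Hypothesis psi0 : \int[mu]_t psi t = 0.
Hypothesis supp : forall t, psi t != 0 -> `|t| <= L0.
Local Notation q := (spec H A).
Local Notation K := (Kmat H A).

Lemma intg_spec s t i l : intg mu (fun x => hker s t x * q x i l).
Proof. exact: (ofbm_cov hX hAim s t i l).1. Qed.

Lemma cov_X s t i l : \int[Pr]_w (X s w i 0 * X t w l 0) = K s t i l.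
Proof. by rewrite mxE (ofbm_cov hX hAim s t i l).2. Qed.

Lemma X_L4 t i : L4 Pr (fun w => X t w i 0).
Proof. by have [_ gX _] := hX; exact: gaussian_L4. Qed.

Lemma X_moment4 t i : (\int[Pr]_w ((X t w i 0) ^+ 4)%:E = (3 * K t t i i ^+ 2)%:E)%E.
Proof.
have [_ gX _] := hX; have := gX 1%N (fun=> delta_mx 0 i) (fun=> t).
under [Y in centered_normal _ Y]eq_fun do rewrite big_ord_recl big_ord0 addr0 -rowE mxE.
move=> /centered_normal_moments [v v0 [e2 ->]].
congr (EFin (3 * _ ^+ 2)); rewrite -cov_X /Rintegral.
by under eq_integral do rewrite -expr2; rewrite e2.
Qed.

Lemma X_Wick t1 t2 t3 t4 i1 i2 i3 i4 :
  Wick Pr (fun w => X t1 w i1 0) (fun w => X t2 w i2 0) (fun w => X t3 w i3 0) (fun w => X t4 w i4 0).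
Proof.
apply: Wick_of_moments; try exact: X_L4.
move=> x y z G.
have [_ gX _] := hX.
pose ui (l : 'I_4) := if l == 0 :> nat then i1 else if l == 1%N :> nat then i2 else if l == 2%N :> nat then i3 else i4.
pose ti (l : 'I_4) := if l == 0 :> nat then t1 else if l == 1%N :> nat then t2 else if l == 2%N :> nat then t3 else t4.
pose ci (l : 'I_4) := if l == 0 :> nat then 1 else if l == 1%N :> nat then x else if l == 2%N :> nat then y else z.
have := gX 4%N (fun l => ci l *: delta_mx 0 (ui l)) ti.
have -> : (fun w => (\sum_(l < 4) (ci l *: (delta_mx 0 (ui l) : 'rV[R]_n)) *m X (ti l) w) 0 0) = G.
  apply/funext => w; rewrite summxE.
  under eq_bigr do rewrite -scalemxAl mxE -rowE mxE.
  by rewrite !big_ord_recl big_ord0 /ci /ui /ti /= addr0 mul1r /G !addrA.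
move=> /centered_normal_moments [v v0 [e2 e4]].
by rewrite /Rintegral e2 e4.
Qed.

Definition phi (k u : R) : R := psi (u - k).

Lemma intg_phi k : intg mu (phi k).
Proof.
have := @intg_affine R 1 (- k) ltr01 psi ipsi.
by under [X in intg _ X]eq_fun do rewrite mul1r.
Qed.

Lemma phi_int0 k : \int[mu]_u phi k u = 0.
Proof.
rewrite -psi0 [RHS](@Rintegral_affine R 1 (- k) ltr01) ?mul1r; last exact: (intg_measurable ipsi).
by apply: eq_Rintegral => u _; rewrite mul1r.
Qed.

Lemma phi_supp k u : phi k u != 0 -> `|u| <= L0 + `|k|.
Proof.
move=> /supp h0; rewrite -[u](subrK k); apply: le_trans (ler_normD _ _) _.
by rewrite lerD2r.
Qed.

Lemma Cf_phi k x : Cf (phi k) x = cos (k * x) * Cf psi x - sin (k * x) * Sf psi x.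
Proof.
have ic := intg_cos_phi ipsi x; have is_ := intg_sin_phi ipsi x.
rewrite /Cf (@Rintegral_affine R 1 k ltr01); last exact: intg_measurable (intg_cos_phi (intg_phi k) x).
rewrite mul1r -!RintegralZl // -RintegralB //; try exact: intgZ.
apply: eq_Rintegral => u _; rewrite /phi mul1r addrK mulrDr cosD [x * k]mulrC; ring.
Qed.

Lemma Sf_phi k x : Sf (phi k) x = sin (k * x) * Cf psi x + cos (k * x) * Sf psi x.
Proof.
have ic := intg_cos_phi ipsi x; have is_ := intg_sin_phi ipsi x.
rewrite /Sf (@Rintegral_affine R 1 k ltr01); last exact: intg_measurable (intg_sin_phi (intg_phi k) x).
rewrite mul1r -!RintegralZl // -RintegralD //; try exact: intgZ.
apply: eq_Rintegral => u _; rewrite /phi mul1r addrK mulrDr sinD [x * k]mulrC; ring.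
Qed.

(* The squared modulus of the Fourier transform of the wavelet. *)
Definition psi2 x := Cf psi x ^+ 2 + Sf psi x ^+ 2.

Definition Gam (m : R) : 'M[R]_n := \matrix_(i, l) \int[mu]_x (psi2 x * q x i l * cos (m * x)).

Lemma phi_transform k k' x : Cf (phi k) x * Cf (phi k') x + Sf (phi k) x * Sf (phi k') x =
  psi2 x * cos ((k - k') * x).
Proof.
have -> : (k - k') * x = k * x - k' * x by ring.
rewrite !Cf_phi !Sf_phi /psi2 cosB; ring.
Qed.

Lemma intg_trace t : intg mu (fun x => (1 - cos (t * x)) * \tr (q x)).
Proof.
have -> : (fun x => (1 - cos (t * x)) * \tr (q x)) = (fun x => 2^-1 * \sum_i hker t t x * q x i i).
  by apply/funext => x; rewrite -mulr_sumr hker_diag -/(mxtrace _); field.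
by apply: intgZ; apply: intg_bigsum => i; exact: intg_spec.
Qed.

Lemma trace_bound L : exists M, forall t, `|t| <= L -> \int[mu]_x ((1 - cos (t * x)) * \tr (q x)) <= M.
Proof.
have [M hM] := Kmat_bound intg_spec uP HJ h01 L.
exists (2^-1 * \sum_(i < n) M) => t tL.
have -> : \int[mu]_x ((1 - cos (t * x)) * \tr (q x)) = 2^-1 * \sum_i K t t i i.
  transitivity (\int[mu]_x (2^-1 * \sum_i hker t t x * q x i i)).
    by apply: eq_Rintegral => x _; rewrite -mulr_sumr hker_diag -/(mxtrace _); field.
  rewrite RintegralZl //; last by apply: intg_bigsum => i; exact: intg_spec.
  rewrite Rintegral_bigsum; last by move=> i; exact: intg_spec.
  by congr (_ * _); apply: eq_bigr => i _; rewrite mxE.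
by rewrite ler_wpM2l ?invr_ge0 //; apply: ler_sum => i _; exact: hM.
Qed.

Lemma cov_phi k k' i l : [/\ forall u, phi k u != 0 -> intg mu (fun v => phi k' v * K u v i l),
  intg mu (fun u => phi k u * \int[mu]_v (phi k' v * K u v i l)),
  intg mu (fun x => psi2 x * q x i l * cos ((k - k') * x)) &
  \int[mu]_u (phi k u * \int[mu]_v (phi k' v * K u v i l)) = Gam (k - k') i l].
Proof.
pose L := L0 + `|k| + `|k'|.
have [M hM] := trace_bound L.
have s1 t : phi k t != 0 -> `|t| <= L by move=> /phi_supp /le_trans; apply; rewrite lerDl.
have s2 t : phi k' t != 0 -> `|t| <= L.
  by move=> /phi_supp /le_trans; apply; rewrite /L addrAC lerDl.
have [iu i1 e1] := spectral_cov (measurable_spec H A i l) (fun x => spec_le_trace H hAim x i l) intg_trace hM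
  (intg_phi k) (intg_phi k') (phi_int0 k) (phi_int0 k') s1 s2.
have e x : (Cf (phi k) x * Cf (phi k') x + Sf (phi k) x * Sf (phi k') x) * q x i l =
    psi2 x * q x i l * cos ((k - k') * x).
  by rewrite phi_transform mulrAC.
have eK u v : K u v i l = Kcov (fun x => q x i l) u v by rewrite mxE.
have eu u : phi k u * \int[mu]_v (phi k' v * K u v i l) =
    phi k u * \int[mu]_v (phi k' v * Kcov (fun x => q x i l) u v).
  by congr (_ * _); apply: eq_Rintegral => v _; rewrite eK.
split.
- move=> u /s1 uL; have [_ j _ _] := Kcov_transform (measurable_spec H A i l) (fun x => spec_le_trace H hAim x i l)
    intg_trace hM (intg_phi k') (phi_int0 k') s2 uL.
  by under [Z in intg _ Z]eq_fun do rewrite eK.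
- by under [Z in intg _ Z]eq_fun do rewrite eu.
- by move: i1; under [Z in intg _ Z]eq_fun do rewrite e.
rewrite mxE; transitivity (\int[mu]_u (phi k u * \int[mu]_v (phi k' v * Kcov (fun x => q x i l) u v))).
  by apply: eq_Rintegral => u _; exact: eu.
by rewrite e1; apply: eq_Rintegral => x _; exact: e.
Qed.

Lemma intg_psi2_spec i l : intg mu (fun x => psi2 x * q x i l).
Proof.
have [_ _ + _] := cov_phi 0 0 i l.
by under [Z in intg _ Z -> _]eq_fun do rewrite subrr mul0r cos0 mulr1.
Qed.

Lemma Gam_opp m : Gam (- m) = Gam m.
Proof.
by apply/matrixP => i l; rewrite !mxE; apply: eq_Rintegral => x _; rewrite mulNr cosN.
Qed.

Lemma Gam_cvg0 i l : (fun m : nat => Gam m%:R i l) @ \oo --> (0 : R).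
Proof.
under eq_fun do rewrite mxE.
exact: riemann_lebesgue (intg_psi2_spec i l).
Qed.

Lemma Gam_sym m : (Gam m)^T = Gam m.
Proof.
apply/matrixP => i l; rewrite !mxE; apply: eq_Rintegral => x _.
by rewrite -[in LHS](spec_sym H hAim x) mxE.
Qed.

Section scale.
Variables (s : R).
Hypothesis s0 : 0 < s.
Let E := expmx (ln s *: H).
Let E' := expmx (- ln s *: H).

(** The wavelet coefficient after the substitution t = s u, in which the Jacobian [s] cancels the
    two factors s^(-1/2). *)
Definition Dw (k : R) i (w : T) : R := \int[mu]_u (phi k u * X (s * u) w i 0).

Let mXs i : measurable_fun [set: R * T] (fun p : R * T => X (s * p.1) p.2 i 0).
Proof.
have mp : measurable_fun [set: R * T] (fun p : R * T => (s * p.1, p.2)).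
  apply: measurable_fun_pair; last exact: measurable_snd.
  by apply: measurable_funM => //; exact: measurable_fst.
exact: (measurableT_comp (hXm i) mp).
Qed.

Let X4b k : exists M, forall i t, phi k t != 0 -> (\int[Pr]_w ((X (s * t) w i 0) ^+ 4)%:E <= M%:E)%E.
Proof.
have [M hM] := Kmat_bound intg_spec uP HJ h01 (s * (L0 + `|k|)).
exists (3 * M ^+ 2) => i t /phi_supp ht; rewrite X_moment4 lee_fin ler_wpM2l //.
have K0 : 0 <= K (s * t) (s * t) i i.
  by rewrite -cov_X; apply: Rintegral_ge0 => w _; rewrite -expr2 sqr_ge0.
have KM : K (s * t) (s * t) i i <= M by apply: hM; rewrite normrM (gtr0_norm s0) ler_pM2l.
by rewrite lerXn2r ?nnegrE // (le_trans K0).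
Qed.

Lemma Dw_L4 k i : L4 Pr (Dw k i).
Proof.
have [M hM] := X4b k.
exact: (L4_time_integral (mXs i) (intg_phi k) (hM i)).
Qed.

Lemma Dw_cov_row k b i : L4 Pr b -> \int[Pr]_w (Dw k i w * b w) =
  \int[mu]_u (phi k u * \int[Pr]_w (X (s * u) w i 0 * b w)).
Proof.
move=> hb; have [M hM] := X4b k.
exact: (time_integral_cov (mXs i) (intg_phi k) (hM i) hb).1.
Qed.

Lemma Dw_Wick k b c e i : L4 Pr b -> L4 Pr c -> L4 Pr e ->
  (forall u, Wick Pr (fun w => X (s * u) w i 0) b c e) -> Wick Pr (Dw k i) b c e.
Proof.
move=> hb hc he hW; have [M hM] := X4b k.
by apply: (Wick_time_integral (mXs i) (intg_phi k) (hM i)).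
Qed.

(** The four slots are treated one after another, a rotation bringing the next one to the front. *)
Lemma Dw_Wick4 k1 k2 k3 k4 i1 i2 i3 i4 :
  Wick Pr (Dw k1 i1) (Dw k2 i2) (Dw k3 i3) (Dw k4 i4).
Proof.
have L := Dw_L4; have LX := X_L4.
apply: Dw_Wick => // u1; apply: Wick_rot.
apply: Dw_Wick => // u4; apply: Wick_rot.
apply: Dw_Wick => // u3; apply: Wick_rot.
apply: Dw_Wick => // u2; exact: X_Wick.
Qed.

(** The scale enters only through [Kmat_scale], which extracts s^H on both sides; the double time
    integral that remains is the one at scale 1. *)
Lemma cov_Dw k k' i l :
  \int[Pr]_w (Dw k i w * Dw k' l w) = (E *m Gam (k - k') *m E^T) i l.
Proof.
rewrite Dw_cov_row; last exact: Dw_L4.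
have inner u : phi k u * \int[Pr]_w (X (s * u) w i 0 * Dw k' l w) =
    \sum_j \sum_m E i j * E l m * (phi k u * \int[mu]_v (phi k' v * K u v j m)).
  have -> : \int[Pr]_w (X (s * u) w i 0 * Dw k' l w) = \int[Pr]_w (Dw k' l w * X (s * u) w i 0).
    by apply: eq_Rintegral => w _; rewrite mulrC.
  rewrite Dw_cov_row; last exact: X_L4.
  have [->|nz] := eqVneq (phi k u) 0.
    rewrite mul0r big1 // => j _; rewrite big1 // => m _.
    by rewrite mul0r mulr0.
  have iv j m : intg mu (fun v => phi k' v * K u v j m).
    by have [iv _ _ _] := cov_phi k k' j m; exact: iv.
  transitivity (phi k u * \int[mu]_v \sum_j \sum_m E i j * E l m * (phi k' v * K u v j m)).
    congr (_ * _); apply: eq_Rintegral => v _.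
    have -> : \int[Pr]_w (X (s * v) w l 0 * X (s * u) w i 0) = K (s * u) (s * v) i l.
      by rewrite -cov_X; apply: eq_Rintegral => w _; rewrite mulrC.
    rewrite (Kmat_scale intg_spec) // mulmx_congr_entry mulr_sumr; apply: eq_bigr => j _.
    rewrite mulr_sumr; apply: eq_bigr => m _; rewrite -/E; ring.
  have ivz j m : intg mu (fun v => E i j * E l m * (phi k' v * K u v j m)) by exact: intgZ.
  rewrite Rintegral_bigsum; last by move=> j; exact: intg_bigsum.
  rewrite mulr_sumr; apply: eq_bigr => j _.
  rewrite Rintegral_bigsum // mulr_sumr; apply: eq_bigr => m _.
  by rewrite RintegralZl; [rewrite mulrCA|by []|exact: iv].
have iu j m : intg mu (fun u => E i j * E l m * (phi k u * \int[mu]_v (phi k' v * K u v j m))).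
  by apply: intgZ; have [] := cov_phi k k' j m.
transitivity (\int[mu]_u \sum_j \sum_m E i j * E l m * (phi k u * \int[mu]_v (phi k' v * K u v j m))).
  by apply: eq_Rintegral => u _; exact: inner.
rewrite Rintegral_bigsum; last by move=> j; exact: intg_bigsum.
rewrite mulmx_congr_entry; apply: eq_bigr => j _.
rewrite Rintegral_bigsum //; apply: eq_bigr => m _.
have [_ j1 _ e] := cov_phi k k' j m.
by rewrite RintegralZl // e mulrAC.
Qed.

Definition Yw (k : R) i (w : T) : R := \sum_j E' i j * Dw k j w.

Lemma Yw_L4 k i : L4 Pr (Yw k i).
Proof. by apply: L4_sum => j; apply: L4Z; exact: Dw_L4. Qed.

Lemma E'E : E' *m E = 1%:M.
Proof. by have := expmxNK H (- ln s); rewrite opprK. Qed.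

Lemma cov_Yw k k' i l : \int[Pr]_w (Yw k i w * Yw k' l w) = Gam (k - k') i l.
Proof.
transitivity (\int[Pr]_w \sum_j \sum_m (E' i j * E' l m) * (Dw k j w * Dw k' m w)).
  apply: eq_Rintegral => w _; rewrite /Yw mulr_suml; apply: eq_bigr => j _.
  by rewrite mulr_sumr; apply: eq_bigr => m _; rewrite mulrACA.
have ijm j m : intg Pr (fun w => (E' i j * E' l m) * (Dw k j w * Dw k' m w)).
  by apply: intgZ; apply: L4_prod2; exact: Dw_L4.
rewrite Rintegral_bigsum; last by move=> j; exact: intg_bigsum.
transitivity ((E' *m (E *m Gam (k - k') *m E^T) *m E'^T) i l); last first.
  by rewrite !mulmxA E'E mul1mx -mulmxA -trmx_mul E'E trmx1 mulmx1.
rewrite mulmx_congr_entry; apply: eq_bigr => j _.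
rewrite Rintegral_bigsum //; apply: eq_bigr => m _.
rewrite RintegralZl //; last by apply: L4_prod2; exact: Dw_L4.
by rewrite cov_Dw mulrAC.
Qed.

Lemma Yw_Wick k1 k2 k3 k4 i1 i2 i3 i4 :
  Wick Pr (Yw k1 i1) (Yw k2 i2) (Yw k3 i3) (Yw k4 i4).
Proof.
have L := Dw_L4; have LY := Yw_L4.
apply: Wick_lin => // j1; apply: Wick_rot.
apply: Wick_lin => // j4; apply: Wick_rot.
apply: Wick_lin => // j3; apply: Wick_rot.
apply: Wick_lin => // j2; exact: Dw_Wick4.
Qed.

(** Of the three pairings in Wick's formula, the one that separates [k] from [k'] is the product of
    the means, which centering cancels. *)
Lemma cov_YwYw k k' i l :
  \int[Pr]_w ((Yw k i w * Yw k l w - Gam 0 i l) * (Yw k' i w * Yw k' l w - Gam 0 i l)) =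
  Gam (k - k') i i * Gam (k - k') l l + Gam (k - k') i l * Gam (k - k') l i.
Proof.
have W := Yw_Wick k k k' k' i l i l; rewrite /Wick in W.
have i4 := L4_prod4 (Yw_L4 k i) (Yw_L4 k l) (Yw_L4 k' i) (Yw_L4 k' l).
have i2 := L4_prod2 (Yw_L4 k i) (Yw_L4 k l).
have i2' := L4_prod2 (Yw_L4 k' i) (Yw_L4 k' l).
set c := Gam 0 i l.
have ic : intg Pr (fun=> c ^+ 2) by exact: L4_intg1 (L4_cst Pr (c ^+ 2)).
have is2 : intg Pr (fun w => Yw k i w * Yw k l w + Yw k' i w * Yw k' l w) by exact: intgD.
have izs : intg Pr (fun w => c * (Yw k i w * Yw k l w + Yw k' i w * Yw k' l w)) by exact: intgZ.
transitivity (\int[Pr]_w ((Yw k i w * Yw k l w * Yw k' i w * Yw k' l w -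
   c * (Yw k i w * Yw k l w + Yw k' i w * Yw k' l w)) + c ^+ 2)).
  by apply: eq_Rintegral => w _; ring.
rewrite RintegralD //; last exact: intgB.
rewrite RintegralB // RintegralZl // RintegralD // Rintegral_cst // [X in fine X](probability_setT Pr) mulr1.
rewrite W !cov_Yw !subrr -/c; ring.
Qed.

Definition What K0 (w : T) : 'M[R]_n := \matrix_(i, l)
  (K0%:R^-1 * \sum_(1 <= k < K0.+1) Yw k%:R i w * Yw k%:R l w).

(** Dominates both pairings of [cov_YwYw] for all [i] and [l] at once, so that every entrywise
    variance is bounded by the same scalar sum over lags. *)
Definition gam (m : nat) : R := 2 * (\sum_a \sum_b `|Gam m%:R a b|) ^+ 2.

Lemma gam_ge0 m : 0 <= gam m.
Proof. by rewrite mulr_ge0 ?sqr_ge0. Qed.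

Lemma Gam_le_gam k k' i l :
  `|Gam (k%:R - k'%:R) i l| <= \sum_a \sum_b `|Gam (absd k k')%:R a b|.
Proof.
have -> : Gam (k%:R - k'%:R) = Gam (absd k k')%:R.
  have [kk|kk] := leqP k k'.
    have -> : absd k k' = (k' - k)%N by rewrite /absd; lia.
    by rewrite natrB // -Gam_opp opprB.
  have -> : absd k k' = (k - k')%N by rewrite /absd; lia.
  by rewrite natrB // ltnW.
rewrite (bigD1 i) //= (bigD1 l) //= -addrA lerDl addr_ge0 //; first exact: sumr_ge0.
by apply: sumr_ge0 => j _; exact: sumr_ge0.
Qed.

Lemma var_What K0 i l : (0 < K0)%N ->
  intg Pr (fun w => (What K0 w i l - Gam 0 i l) ^+ 2) /\ \int[Pr]_w ((What K0 w i l - Gam 0 i l) ^+ 2) <= 2 * (K0%:R^-1 * \sum_(0 <= m < K0) gam m).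
Proof.
move=> K00; have K0n : K0%:R != 0 :> R by rewrite pnatr_eq0 -lt0n.
pose Z k w := Yw k%:R i w * Yw k%:R l w - Gam 0 i l.
have e w : (What K0 w i l - Gam 0 i l) ^+ 2 =
    K0%:R ^- 2 * \sum_(1 <= k < K0.+1) \sum_(1 <= k' < K0.+1) Z k w * Z k' w.
  have -> : What K0 w i l - Gam 0 i l = K0%:R^-1 * \sum_(1 <= k < K0.+1) Z k w.
    rewrite /Z sumrB sumr_const_nat subSS subn0 mxE mulrBr -[Gam 0 i l *+ K0]mulr_natr; congr (_ - _).
    by rewrite mulrCA mulVf ?mulr1.
  rewrite exprMn exprVn; congr (_ * _); rewrite expr2 mulr_suml.
  by apply: eq_bigr => k _; rewrite mulr_sumr.
have iZ k k' : intg Pr (fun w => Z k w * Z k' w).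
  have i4 := L4_prod4 (Yw_L4 k%:R i) (Yw_L4 k%:R l) (Yw_L4 k'%:R i) (Yw_L4 k'%:R l).
  have i2 := L4_prod2 (Yw_L4 k%:R i) (Yw_L4 k%:R l).
  have i2' := L4_prod2 (Yw_L4 k'%:R i) (Yw_L4 k'%:R l).
  pose c := Gam 0 i l.
  have ic : intg Pr (fun=> c ^+ 2) by exact: L4_intg1 (L4_cst Pr (c ^+ 2)).
  have -> : (fun w => Z k w * Z k' w) = (fun w => (Yw k%:R i w * Yw k%:R l w * Yw k'%:R i w * Yw k'%:R l w -
     c * (Yw k%:R i w * Yw k%:R l w + Yw k'%:R i w * Yw k'%:R l w)) + c ^+ 2).
    by apply/funext => w; rewrite /Z -/c; ring.
  by apply: intgD => //; apply: intgB => //; apply: intgZ; exact: intgD.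
have iS : intg Pr (fun w => \sum_(1 <= k < K0.+1) \sum_(1 <= k' < K0.+1) Z k w * Z k' w).
  by apply: intg_bigsum => k; exact: intg_bigsum.
split; first by under [Y in intg _ Y]eq_fun do rewrite e; exact: intgZ.
have -> : \int[Pr]_w ((What K0 w i l - Gam 0 i l) ^+ 2) =
    K0%:R ^- 2 * \sum_(1 <= k < K0.+1) \sum_(1 <= k' < K0.+1) \int[Pr]_w (Z k w * Z k' w).
  transitivity (\int[Pr]_w (K0%:R ^- 2 * \sum_(1 <= k < K0.+1) \sum_(1 <= k' < K0.+1) Z k w * Z k' w)).
    by apply: eq_Rintegral => w _; exact: e.
  rewrite RintegralZl // Rintegral_bigsum; last by move=> k; exact: intg_bigsum.
  by congr (_ * _); apply: eq_bigr => k _; rewrite Rintegral_bigsum.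
apply: le_trans (double_sum_absd_le gam_ge0 K00).
rewrite ler_wpM2l ?invr_ge0 ?exprn_ge0 //.
apply: ler_sum => k _; apply: ler_sum => k' _.
rewrite cov_YwYw; apply: le_trans (ler_norm _) _; apply: le_trans (ler_normD _ _) _.
rewrite !normrM /gam mulr2n mulrDl !mul1r expr2.
by apply: lerD; apply: ler_pM => //; exact: Gam_le_gam.
Qed.
End scale.

Lemma gam_cvg0 : gam @ \oo --> (0 : R).
Proof.
have h1 : (fun m : nat => \sum_a \sum_b `|Gam m%:R a b|) @ \oo --> \sum_(a < n) \sum_(b < n) (0 : R).
  apply: cvg_bigsum => a; apply: cvg_bigsum => b.
  by rewrite -(normr0 R); apply: cvg_norm; exact: Gam_cvg0.
have e0 : \sum_(a < n) \sum_(b < n) (0 : R) = 0 by rewrite big1 // => a _; rewrite big1.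
rewrite e0 in h1.
rewrite -(mulr0 2) -(mulr0 0); apply: cvgM; first exact: cvg_cst.
by rewrite /=; under eq_fun do rewrite expr2; exact: cvgM.
Qed.
End wavelet_process.

(** * Measurability of eigenvalues and nondegeneracy of the limit *)

Section perturbation.
Variables (R : realType) (n : nat).
Local Notation C := R[i].

Lemma rin_le (v : 'rV[C]_n) i j : `|rin (v 0 i) (v 0 j)| <= mxnorm2 v.
Proof.
have le1 m : sqn (v 0 m) <= mxnorm2 v.
  by rewrite mxnorm2_row (bigD1 m) //= lerDl sumr_ge0 // => *; exact: sqn_ge0.
have := le1 i; have := le1 j; rewrite /sqn /rin.
move: (complex.Re (v 0 i)) (complex.Im (v 0 i)) (complex.Re (v 0 j)) (complex.Im (v 0 j)) => a b c e h1 h2.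
have := sqr_ge0 (a - c); have := sqr_ge0 (a + c); have := sqr_ge0 (b - e); have := sqr_ge0 (b + e) => *.
by rewrite ler_norml; apply/andP; split; lra.
Qed.

Lemma qfB (S S' : 'M[R]_n) v : qf S v - qf S' v = \sum_i \sum_j (S i j - S' i j) * rin (v 0 i) (v 0 j).
Proof.
rewrite !qf_rowE -sumrB; apply: eq_bigr => i _; rewrite -sumrB; apply: eq_bigr => j _.
by rewrite mulrBl.
Qed.

Lemma qf_perturb (S S' : 'M[R]_n) v :
  qf S v <= qf S' v + (\sum_i \sum_j `|S i j - S' i j|) * mxnorm2 v.
Proof.
rewrite -lerBlDl qfB mulr_suml; apply: ler_sum => i _; rewrite mulr_suml; apply: ler_sum => j _.
by apply: le_trans (ler_norm _) _; rewrite normrM ler_wpM2l // rin_le.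
Qed.

(** Eigenvalues are Lipschitz for the entrywise l^1 norm, by Weyl's inequality. *)
Lemma lambda_perturb (S S' : 'M[R]_n) (p : 'I_n) : S^T = S -> S'^T = S' ->
  lambda p S <= lambda p S' + \sum_i \sum_j `|S i j - S' i j|.
Proof. by move=> sS sS'; apply: lambda_mono => // v; exact: qf_perturb. Qed.

(* Measurability of an eigenvalue: by Lipschitz continuity, its superlevel sets
   are countable unions of balls centered at rational symmetric matrices. *)
Definition ratsym (M : 'M[rat]_n) : 'M[R]_n :=
  \matrix_(i, j) ratr (if (i <= j)%N then M i j else M j i).

Lemma ratsym_sym M : (ratsym M)^T = ratsym M.
Proof.
apply/matrixP => i j; rewrite !mxE; case: ltngtP => // h.
by rewrite (val_inj h).
Qed.

Lemma ratsym_dense (S : 'M[R]_n) (e : R) : S^T = S -> 0 < e ->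
  exists M, \sum_i \sum_j `|S i j - ratsym M i j| <= e.
Proof.
move=> sS e0.
pose N : R := n%:R * n%:R + 1.
have N0 : 0 < N by rewrite ltr_wpDl // mulr_ge0.
have eN0 : 0 < e / N by rewrite divr_gt0.
have /choice [f hf] : forall ij : 'I_n * 'I_n, exists r : rat, `|S ij.1 ij.2 - ratr r| <= e / N.
  move=> [i j] /=.
  have lt0 : S i j < S i j + e / N by rewrite ltrDl.
  have [r] := rat_in_itvoo lt0.
  by rewrite in_itv /= => /andP[h1 h2]; exists r; rewrite ler_norml; apply/andP; split; lra.
exists (\matrix_(i, j) f (i, j)).
apply: (@le_trans _ _ (\sum_(i < n) \sum_(j < n) (e / N))).
  apply: ler_sum => i _; apply: ler_sum => j _; rewrite mxE; case: ifP => ij; rewrite mxE.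
    exact: (hf (i, j)).
  have -> : S i j = S j i by rewrite -[in LHS]sS mxE.
  exact: (hf (j, i)).
rewrite !sumr_const !card_ord -[X in X <= _]mulr_natr -[e / N *+ n]mulr_natr.
have -> : e = e / N * N by rewrite divfK // lt0r_neq0.
rewrite mulfK ?lt0r_neq0 // -mulrA ler_wpM2l ?(ltW eN0) // /N lerDl //.
Qed.

Lemma measurable_lambda d (T : measurableType d) (W : T -> 'M[R]_n) (p : 'I_n) :
  (forall i j, measurable_fun setT (fun w => W w i j)) -> (forall w, (W w)^T = W w) ->
  measurable_fun setT (fun w => lambda p (W w)).
Proof.
move=> mW sW; apply: (measurability _ (RGenOInfty.measurableE R)) => //.
move=> /= _ [_ [x ->] <-]; rewrite setTI.
pose D M w := \sum_i \sum_j `|W w i j - ratsym M i j|.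
have mD M : measurable_fun setT (D M).
  apply: measurable_sum => i; apply: measurable_sum => j.
  by apply: measurableT_comp => //; exact: measurable_funB.
(* The union runs over the codes of rational matrices. By the Lipschitz bound
   [lambda p (ratsym M) - D M w] never exceeds the eigenvalue at [w], and density brings it
   arbitrarily close. *)
pose F k := if unpickle k is Some M then [set w | x < lambda p (ratsym M) - D M w] else set0.
have key1 (l1 l2 dd z e : R) : l1 <= l2 + dd -> dd <= e -> 0 < e -> z = l1 - 4 * e -> z < l2 - dd.
  by move=> *; lra.
have key2 (l1 l2 dd z : R) : z < l2 - dd -> l2 <= l1 + dd -> z < l1 by move=> *; lra.
have -> : (fun w => lambda p (W w)) @^-1` `]x, +oo[%classic = \bigcup_k F k.
  apply/seteqP; split => w /=.
    rewrite in_itv /= andbT => xl.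
    pose e := (lambda p (W w) - x) / 4.
    have e0 : 0 < e by rewrite divr_gt0 // subr_gt0.
    have [M hM] := ratsym_dense (sW w) e0.
    exists (pickle M) => //; rewrite /F pickleK /= /D.
    have := lambda_perturb p (sW w) (ratsym_sym M).
    move=> h2; apply: (key1 _ _ _ _ _ h2 hM e0); by rewrite /e; field.
  move=> [k _]; rewrite /F; case: unpickle => // M /= h; rewrite in_itv /= andbT.
  have h2 := lambda_perturb p (ratsym_sym M) (sW w).
  have e : \sum_i \sum_j `|ratsym M i j - W w i j| = D M w.
    by apply: eq_bigr => i _; apply: eq_bigr => j _; rewrite distrC.
  by rewrite e in h2; exact: key2 h h2.
apply: bigcupT_measurable => k; rewrite /F; case: unpickle => [M|]; last exact: measurable0.
have mf : measurable_fun setT (fun w => lambda p (ratsym M) - D M w) by exact: measurable_funB.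
rewrite [X in measurable X](_ : _ = (fun w => lambda p (ratsym M) - D M w) @^-1` `]x, +oo[%classic); last first.
  by apply/seteqP; split => w /=; rewrite in_itv /= andbT.
by rewrite -[X in measurable X]setTI; apply: mf.
Qed.

Lemma pd_bounds (S : 'M[R]_n) : S^T = S -> (forall v : 'rV[C]_n, v != 0 -> 0 < qf S v) ->
  exists c1 c2 : R, [/\ 0 < c1, 0 < c2 & forall v, c1 * mxnorm2 v <= qf S v <= c2 * mxnorm2 v].
Proof.
move=> sS S0; have [U [e [U1 SE _]]] := spectral_real sS.
have e0 i : 0 < e i.
  pose v := row i U.
  have vU : v *m adjmx U = delta_mx 0 i by rewrite /v rowE -mulmxA U1 mulmx1.
  have v0 : v != 0.
    apply/eqP => v0; move: vU; rewrite v0 mul0mx => /matrixP /(_ 0 i); rewrite !mxE !eqxx /= => /eqP.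
    by rewrite eq_sym oner_eq0.
  have := S0 v v0; rewrite (qf_spectral SE) vU (bigD1 i) //= big1; last first.
    by move=> k /negbTE ki; rewrite delta_rowE ki /sqn /= expr0n addr0 mulr0.
  by rewrite delta_rowE eqxx /sqn /= expr0n expr1n !addr0 mulr1.
pose c1 := \big[Num.min/1]_i e i.
have c10 : 0 < c1 by rewrite /c1; elim/big_ind: _ => // x y x0 y0; rewrite lt_min x0.
have c1e i : c1 <= e i by rewrite /c1 (bigD1 i) //= ge_min lexx.
pose c2 := 1 + \sum_i e i.
have s0 : 0 <= \sum_i e i by apply: sumr_ge0 => i _; exact: ltW.
have c2e i : e i <= c2.
  by rewrite /c2 (bigD1 i) //= addrCA lerDl addr_ge0 // sumr_ge0 // => j _; exact: ltW.
exists c1, c2; split => //; first by rewrite ltr_wpDr.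
move=> v; rewrite (qf_spectral SE) (mxnorm2_spectral U1 v) !mulr_sumr.
by apply/andP; split; apply: ler_sum => i _; rewrite ler_wpM2r ?sqn_ge0.
Qed.
End perturbation.

(** * Positive definiteness of the limit *)

Section nondegenerate.
Variable R : realType.
Local Notation C := R[i].
Local Notation mu := (@lebesgue_measure R).
Variables (n : nat) (H : 'M[R]_n) (A : 'M[C]_n).
Hypothesis hAre : \rank (map_mx (@complex.Re R) (A *m adjmx A)) = n.
Hypothesis hAim : map_mx (@complex.Im R) (A *m adjmx A) = 0.
Variables (psi : R -> R) (a b : R).
Hypothesis ipsi : intg mu psi.
Hypothesis psi_sq : (\int[mu]_t (psi t ^+ 2)%:E = 1)%E.
Hypothesis supp : forall t, psi t != 0 -> a <= t <= b.
Hypothesis ips : forall i l, intg mu (fun x => psi2 psi x * spec H A x i l).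

Lemma psi2_neq0 : exists x, psi2 psi x != 0.
Proof.
apply: contrapT => /forallNP hn.
have h0 x : Cf psi x = 0 /\ Sf psi x = 0.
  have /negP/negPn := hn x; rewrite /psi2 paddr_eq0 ?sqr_ge0 // !sqrf_eq0.
  by move=> /andP[/eqP -> /eqP ->].
have ae0 := fourier_uniqueness ipsi (fun x => (h0 x).1) (fun x => (h0 x).2) supp.
have mpsi := intg_measurable ipsi.
have : (\int[mu]_t (psi t ^+ 2)%:E = \int[mu]_t (0 : R)%:E)%E.
  apply: ae_eq_integral => //.
    by apply/measurable_EFinP; exact: measurable_funX.
  apply: filterS ae0; first exact: (ae_filter_ringOfSetsType mu).
  by move=> x -> _; rewrite expr0n.
by rewrite psi_sq integral0 => /eqP; rewrite eqe oner_eq0.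
Qed.

(** A zero integral would make the nonnegative integrand vanish almost everywhere; but [psi2] is
    continuous, hence positive on a whole ball, where the density is definite except at 0. *)
Lemma Gam0_pd (v : 'rV[C]_n) : v != 0 -> 0 < qf (Gam H A psi 0) v.
Proof.
move=> v0.
pose f x := psi2 psi x * qf (spec H A x) v.
have p0 x : 0 <= psi2 psi x by rewrite addr_ge0 ?sqr_ge0.
have f0 x : 0 <= f x by rewrite mulr_ge0 // qf_spec_ge0.
have fE x : f x = \sum_i \sum_j rin (v 0 i) (v 0 j) * (psi2 psi x * spec H A x i j).
  rewrite /f qf_rowE mulr_sumr; apply: eq_bigr => i _; rewrite mulr_sumr; apply: eq_bigr => j _.
  by ring.
have ij i j : intg mu (fun x => rin (v 0 i) (v 0 j) * (psi2 psi x * spec H A x i j)) by exact: intgZ.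
have fi : intg mu f.
  have -> : f = fun x => \sum_i \sum_j rin (v 0 i) (v 0 j) * (psi2 psi x * spec H A x i j).
    exact/funext.
  by apply: intg_bigsum => i; exact: intg_bigsum.
have -> : qf (Gam H A psi 0) v = \int[mu]_x f x.
  transitivity (\int[mu]_x \sum_i \sum_j rin (v 0 i) (v 0 j) * (psi2 psi x * spec H A x i j)); last first.
    by apply: eq_Rintegral => x _; rewrite fE.
  rewrite qf_rowE Rintegral_bigsum; last by move=> i; exact: intg_bigsum.
  apply: eq_bigr => i _; rewrite Rintegral_bigsum //; apply: eq_bigr => j _.
  rewrite RintegralZl; [|by []|exact: ips].
  rewrite mulrC mxE; congr (_ * _); apply: eq_Rintegral => x _.
  by rewrite mul0r cos0 mulr1.
rewrite lt_def Rintegral_ge0 ?andbT //; apply/eqP => int0.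
have mf := intg_measurable fi.
have : (\int[mu]_x `|(f x)%:E| = 0)%E.
  transitivity (\int[mu]_x (f x)%:E)%E; last by rewrite intgE // int0.
  by apply: eq_integral => x _; rewrite abse_EFin ger0_norm.
have mfE : measurable_fun setT (EFin \o f) by apply/measurable_EFinP.
have [z1 _] := ae_eq_integral_abs mu measurableT mfE.
move/z1 => [N [mN N0 sub]].
have [x0 hx0] := psi2_neq0.
have cp : continuous (psi2 psi).
  move=> x; rewrite /psi2; apply: cvgD.
    by under eq_fun do rewrite expr2; rewrite expr2; apply: cvgM; exact: continuous_Cf.
  by under eq_fun do rewrite expr2; rewrite expr2; apply: cvgM; exact: continuous_Sf.
have px0 : 0 < psi2 psi x0 by rewrite lt_def hx0 p0.
have : \forall x \near x0, 0 < psi2 psi x.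
  by have := cp x0; move/cvgr_gt; apply.
move=> /nbhs_ballP [e /= e0 hb].
have sb : ball x0 e `<=` N `|` [set 0].
  move=> x xb; have [->|x1] := eqVneq x 0; [by right|left].
  apply: sub => /= h; have := h I => -[] /eqP; rewrite mulf_eq0 => /orP[/eqP h1|/eqP h1].
    by have := hb x xb; rewrite /= h1 ltxx.
  by have := qf_spec_gt0 H hAre hAim x1 v0; rewrite h1 ltxx.
have : (mu (ball x0 e) <= 0)%E.
  apply: (@le_trans _ _ (mu (N `|` [set 0]))).
    apply: le_measure => //; rewrite inE; first exact: measurable_ball.
    by apply: measurableU.
  apply: le_trans (measureU2 _ _ _) _ => //.
  rewrite -[leRHS](adde0 0%E).
  by apply: leeD; rewrite le_eqVlt; apply/orP; left; apply/eqP; [exact: N0|exact: lebesgue_measure_set1].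
by rewrite lebesgue_measure_ball ?(ltW e0) // lee_fin leNgt mulr2n addr_gt0.
Qed.
End nondegenerate.

(** * Consistency *)

Section scaled_integral.
Context {d : measure_display} {T : measurableType d} {R : realType}.
Variable mu : {measure set T -> \bar R}.

(* No integrability is needed, unlike in [RintegralZl]. *)
Lemma Rintegral_gt0Zl (c : R) (f : T -> R) : 0 < c -> measurable_fun setT f ->
  \int[mu]_x (c * f x) = c * \int[mu]_x f x.
Proof.
move=> c0 mf; have mfE : measurable_fun setT (EFin \o f) by apply/measurable_EFinP.
rewrite /Rintegral integralE [in RHS]integralE.
have -> : (fun x => (c * f x)%:E) = (fun x => c%:E * (EFin \o f) x)%E by [].
rewrite ge0_funeposM ?ge0_funenegM ?(ltW c0) //.
rewrite !ge0_integralZl ?lee_fin ?(ltW c0) //;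
  [|exact: measurable_funeneg|exact: measurable_funepos].
move: (integral _ _ _) (integral _ _ _) => [p| |] [q| |] //=;
  by rewrite ?gt0_muley ?gt0_muleNy ?lte_fin //= ?mulr0 ?mulrBr.
Qed.

Lemma markov_ge (Q : T -> R) (b : R) : intg mu Q -> (forall w, 0 <= Q w) -> 0 < b ->
  (mu [set w | (b <= Q w)%R] <= (b^-1 * \int[mu]_w Q w)%:E)%E.
Proof.
move=> iQ Q0 b0.
have mQ : measurable_fun setT (EFin \o Q) by apply/measurable_EFinP; exact: intg_measurable iQ.
have := le_integral_abse mu measurableT mQ b0.
have -> : (\int[mu]_x `|(EFin \o Q) x| = (\int[mu]_w Q w)%:E)%E.
  by rewrite -intgE //; apply: eq_integral => w _; rewrite /= ger0_norm.
rewrite setTI (_ : [set x | _] = [set w | (b <= Q w)%R]); last first.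
  by apply/seteqP; split => w /=; rewrite lee_fin ger0_norm.
move=> h; rewrite EFinM lee_pdivlMl //.
Qed.
End scaled_integral.

(** * Logarithmic asymptotics along the admissible sample sizes *)

Section asymptotics.
Variable R : realType.

(** Half of the error [e] is the loss in the exponent. The other half absorbs the constants and the
    octave shift [J], whose logarithmic contribution is at most [S], hence at most e ln(a) beyond
    [Y0]. *)
Lemma log_ratio_bounds (b1 b2 h J e : R) : 0 < b1 -> 0 < b2 -> 0 < e ->
  exists Y0, 0 < Y0 /\ forall a l : R, Y0 <= ln a ->
    b1 * expR (2 * (h - e / 2) * (ln a + J)) <= l ->
    l <= b2 * expR (2 * (h + e / 2) * (ln a + J)) -> `|log_ratio l a - h| <= e.
Proof.
move=> b10 b20 e0.
pose S := `|ln b1 + 2 * (h - e / 2) * J| + `|ln b2 + 2 * (h + e / 2) * J|.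
have S0 : 0 <= S by rewrite addr_ge0.
exists (S / e + 1); split; first by rewrite ltr_wpDl // divr_ge0 // ltW.
move=> a l ya l1 l2; set y := ln a in ya l1 l2 *.
have y0 : 0 < y by apply: lt_le_trans ya; rewrite ltr_wpDl // divr_ge0 // ltW.
have l0 : 0 < l by apply: lt_le_trans l1; rewrite mulr_gt0 ?expR_gt0.
have L1 : ln b1 + 2 * (h - e / 2) * (y + J) <= ln l.
  rewrite -[X in _ + X](expRK) -lnM ?posrE ?expR_gt0 //.
  by rewrite ler_ln ?posrE // mulr_gt0 ?expR_gt0.
have L2 : ln l <= ln b2 + 2 * (h + e / 2) * (y + J).
  rewrite -[X in _ + X](expRK) -lnM ?posrE ?expR_gt0 //.
  by rewrite ler_ln ?posrE // mulr_gt0 ?expR_gt0.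
have Sy : S <= e * y.
  by rewrite -ler_pdivrMl // mulrC; apply: le_trans ya; rewrite lerDl.
have N1 : `|ln b1 + 2 * (h - e / 2) * J| <= e * y.
  by apply: le_trans Sy; rewrite /S lerDl.
have N2 : `|ln b2 + 2 * (h + e / 2) * J| <= e * y.
  by apply: le_trans Sy; rewrite /S lerDr.
move: N1 N2; rewrite !ler_norml => /andP[N1 _] /andP[_ N2].
have -> : log_ratio l a - h = (ln l - 2 * h * y) / (2 * y).
  rewrite /log_ratio -/y; field; exact: lt0r_neq0.
have y2 : 0 < 2 * y by rewrite mulr_gt0.
rewrite ler_pdivlMr // ler_pdivrMr //.
move: (ln l) (ln b1) (ln b2) L1 L2 N1 N2 => u v w L1 L2 N1 N2.
by apply/andP; split; nra.
Qed.

Section scaling.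
Variables (n : nat) (H : 'M[R]_n) (a : nat -> nat) (j : nat).
Hypothesis ha : is_scaling_factor H a j.

Lemma nu_infty_filter : Filter (nu_infty a j).
Proof. exact: within_filter. Qed.
Let FF := nu_infty_filter.

Lemma near_sample : \forall nu \near nu_infty a j, sample_sizes a j nu.
Proof. exact: withinT. Qed.

Lemma near_ge N : \forall nu \near nu_infty a j, (N <= nu)%N.
Proof. by apply: cvg_within; exists N. Qed.

Lemma scaling_gt0 nu : sample_sizes a j nu -> (0 < a nu)%N.
Proof. by move=> /(scaling_pow2 ha) [m ->]; rewrite expn_gt0. Qed.

Lemma near_mean_small (e : R) : 0 < e -> \forall nu \near nu_infty a j,
  (a nu)%:R / nu%:R < e /\ nu%:R / (a nu)%:R `^ (1 + 2 * varpi0 H) < e.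
Proof.
move=> e0; have := cvgr_lt _ (scaling_cvg ha) e e0; move=> /(_ FF).
apply: (@filterS _ _ FF) => nu h.
have t1 : 0 <= (a nu)%:R / nu%:R :> R by rewrite divr_ge0.
have t2 : 0 <= nu%:R / (a nu)%:R `^ (1 + 2 * varpi0 H) :> R by rewrite divr_ge0 ?powR_ge0.
by split; apply: le_lt_trans h; rewrite ?lerDl ?lerDr.
Qed.

(** The second term of the scaling condition at work: once it is below 1, nu is less than a^p, so a
    bound on [a nu] would bound nu. The absolute value of p in [c] makes the power monotone in the
    base. *)
Lemma near_scale_ge (A0 : R) : \forall nu \near nu_infty a j, A0 <= (a nu)%:R.
Proof.
pose p := 1 + 2 * varpi0 H; pose c := Num.max 1 A0 `^ `|p|.
have c0 : 0 < c by rewrite powR_gt0 // lt_max ltr01.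
have [N cN] : exists N : nat, c <= N%:R.
  by exists (Num.bound c); apply: ltW; apply: archi_boundP; exact: ltW.
have h1 := near_mean_small ltr01; have h2 := near_sample; have h3 := near_ge N.
have := @filterI _ _ FF _ _ h1 (@filterI _ _ FF _ _ h2 h3); apply: (@filterS _ _ FF) => nu [[_ h] [sn Nn]].
rewrite leNgt; apply/negP => aA.
have a1 : 1 <= (a nu)%:R :> R by rewrite ler1n scaling_gt0.
have pc : (a nu)%:R `^ p <= c.
  apply: (@le_trans _ _ ((a nu)%:R `^ `|p|)); first by rewrite ler_powR // ler_norm.
  by rewrite ge0_ler_powR // ?nnegrE ?le_max ?ler01 // (ltW aA) orbT.
have ap : 0 < (a nu)%:R `^ p by rewrite powR_gt0 // (lt_le_trans ltr01).
move: h; rewrite -/p ltr_pdivrMr // mul1r ltNge => /negP; apply.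
by apply: le_trans pc _; apply: le_trans cN _; rewrite ler_nat.
Qed.

(** The first term of the scaling condition at work: the number of blocks is nu / a up to the fixed
    factor 2^j. *)
Lemma near_blocks_ge (K0 : nat) : \forall nu \near nu_infty a j, (K0 <= nu %/ (a nu * 2 ^ j))%N.
Proof.
have e0 : 0 < (K0.+1%:R * 2 ^+ j)^-1 :> R by rewrite invr_gt0 mulr_gt0 ?exprn_gt0.
have := @filterI _ _ FF _ _ (near_mean_small e0) near_sample.
apply: (@filterS _ _ FF) => nu [[h _] sn]; have [nu0 dv] := sn.
have a0 := scaling_gt0 sn.
rewrite leq_divRL ?muln_gt0 ?a0 ?expn_gt0 //.
rewrite -(@ler_nat R) !natrM natrX.
move: h; rewrite ltr_pdivrMr ?ltr0n // ltr_pdivlMl ?mulr_gt0 ?exprn_gt0 // => /ltW h.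
apply: le_trans h; set x := (a nu)%:R; set y := 2 ^+ j.
have xy : 0 <= y * x by rewrite mulr_ge0 ?exprn_ge0.
by rewrite -[K0.+1]addn1 natrD -mulrA [x * y]mulrC mulrDl mul1r lerDl.
Qed.

Lemma cvg_blocks : (fun nu => nu %/ (a nu * 2 ^ j))%N @ nu_infty a j --> \oo.
Proof.
move=> S [N _ hN]; have := near_blocks_ge N.
by apply: (@filterS _ _ FF) => nu h; apply: hN.
Qed.
End scaling.
End asymptotics.

(** * Wavelet matrices as congruences of normalized ones *)

Section wavelet_matrices.
Context {R : realType} {d : measure_display} {T : measurableType d}.
Local Notation C := R[i].
Local Notation mu := (@lebesgue_measure R).
Variables (Pr : probability T R) (n : nat) (H : 'M[R]_n) (A : 'M[C]_n)
  (X : R -> T -> 'cV[R]_n).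
Hypothesis hX : is_ofbm H A Pr X.
Hypothesis hXm : measurable_process X.
Hypothesis hAre : \rank (map_mx (@complex.Re R) (A *m adjmx A)) = n.
Hypothesis hAim : map_mx (@complex.Im R) (A *m adjmx A) = 0.
Variables (n' : nat) (h : 'I_n' -> C) (sz : 'I_n' -> nat)
  (hsz : (\sum_(i < n') sz i)%N = n) (P : 'M[C]_n).
Hypothesis uP : P \in unitmx.
Hypothesis HJ : cplxmx H =
     P *m castmx (hsz, hsz) (\mxdiag_(i < n') Jordan_block (h i) (sz i)) *m invmx P.
Hypothesis h01 : forall i, 0 < complex.Re (h i) < 1.
Variables (psi : R -> R) (L0 : R).
Hypothesis ipsi : intg mu psi.
Hypothesis psi0 : \int[mu]_t psi t = 0.
Hypothesis supp : forall t, psi t != 0 -> `|t| <= L0.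

(** An identity for every outcome, not only almost surely: the substitution and the extraction of
    positive factors rely on measurability of the path, so divergent integrals are covered. *)
Lemma wavelet_coefE (s : R) (k : nat) w i : 0 < s ->
  wavelet_coef psi X s k%:Z w i 0 = Dw X psi s k%:R i w.
Proof.
move=> s0; rewrite mxE /Dw.
have r0 : 0 < (Num.sqrt s)^-1 by rewrite invr_gt0 sqrtr_gt0.
have mX : measurable_fun [set: R] (fun t => X t w i 0).
  exact: (measurableT_comp (hXm i) (measurable_pair2 w)).
have mpsi := intg_measurable ipsi.
have mp : measurable_fun [set: R] (fun t => psi (s^-1 * t - k%:R)).
  by apply: (measurableT_comp mpsi); apply: measurable_funB => //; exact: measurable_funM.
have mf : measurable_fun [set: R] (fun t => (Num.sqrt s)^-1 * psi (s^-1 * t - k%:R) * X t w i 0).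
  by apply: measurable_funM => //; exact: measurable_funM.
rewrite (@Rintegral_affine R s 0 s0) //.
have mX' : measurable_fun [set: R] (fun u => X (s * u) w i 0).
  by apply: (measurableT_comp mX); exact: measurable_funM.
have mphi : measurable_fun [set: R] (fun u => phi psi k%:R u * X (s * u) w i 0).
  by apply: measurable_funM => //; exact: (intg_measurable (intg_phi ipsi k%:R)).
transitivity ((Num.sqrt s)^-1 * (s * \int[mu]_u ((Num.sqrt s)^-1 * (phi psi k%:R u * X (s * u) w i 0)))).
  congr (_ * (_ * _)); apply: eq_Rintegral => u _.
  by rewrite addr0 mulKf ?gt_eqF // -mulrA.
rewrite Rintegral_gt0Zl // !mulrA.
have -> : (Num.sqrt s)^-1 * s * (Num.sqrt s)^-1 = 1; last by rewrite mul1r.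
by rewrite -{2}(sqr_sqrtr (ltW s0)); field; rewrite gt_eqF // sqrtr_gt0.
Qed.

Lemma wavelet_varE (nu s : nat) w i l : (0 < s)%N ->
  wavelet_var psi X nu s w i l = (nu %/ s)%:R^-1 *
    \sum_(1 <= k < (nu %/ s).+1) Dw X psi s%:R k%:R i w * Dw X psi s%:R k%:R l w.
Proof.
move=> s0; rewrite /wavelet_var mxE summxE; congr (_ * _); apply: eq_bigr => k _.
by rewrite mxE big_ord_recl big_ord0 addr0 [(_^T) _ _]mxE !wavelet_coefE // ltr0n.
Qed.

Lemma wavelet_var_sym nu s w : (wavelet_var psi X nu s w)^T = wavelet_var psi X nu s w.
Proof.
rewrite /wavelet_var linearZ /= linear_sum /=; congr (_ *: _); apply: eq_bigr => k _.
by rewrite trmx_mul trmxK.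
Qed.

Lemma wavelet_var_What (nu s : nat) w : (0 < s)%N ->
  let E := expmx (ln s%:R *: H) in
  wavelet_var psi X nu s w = E *m What H X psi s%:R (nu %/ s) w *m E^T.
Proof.
move=> s0 E; pose E' := expmx (- ln s%:R *: H).
have EE : E *m E' = 1%:M by exact: expmxNK.
have -> : What H X psi s%:R (nu %/ s) w = E' *m wavelet_var psi X nu s w *m E'^T.
  apply/matrixP => i l; rewrite mulmx_congr_entry mxE.
  under [RHS]eq_bigr do under eq_bigr do rewrite wavelet_varE // mulrCA -mulrA.
  under [RHS]eq_bigr do rewrite -mulr_sumr.
  rewrite -mulr_sumr; congr (_ * _).
  under [RHS]eq_bigr do under eq_bigr do rewrite mulr_sumr mulr_suml.
  under [RHS]eq_bigr do rewrite exchange_big /=.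
  rewrite exchange_big /=; apply: eq_bigr => k _.
  rewrite /Yw mulr_suml; apply: eq_bigr => a _; rewrite mulr_sumr; apply: eq_bigr => b _.
  by rewrite -/E'; ring.
by rewrite !mulmxA EE mul1mx -mulmxA -trmx_mul EE trmx1 mulmx1.
Qed.

Lemma measurable_wavelet_var (nu s : nat) i l : (0 < s)%N ->
  measurable_fun setT (fun w => wavelet_var psi X nu s w i l).
Proof.
move=> s0; under eq_fun do rewrite wavelet_varE //.
apply: measurable_funM => //; apply: measurable_sum => k.
have s0' : 0 < s%:R :> R by rewrite ltr0n.
have L m := Dw_L4 hX hXm hAim uP HJ h01 ipsi supp s0' k%:R m.
by apply: measurable_funM; case: (L i); case: (L l).
Qed.

Lemma mx_expectation_wavelet_var (nu s : nat) : (0 < s)%N -> (0 < nu %/ s)%N ->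
  let E := expmx (ln s%:R *: H) in
  mx_expectation Pr (wavelet_var psi X nu s) = E *m Gam H A psi 0 *m E^T.
Proof.
move=> s0 K0 E; apply/matrixP => i l; rewrite mxE unlock.
have s0' : 0 < s%:R :> R by rewrite ltr0n.
have L k m := Dw_L4 hX hXm hAim uP HJ h01 ipsi supp s0' k m.
set K := (nu %/ s)%N in K0 *.
transitivity (\int[Pr]_w (K%:R^-1 * \sum_(1 <= k < K.+1) Dw X psi s%:R k%:R i w * Dw X psi s%:R k%:R l w)).
  by apply: eq_Rintegral => w _; rewrite wavelet_varE.
have ik k : intg Pr (fun w => Dw X psi s%:R k i w * Dw X psi s%:R k l w) by exact: L4_prod2.
rewrite RintegralZl //; last by apply: intg_bigsum => k; exact: ik.
rewrite Rintegral_bigsum; last by move=> k; exact: ik.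
under eq_bigr do rewrite (cov_Dw hX hXm hAim uP HJ h01 ipsi psi0 supp s0') subrr.
rewrite sumr_const_nat subSS subn0 -/E -[X in _ * X]mulr_natr mulrCA mulVf ?mulr1 //.
by rewrite pnatr_eq0 -lt0n.
Qed.
End wavelet_matrices.

Lemma half_perturbation (R : realFieldType) (x y z z2 t : R) :
  z <= y -> y <= z2 -> x <= y + t -> y <= x + t -> t <= z / 2 -> 0 <= z ->
  z / 2 <= x <= z2 + z.
Proof. by move=> *; apply/andP; split; lra. Qed.

(** * Convergence of the log-eigenvalues *)

Section consistency.
Context {R : realType} {d : measure_display} {T : measurableType d}.
Local Notation C := R[i].
Local Notation mu := (@lebesgue_measure R).
Variables (Pr : probability T R) (n : nat) (H : 'M[R]_n) (A : 'M[C]_n)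
  (X : R -> T -> 'cV[R]_n).
Hypothesis hX : is_ofbm H A Pr X.
Hypothesis hXm : measurable_process X.
Hypothesis hAre : \rank (map_mx (@complex.Re R) (A *m adjmx A)) = n.
Hypothesis hAim : map_mx (@complex.Im R) (A *m adjmx A) = 0.
Variables (n' : nat) (h : 'I_n' -> C) (sz : 'I_n' -> nat)
  (hsz : (\sum_(i < n') sz i)%N = n) (P : 'M[C]_n).
Hypothesis uP : P \in unitmx.
Hypothesis HJ : cplxmx H =
     P *m castmx (hsz, hsz) (\mxdiag_(i < n') Jordan_block (h i) (sz i)) *m invmx P.
Hypothesis h01 : forall i, 0 < complex.Re (h i) < 1.
Hypothesis h_le : forall i1 i2 : 'I_n', (i1 <= i2)%N -> complex.Re (h i1) <= complex.Re (h i2).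
Variables (psi : R -> R) (N : nat) (alpha : R).
Hypothesis hpsi : is_wavelet psi N alpha.
Variables (j : nat) (a : nat -> nat).
Hypothesis ha : is_scaling_factor H a j.

Let s nu := (a nu * 2 ^ j)%N.
Let W nu := wavelet_var psi X nu (s nu).
Let G0 := Gam H A psi 0.

Let ipsi : intg mu psi. Proof. exact: wavelet_L1 hpsi. Qed.

Let psi0 : \int[mu]_t psi t = 0.
Proof.
have h0 := @wavelet_moments _ _ _ _ hpsi 0 (ltnW (wavelet_N hpsi)).
transitivity (fine (\int[mu]_t (t ^+ 0 * psi t)%:E)%E); last by rewrite h0.
by congr fine; apply: eq_integral => t _; rewrite expr0 mul1r.
Qed.

Let supp2 : exists ab : R * R, forall t, psi t != 0 -> ab.1 <= t <= ab.2.
Proof.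
have [b [c hbc]] := wavelet_supp hpsi; exists (b, c) => t t0 /=.
have : closure [set t | psi t != 0] t by exact: subset_closure.
by rewrite hbc /= in_itv.
Qed.

Let supp : exists L0, forall t, psi t != 0 -> `|t| <= L0.
Proof.
have [[b c] hbc] := supp2; exists (`|b| + `|c|) => t /hbc /= /andP[bt tc].
have := ler_norm c; have := ler_norm (- b); rewrite normrN.
have := normr_ge0 b; have := normr_ge0 c => *.
by rewrite ler_norml; apply/andP; split; lra.
Qed.

Let G0_bounds : exists c1 c2 : R,
  [/\ 0 < c1, 0 < c2 & forall v, c1 * mxnorm2 v <= qf G0 v <= c2 * mxnorm2 v].
Proof.
have [L0 hL] := supp; have [[b c] hbc] := supp2.
apply: pd_bounds; first exact: Gam_sym.
move=> v v0; apply: (Gam0_pd hAre hAim ipsi (wavelet_norm hpsi) hbc) => // i l.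
exact: (intg_psi2_spec hX hAim uP HJ h01 ipsi psi0 hL i l).
Qed.

Variables (q : 'I_n) (q' : 'I_n').
Hypothesis hqq : (\sum_(i < n' | (i < q')%N) sz i < q.+1 <= \sum_(i < n' | (i <= q')%N) sz i)%N.

(** The deterministic core shared by both limits: [S] is [G0] itself for the expectation, and the
    normalized sample variance on an event of high probability. A distance of at most c1 / 2 keeps
    half of the lower bound of [G0]. *)
Let log_ratio_near (e : R) : 0 < e -> exists2 b : R, 0 < b & exists Y0 : R, forall nu S,
  sample_sizes a j nu -> Y0 <= (a nu)%:R -> S^T = S ->
  (\sum_i \sum_l `|S i l - G0 i l| <= b) ->
  `|log_ratio (lambda q (expmx (ln (s nu)%:R *: H) *m S *m (expmx (ln (s nu)%:R *: H))^T)) (a nu)%:R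
    - complex.Re (h q')| <= e.
Proof.
move=> e0; have [c1 [c2 [c10 c20 hc]]] := G0_bounds.
have e20 : 0 < e / 2 by rewrite divr_gt0.
have [Kg Kg0 hK] := lambda_growth uP HJ h_le e20.
have b10 : 0 < c1 / 2 / Kg by rewrite !divr_gt0.
have b20 : 0 < (c2 + c1) * Kg by rewrite mulr_gt0 // addr_gt0.
have [Y0 [Y00 hY]] := log_ratio_bounds (complex.Re (h q')) (ln 2 *+ j) b10 b20 e0.
exists (c1 / 2); first by rewrite divr_gt0.
exists (expR Y0) => nu S sn aY sS dS.
have a0 : (0 < a nu)%N := scaling_gt0 ha sn.
have aR : 0 < (a nu)%:R :> R by rewrite ltr0n.
have lnY : Y0 <= ln (a nu)%:R by rewrite -(expRK Y0) ler_ln ?posrE ?expR_gt0.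
have lns : ln (s nu)%:R = ln (a nu)%:R + ln 2 *+ j :> R.
  by rewrite natrM natrX lnM ?posrE ?exprn_gt0 // lnXn.
have t0 : 0 <= ln (s nu)%:R :> R by rewrite ln_ge0 // ler1n muln_gt0 a0 expn_gt0.
have bS v : c1 / 2 * mxnorm2 v <= qf S v <= (c2 + c1) * mxnorm2 v.
  have /andP[h1 h2] := hc v.
  have v0 := mxnorm2_ge0 v.
  have p1 := qf_perturb S G0 v; have p2 := qf_perturb G0 S v.
  have e1 : \sum_i \sum_l `|G0 i l - S i l| = \sum_i \sum_l `|S i l - G0 i l|.
    by apply: eq_bigr => i _; apply: eq_bigr => l _; rewrite distrC.
  rewrite e1 in p2.
  have p3 : (\sum_i \sum_l `|S i l - G0 i l|) * mxnorm2 v <= c1 / 2 * mxnorm2 v by rewrite ler_wpM2r.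
  have p4 : 0 <= c1 * mxnorm2 v by rewrite mulr_ge0 // ltW.
  have half : c1 / 2 * mxnorm2 v = (c1 * mxnorm2 v) / 2 by rewrite mulrAC.
  rewrite half in p3 *; rewrite mulrDl.
  exact: half_perturbation h1 h2 p1 p2 p3 p4.
have c120 : 0 <= c1 / 2 by rewrite divr_ge0 // ltW.
have c210 : 0 <= c2 + c1 by rewrite addr_ge0 // ltW.
have /andP[l1 l2] := hK q q' hqq (ln (s nu)%:R) S (c1 / 2) (c2 + c1) t0 sS c120 c210 bS.
by apply: hY => //; rewrite -lns.
Qed.

Let FF := nu_infty_filter a j.

Let s_gt0 nu : sample_sizes a j nu -> (0 < s nu)%N.
Proof. by move=> /(scaling_gt0 ha) a0; rewrite muln_gt0 a0 expn_gt0. Qed.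

Lemma log_eigenvalue_EW_cvg :
  (fun nu => log_ratio (lambda q (mx_expectation Pr (W nu))) (a nu)%:R) @ nu_infty a j
    --> complex.Re (h q').
Proof.
have [L0 hL] := supp.
apply/(@cvgrPdist_le _ _ _ _ FF) => /= e e0.
have [b b0 [Y0 hY]] := log_ratio_near e0.
have n1 := near_sample a j; have n2 := near_scale_ge ha Y0; have n3 := near_blocks_ge ha 1.
apply: (@filterS _ _ FF) (@filterI _ _ FF _ _ n1 (@filterI _ _ FF _ _ n2 n3)) => nu [sn [aY K1]].
rewrite distrC (mx_expectation_wavelet_var hX hXm hAim uP HJ h01 ipsi psi0 hL (s_gt0 sn) K1).
apply: hY => //; first exact: Gam_sym.
rewrite big1 ?(ltW b0) // => i _; rewrite big1 // => l _.
by rewrite subrr normr0.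
Qed.

(** Chebyshev's argument: a deviation above [e] forces the normalized sample variance away from
    [G0], and the probability of this is bounded by its mean-square error, which tends to 0 with the
    number of blocks growing. *)
Lemma log_eigenvalue_W_cvg : cvg_in_probability Pr (nu_infty a j)
  (fun nu w => log_ratio (lambda q (W nu w)) (a nu)%:R) (complex.Re (h q')).
Proof.
have [L0 hL] := supp.
move=> e e0; have [b b0 [Y0 hY]] := log_ratio_near e0.
(* If the sum of squared errors is below b' = (b / M)^2, each entry errs by at most b / M and the
   l^1 distance is at most n^2 b / M <= b. The added 1 keeps [M] positive. *)
pose M : R := n%:R * n%:R + 1.
have M0 : 0 < M by rewrite ltr_wpDl // mulr_ge0.
pose b' := (b / M) ^+ 2.
have b'0 : 0 < b' by rewrite exprn_gt0 // divr_gt0.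
pose mean K : R := K%:R^-1 * \sum_(0 <= m < K) gam H A psi m.
pose u nu := b'^-1 * (n%:R * (n%:R * (2 * mean (nu %/ s nu)%N))).
have u0 : u @ nu_infty a j --> (0 : R).
  have m0 : mean @ \oo --> (0 : R).
    apply: cvg_mean; exact: (gam_cvg0 hX hAim uP HJ h01 ipsi psi0 hL).
  have mK : (fun nu => mean (nu %/ s nu)%N) @ nu_infty a j --> (0 : R).
    exact: (cvg_comp _ _ (cvg_blocks ha) m0).
  have z : (0 : R) = b'^-1 * (n%:R * (n%:R * (2 * 0))) by rewrite !mulr0.
  rewrite /u; rewrite [X in _ --> X]z.
  by do 4! (apply: (@cvgMr _ _ _ FF)).
apply: (@squeeze_cvge _ _ FF _ (cst 0%E) _ (fun nu => (u nu)%:E)).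
- have n1 := near_sample a j; have n2 := near_scale_ge ha Y0; have n3 := near_blocks_ge ha 1.
  apply: (@filterS _ _ FF) (@filterI _ _ FF _ _ n1 (@filterI _ _ FF _ _ n2 n3)) => nu [sn [aY K1]].
  have s0 := s_gt0 sn.
  have s0' : 0 < (s nu)%:R :> R by rewrite ltr0n.
  set K := (nu %/ s nu)%N in K1 *.
  pose D i l w := (What H X psi (s nu)%:R K w i l - G0 i l) ^+ 2.
  have [iD vD] : (forall i l, intg Pr (D i l)) /\
      (forall i l, \int[Pr]_w D i l w <= 2 * mean K).
    have v i l := var_What hX hXm hAre hAim uP HJ h01 ipsi psi0 hL s0' i l K1.
    by split=> i l; case: (v i l).
  pose Q w := \sum_i \sum_l D i l w.
  have Q0 w : 0 <= Q w by apply: sumr_ge0 => i _; apply: sumr_ge0 => l _; exact: sqr_ge0.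
  have iQ : intg Pr Q by apply: intg_bigsum => i; exact: intg_bigsum.
  have vQ : \int[Pr]_w Q w <= n%:R * (n%:R * (2 * mean K)).
    rewrite Rintegral_bigsum; last by move=> i; exact: intg_bigsum.
    have -> : n%:R * (n%:R * (2 * mean K)) = \sum_(i < n) \sum_(l < n) (2 * mean K).
      by rewrite !sumr_const !card_ord !mulr_natl.
    by apply: ler_sum => i _; rewrite Rintegral_bigsum //; apply: ler_sum => l _.
  have mW : measurable_fun setT (fun w => lambda q (W nu w)).
    apply: measurable_lambda => [i l|w]; last exact: wavelet_var_sym.
    exact: (measurable_wavelet_var hX hXm hAim uP HJ h01 ipsi hL nu i l s0).
  have mZ : measurable_fun setT (fun w => `|log_ratio (lambda q (W nu w)) (a nu)%:R - complex.Re (h q')|).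
    apply: measurableT_comp => //; apply: measurable_funB => //.
    apply: measurable_funM => //; exact: (measurableT_comp (@measurable_ln R) mW).
  have mset (f : T -> R) (c : R) : measurable_fun setT f -> measurable [set w | c < f w].
    move=> mf; rewrite [X in measurable X](_ : _ = f @^-1` `]c, +oo[%classic); last first.
      by apply/seteqP; split => w /=; rewrite in_itv /= andbT.
    by rewrite -[X in measurable X]setTI; apply: mf.
  have msetc (f : T -> R) (c : R) : measurable_fun setT f -> measurable [set w | c <= f w].
    move=> mf; rewrite [X in measurable X](_ : _ = f @^-1` `[c, +oo[%classic); last first.
      by apply/seteqP; split => w /=; rewrite in_itv /= andbT.
    by rewrite -[X in measurable X]setTI; apply: mf.
  rewrite measure_ge0 /=.
  apply: (@le_trans _ _ (Pr [set w | b' <= Q w])).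
    apply: le_measure; rewrite ?inE; [exact: mset|apply: msetc; exact: intg_measurable iQ|].
    move=> w /= ew; rewrite leNgt; apply/negP => Qb; move: ew; apply/negP; rewrite -leNgt.
    rewrite /W (wavelet_var_What H hXm ipsi nu w s0); apply: hY => //.
      by apply/matrixP => i l; rewrite !mxE; congr (_ * _); apply: eq_bigr => k _; rewrite mulrC.
    have Dle i l : `|What H X psi (s nu)%:R K w i l - G0 i l| <= b / M.
      rewrite -(@ler_pXn2r _ 2) ?nnegrE // ?divr_ge0 ?(ltW b0) ?(ltW M0) //.
      rewrite -normrX ger0_norm ?sqr_ge0 // ltW //; apply: le_lt_trans Qb.
      rewrite /Q (bigD1 i) //= (bigD1 l) //= -/(D i l w) -addrA lerDl addr_ge0 //.
        by apply: sumr_ge0 => *; exact: sqr_ge0.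
      by apply: sumr_ge0 => *; apply: sumr_ge0 => *; exact: sqr_ge0.
    apply: (@le_trans _ _ (\sum_(i < n) \sum_(l < n) (b / M))).
      by apply: ler_sum => i _; apply: ler_sum => l _.
    rewrite !sumr_const !card_ord -[X in X <= _]mulr_natr -[b / M *+ n]mulr_natr.
    have -> : b = b / M * M by rewrite divfK // lt0r_neq0.
    by rewrite mulfK ?lt0r_neq0 // -mulrA ler_wpM2l ?divr_ge0 ?(ltW b0) ?(ltW M0) // /M lerDl.
  apply: le_trans (markov_ge iQ Q0 b'0) _.
  by rewrite lee_fin ler_wpM2l // invr_ge0 ltW.
- exact: cvg_cst.
- by apply: cvg_EFin => //; apply: nearW.
Qed.
End consistency.

Lemma block_size1 n n' (sz : 'I_n' -> nat) : (forall i, (0 < sz i)%N) ->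
  (\sum_(i < n') sz i)%N = n -> n' = n -> forall i, sz i = 1%N.
Proof.
move=> s0 sn nn i.
have : (\sum_(i < n') (sz i - 1) = 0)%N.
  rewrite sumnB //= sn sum1_card card_ord nn subnn //.
move/eqP; rewrite sum_nat_eq0 => /forallP /(_ i) /implyP /(_ isT) /eqP.
have := s0 i; by case: (sz i) => // m _; rewrite subSS subn0 => ->.
Qed.

Lemma sum_ord_lt n' k : (k <= n')%N -> (\sum_(i < n' | (i < k)%N) 1 = k)%N.
Proof.
by move=> kn; rewrite (big_ord_narrow kn) sum1_card card_ord.
Qed.
Theorem theorem3p1
  (R : realType) (d : measure_display) (T : measurableType d)
  (Pr : probability T R)
  (n : nat) (hn : (2 <= n)%N)
  (H : 'M[R]_n) (A : 'M[R[i]]_n) (B : R -> T -> 'cV[R]_n)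
  (hB : is_ofbm H A Pr B) (hBmeas : measurable_process B)
  (hAre : \rank (map_mx (@complex.Re R) (A *m adjmx A)) = n)
  (hAim : map_mx (@complex.Im R) (A *m adjmx A) = 0)
  (n' : nat) (hn' : (1 <= n' <= n)%N)
  (h : 'I_n' -> R[i]) (sz : 'I_n' -> nat)
  (hsz_gt0 : forall i, (0 < sz i)%N)
  (hsz : (\sum_(i < n') sz i)%N = n)
  (hRe01 : forall i, 0 < complex.Re (h i) < 1)
  (hRe_le : forall i1 i2 : 'I_n', (i1 <= i2)%N ->
     complex.Re (h i1) <= complex.Re (h i2))
  (P : 'M[R[i]]_n) (hPunit : P \in unitmx)
  (hPnorm : forall k : 'I_n, mxnorm2 (col k P) = 1)
  (hJordan : cplxmx H =
     P *m castmx (hsz, hsz) (\mxdiag_(i < n') Jordan_block (h i) (sz i))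
       *m invmx P)
  (psi : R -> R) (Npsi : nat) (alpha : R) (hpsi : is_wavelet psi Npsi alpha)
  (j : nat) (hj : (1 <= j)%N)
  (a : nat -> nat) (ha : is_scaling_factor H a j) :
  let W nu := wavelet_var psi B nu (a nu * 2 ^ j) in
  let EW nu := mx_expectation Pr (W nu) in
  (forall (q : 'I_n) (q' : 'I_n'),
     (\sum_(i < n' | (i < q')%N) sz i < q.+1
        <= \sum_(i < n' | (i <= q')%N) sz i)%N ->
     cvg_in_probability Pr (nu_infty a j)
       (fun nu w => log_ratio (lambda q (W nu w)) (a nu)%:R)
       (complex.Re (h q')) /\
     (fun nu => log_ratio (lambda q (EW nu)) (a nu)%:R) @ nu_infty a j
       --> complex.Re (h q')) /\
  (forall hr : 'I_n' -> R,
     n' = n ->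
     (forall i, h i = (hr i)%:C) ->
     (forall i1 i2 : 'I_n', (i1 < i2)%N -> hr i1 < hr i2) ->
     forall (q : 'I_n) (q' : 'I_n'), q = q' :> nat ->
     cvg_in_probability Pr (nu_infty a j)
       (fun nu w => log_ratio (lambda q (W nu w)) (a nu)%:R) (hr q') /\
     (fun nu => log_ratio (lambda q (EW nu)) (a nu)%:R) @ nu_infty a j
       --> hr q').
Proof.
move=> W EW; split.
  move=> q q' hqq; split.
    exact: (log_eigenvalue_W_cvg hB hBmeas hAre hAim hPunit hJordan hRe01 hRe_le hpsi ha hqq).
  exact: (log_eigenvalue_EW_cvg hB hBmeas hAre hAim hPunit hJordan hRe01 hRe_le hpsi ha hqq).
move=> hr nn hhr _ q q' qq.
have sz1 := block_size1 hsz_gt0 hsz nn.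
(* With n blocks of size 1 the partial sums at q' are q' and q' + 1, both indices counting from 0,
   so the second claim is a case of the first. *)
have hqq : (\sum_(i < n' | (i < q')%N) sz i < q.+1 <= \sum_(i < n' | (i <= q')%N) sz i)%N.
  have e k : (k <= n')%N -> (\sum_(i < n' | (i < k)%N) sz i)%N = k.
    by move=> kn; rewrite -[RHS](sum_ord_lt kn); apply: eq_bigr.
  have -> : (\sum_(i < n' | (i <= q')%N) sz i)%N = q'.+1 by exact: (e q'.+1 (ltn_ord q')).
  by rewrite (e q') ?qq ?ltnS ?leqnn // ltnW.
have -> : hr q' = complex.Re (h q') by rewrite hhr.
split.
  exact: (log_eigenvalue_W_cvg hB hBmeas hAre hAim hPunit hJordan hRe01 hRe_le hpsi ha hqq).
exact: (log_eigenvalue_EW_cvg hB hBmeas hAre hAim hPunit hJordan hRe01 hRe_le hpsi ha hqq).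
Qed.
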